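(* Fix an inverse temperature $\beta$, Hamiltonians $H_1,H_2$ with Gibbs states $\gamma_1,\gamma_2$, a state $\rho_1$ of the first system and an energy-incoherent state $\rho_2$ ($[\rho_2,\gamma_2]=0$) of the second. Consider a battery with energy gap $w=w_1n+w_2\sqrt n$ with constants $w_1,w_2$, and fix $\epsilon\in(0,1)$. Let $R_n^*(\epsilon)$ be the largest $R_n$ such that $\rho_1^{\otimes n}\otimes|0\rangle\langle0|_W\xrightarrow[\mathrm{TO}]{\epsilon}\rho_2^{\otimes R_nn}\otimes|1\rangle\langle1|_W$. Then $$R_n^*(\epsilon)=\frac{D(\rho_1\|\gamma_1)-\beta w_1}{D(\rho_2\|\gamma_2)}+\frac{\sqrt{V(\rho_1\|\gamma_1)}\,S^{-1}_{1/\xi'}(\epsilon)-\beta w_2}{\sqrt n\,D(\rho_2\|\gamma_2)}+o(1/\sqrt n),\qquad \xi'=\frac{V(\rho_1\|\gamma_1)}{D(\rho_1\|\gamma_1)-\beta w_1}\Big/\frac{V(\rho_2\|\gamma_2)}{D(\rho_2\|\gamma_2)}.$$ Moreover, when $\rho_2=\gamma_2$, any positive transformation rate is possible as long as $\frac{\beta w}{n}\le D(\rho_1\|\gamma_1)+\sqrt{\frac{V(\rho_1\|\gamma_1)}{n}}\Phi^{-1}(\epsilon)+o(1/\sqrt n)$.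
   Context: The battery $W$ is a two-level system with energy eigenstates $|0\rangle_W$, $|1\rangle_W$ separated by gap $w$ (energy of $|1\rangle$ minus energy of $|0\rangle$; $w>0$ is work extraction, $w<0$ work investment), Gibbs state $\frac{1}{1+e^{-\beta w}}|0\rangle\langle0|+\frac{e^{-\beta w}}{1+e^{-\beta w}}|1\rangle\langle1|$. A thermal operation (TO) is $\mathcal E(\rho)=\mathrm{Tr}_{B'}[U(\rho\otimes\gamma_B)U^\dagger]$ with $\gamma_B=e^{-\beta H_B}/Z_B$ a Gibbs bath state for arbitrary $H_B$, $U$ unitary commuting with the total Hamiltonian $H\otimes\mathbb1+\mathbb1\otimes H_B$, and $B'$ any subsystem; $\rho\xrightarrow[\mathrm{TO}]{\epsilon}\rho'$ means a TO outputs a state within trace distance $\epsilon$ ($T(\rho,\sigma)=\frac12\|\rho-\sigma\|_1$) of $\rho'$. Copies are non-interacting. $D(\rho\|\sigma)=\mathrm{Tr}\rho(\ln\rho-\ln\sigma)$, $V(\rho\|\sigma)=\mathrm{Tr}\rho(\ln\rho-\ln\sigma)^2-D(\rho\|\sigma)^2$ (natural logarithms). $\Phi$ is the standard normal cdf; $S_\nu(\mu)=\frac12\inf_{A\ge\Phi}\int|A'-\phi_{\mu,\nu}|$ over cdfs $A$ pointwise $\ge\Phi$, $\phi_{\mu,\nu}$ the $N(\mu,\nu)$ density, and $S_\nu^{-1}$ its inverse cdf. *)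

(* Defs.v *)
From HB Require Import structures.
From mathcomp Require Import all_boot all_order all_algebra.
From mathcomp Require Import all_classical all_reals all_analysis.
From mathcomp.real_closed Require Import complex mxtens.
From mathcomp Require Import normal_distribution.

Set Implicit Arguments.
Unset Strict Implicit.
Unset Printing Implicit Defensive.

Import Order.TTheory GRing.Theory Num.Theory.
Local Open Scope ring_scope.
Local Open Scope classical_set_scope.

Section QDefs.
Variable R : realType.
Local Notation C := R[i].

Definition dagger {m n} (A : 'M[C]_(m, n)) : 'M[C]_(n, m) := (map_mx (@conjc R) A)^T.
Definition rC (x : R) : C := x%:C%C.

Definition herm_mx {n} (A : 'M[C]_n) : Prop := dagger A = A.
Definition unitary_mx {m n} (U : 'M[C]_(m, n)) : Prop :=
  U *m dagger U = 1%:M /\ dagger U *m U = 1%:M.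

Definition psd_mx {n} (A : 'M[C]_n) : Prop :=
  herm_mx A /\ forall v : 'cV[C]_n, 0 <= (dagger v *m A *m v) 0 0.
Definition qstate {n} (rho : 'M[C]_n) : Prop := psd_mx rho /\ \tr rho = 1.

Definition spec_dec {n} (A : 'M[C]_n) (p : 'M[C]_n * 'rV[R]_n) : Prop :=
  unitary_mx p.1 /\ A = p.1 *m diag_mx (map_mx rC p.2) *m dagger p.1.
Definition spec_pick {n} (A : 'M[C]_n) : 'M[C]_n * 'rV[R]_n :=
  xget (1%:M, 0) (spec_dec A).
Definition mfun {n} (f : R -> R) (A : 'M[C]_n) : 'M[C]_n :=
  (spec_pick A).1 *m diag_mx (\row_i rC (f ((spec_pick A).2 0 i))) *m dagger (spec_pick A).1.

Definition mln {n} (A : 'M[C]_n) := mfun (@ln R) A.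
Definition mexp {n} (A : 'M[C]_n) := mfun (@expR R) A.

Definition trnorm {n} (X : 'M[C]_n) : R := complex.Re (\tr (mfun (fun x => `|x|) X)).
Definition tdist {n} (rho sigma : 'M[C]_n) : R := trnorm (rho - sigma) / 2.

Definition gibbs {n} (beta : R) (H : 'M[C]_n) : 'M[C]_n :=
  let E := mexp (- rC beta *: H) in (\tr E)^-1 *: E.

Definition relent {n} (rho sigma : 'M[C]_n) : R :=
  complex.Re (\tr (rho *m (mln rho - mln sigma))).
Definition relvar {n} (rho sigma : 'M[C]_n) : R :=
  let X := mln rho - mln sigma in
  complex.Re (\tr (rho *m (X *m X))) - relent rho sigma ^+ 2.

Definition ptr2 {m k} (A : 'M[C]_(m * k)) : 'M[C]_m :=
  \matrix_(i, j) \sum_(l < k) A (mxtens_index (i, l)) (mxtens_index (j, l)).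

Definition hsum {m k} (HA : 'M[C]_m) (HB : 'M[C]_k) : 'M[C]_(m * k) :=
  HA *t (1%:M : 'M[C]_k) + (1%:M : 'M[C]_m) *t HB.

(* Thermal operation (up to error eps) from system (dS, HS) in qstate rho to
   system (dO, HO) close to rho'.  Bath B with arbitrary Hamiltonian HB, the
   total space is split after the energy-conserving unitary_mx into the output
   system and the discarded subsystem B' (Hamiltonian HK). *)
Definition TO_eps {dS dO} (beta : R) (HS : 'M[C]_dS) (HO : 'M[C]_dO)
    (rho : 'M[C]_dS) (rho' : 'M[C]_dO) (eps : R) : Prop :=
  exists (dB : nat) (HB : 'M[C]_dB) (dK : nat) (HK : 'M[C]_dK)
         (U : 'M[C]_(dS * dB, dO * dK)),
    (0 < dB)%N /\ (0 < dK)%N /\ herm_mx HB /\ herm_mx HK /\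
    unitary_mx U /\
    dagger U *m hsum HS HB *m U = hsum HO HK /\
    tdist (ptr2 (dagger U *m (rho *t gibbs beta HB) *m U)) rho' <= eps.

Definition npow (d n : nat) : nat := iter n (muln d) 1%N.
Fixpoint tpow {d} (A : 'M[C]_d) (n : nat) : 'M[C]_(npow d n) :=
  match n with 0 => 1%:M | n'.+1 => A *t tpow A n' end.
Fixpoint hpow {d} (H : 'M[C]_d) (n : nat) : 'M[C]_(npow d n) :=
  match n with 0 => 0 | n'.+1 => hsum H (hpow H n') end.

Definition HW (w : R) : 'M[C]_2 := diag_mx (\row_(i < 2) rC (if i == 1 then w else 0)).
Definition ket0 : 'M[C]_2 := delta_mx 0 0.
Definition ket1 : 'M[C]_2 := delta_mx 1 1.

Definition achievable {d1 d2} (beta : R) (H1 : 'M[C]_d1) (H2 : 'M[C]_d2)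
    (rho1 : 'M[C]_d1) (rho2 : 'M[C]_d2) (w eps : R) (n m : nat) : Prop :=
  TO_eps beta (hsum (hpow H1 n) (HW w)) (hsum (hpow H2 m) (HW w))
    (tpow rho1 n *t ket0) (tpow rho2 m *t ket1) eps.

Definition Rstar {d1 d2} (beta : R) (H1 : 'M[C]_d1) (H2 : 'M[C]_d2)
    (rho1 : 'M[C]_d1) (rho2 : 'M[C]_d2) (w eps : R) (n : nat) : R :=
  sup [set (m%:R / n%:R) | m in [set m | achievable beta H1 H2 rho1 rho2 w eps n m]].

Definition Phi (x : R) : R :=
  fine (\int[@lebesgue_measure R]_(t in `]-oo, x]) (normal_pdf 0 1 t)%:E).

Definition dominating_density (a : R -> R) : Prop :=
  [/\ measurable_fun setT a, (forall t, 0 <= a t),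
      (\int[@lebesgue_measure R]_t (a t)%:E = 1)%E &
      forall x, Phi x <= fine (\int[@lebesgue_measure R]_(t in `]-oo, x]) (a t)%:E)].

(* S_nu(mu) = 1/2 inf_{A >= Phi} int |A' - phi_{mu,nu}|, nu = variance *)
Definition Sfun (nu mu : R) : R :=
  inf [set fine (\int[@lebesgue_measure R]_t
                   (`|a t - normal_pdf mu (Num.sqrt nu) t|)%:E) / 2
      | a in dominating_density].

Definition qinv (F : R -> R) (e : R) : R := inf [set mu | e <= F mu].

End QDefs.

(* Main.v *)
(* Write p for the Nussbaum-Szkola law r_i |<v_j|w_i>|^2 of (rho1, gamma1) and X = ln (r_i / s_j); under p^n the sum of the X's has mean n D1 and variance n V1. Let t and Y be the law and the log-likelihood ratio of the commuting pair (rho2, gamma2).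

   Achievability. If the distribution function of the input log-likelihood, shifted by the work, exceeds that of the output by at most e < eps, the two laws have a coupling of mass 1 - e which moves weight only towards smaller ratios t_k / gamma_k <= p_s / gamma_s. Such a coupling is realised, up to rounding, by a permutation inside the total energy shells of a lattice bath whose degeneracies grow like e^(beta E), so that Gibbs weights are constant on shells; a uniform register dephases the input. A coherent rho1^n is first written in an energy eigenbasis that diagonalises its pinching; since there are only polynomially many types this costs a factor n^O(1) in the likelihood ratio.

   Converse. Applying the quantum Neyman-Pearson bound on system plus bath to the test that the battery is excited and Y_1 + ... + Y_m0 > c compares the same two distribution functions at all m >= m0.

   Both bounds turn the optimal rate into the comparison of two central limit theorems. The largest shift mu for which Phi - N(mu, nu) stays below eps everywhere is S_nu^(-1)(eps): total variation to a law dominating Phi dominates that one-sided gap, and an explicit dominating density attains it. *)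

Require Import Defs.
From HB Require Import structures.
From mathcomp Require Import all_boot all_order all_algebra.
From mathcomp Require Import all_classical all_reals all_analysis.
From mathcomp.real_closed Require Import complex mxtens.
From mathcomp Require Import ring lra.
From mathcomp Require Import normal_distribution measurable_realfun.
From mathcomp Require Import perm.

Import Order.TTheory GRing.Theory Num.Theory.
Import numFieldNormedType.Exports.
Local Open Scope ring_scope.
Local Open Scope classical_set_scope.

Set Implicit Arguments.
Unset Strict Implicit.
Unset Printing Implicit Defensive.

(** Functional calculus is defined through an arbitrarily chosen diagonalisation, so every operator
    is put in the form [spf V d], and [mfun_spf] makes the choice harmless. Energies may be
    incommensurate and Boltzmann weights irrational: shells are therefore labelled by integer
    vectors rather than by energies, and degeneracies are rounded. The loss is paid from the strict
    inequality e < eps. Rates exactly at the threshold are never examined. For x below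
    S_nu^(-1)(eps) the limiting gap stays under some g < eps, for x above it the gap exceeds eps at
    some point, and each strict margin absorbs the errors of a central limit theorem without rate;
    the supremum in [Rstar] is then squeezed. The set of achievable copy numbers is not shown to be
    downward closed, so the converse must exclude all m >= m0 at once, hence a test that sees only
    m0 output copies. The shift tau is (d + 1) ln (n + 1): it beats the (n + 1)^d energy types and
    vanishes against sqrt n. In the second statement one error function has to serve all m and w; it
    comes from a diagonal argument. *)

Section LinearAlgebra.
Variable R : realType.
Local Notation C := (complex R).

(** * Daggers, unitaries, spectral forms and projections *)

Lemma daggerE m n (A : 'M[C]_(m, n)) i j : dagger A i j = conjc (A j i).
Proof. by rewrite !mxE. Qed.

Lemma daggerK m n (A : 'M[C]_(m, n)) : dagger (dagger A) = A.
Proof. by apply/matrixP => i j; rewrite !daggerE conjcK. Qed.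

Lemma daggerM m n p (A : 'M[C]_(m, n)) (B : 'M[C]_(n, p)) :
  dagger (A *m B) = dagger B *m dagger A.
Proof. by rewrite /dagger map_mxM trmx_mul. Qed.

Lemma daggerB m n (A B : 'M[C]_(m, n)) : dagger (A - B) = dagger A - dagger B.
Proof. by rewrite /dagger map_mxB linearB. Qed.

Lemma dagger1 n : dagger (1%:M : 'M[C]_n) = 1%:M.
Proof. by rewrite /dagger map_mx1 trmx1. Qed.

Lemma dagger_tens m n p q (A : 'M[C]_(m, n)) (B : 'M[C]_(p, q)) :
  dagger (A *t B) = dagger A *t dagger B.
Proof. by rewrite /dagger map_mxT trmx_tens. Qed.

Lemma unitary_mul m n p (A : 'M[C]_(m, n)) (B : 'M[C]_(n, p)) :
  unitary_mx A -> unitary_mx B -> unitary_mx (A *m B).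
Proof.
move=> [A1 A2] [B1 B2]; split; rewrite daggerM mulmxA.
  by rewrite -[A *m B *m _]mulmxA B1 mulmx1.
by rewrite -[_ *m _ *m A]mulmxA A2 mulmx1.
Qed.

Lemma unitary_dagger m n (A : 'M[C]_(m, n)) :
  unitary_mx A -> unitary_mx (dagger A).
Proof. by move=> [A1 A2]; split; rewrite daggerK. Qed.

Lemma unitary1 n : unitary_mx (1%:M : 'M[C]_n).
Proof. by split; rewrite dagger1 mulmx1. Qed.

Lemma tens11 m n : (1%:M : 'M[C]_m) *t (1%:M : 'M[C]_n) = 1%:M.
Proof.
apply/matrixP => i j; case: (mxtens_indexP i) => i1 i2; case: (mxtens_indexP j) => j1 j2.
rewrite tensmxE !mxE (can_eq (@mxtens_indexK _ _)) xpair_eqE.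
by case: eqP => _; rewrite ?mul0r // mul1r.
Qed.

Lemma unitary_tens m n p q (A : 'M[C]_(m, n)) (B : 'M[C]_(p, q)) :
  unitary_mx A -> unitary_mx B -> unitary_mx (A *t B).
Proof.
by move=> [A1 A2] [B1 B2]; split; rewrite dagger_tens tensmx_mul ?A1 ?A2 ?B1 ?B2 tens11.
Qed.

Definition dg n (d : 'I_n -> R) : 'M[C]_n := diag_mx (\row_i rC (d i)).

(** The shape of [V] is rectangular because conjugation by the unitary of [TO_eps], whose two
    dimensions agree only as a consequence of unitarity, changes the row type. *)
Definition spf m n (V : 'M[C]_(m, n)) (d : 'I_n -> R) : 'M[C]_m :=
  V *m dg d *m dagger V.

Lemma rC_conj (x : R) : conjc (rC x) = rC x.
Proof. exact: conjc_real. Qed.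

Lemma rCM (x y : R) : rC (x * y) = rC x * rC y.
Proof. by rewrite /rC rmorphM. Qed.
Lemma rCD (x y : R) : rC (x + y) = rC x + rC y.
Proof. by rewrite /rC rmorphD. Qed.
Lemma rCN (x : R) : rC (- x) = - rC x.
Proof. by rewrite /rC rmorphN. Qed.
Lemma rC0 : rC (0 : R) = 0. Proof. by []. Qed.
Lemma rC1 : rC (1 : R) = 1. Proof. by []. Qed.
Lemma rC_inj : injective (@rC R).
Proof. by move=> x y [->]. Qed.
Lemma rC_sum (I : Type) (r : seq I) P (F : I -> R) :
  rC (\sum_(i <- r | P i) F i) = \sum_(i <- r | P i) rC (F i).
Proof. by rewrite /rC rmorph_sum. Qed.
Lemma rC_Re (x : R) : complex.Re (rC x) = x. Proof. by []. Qed.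

Lemma Re_sum (I : Type) (r : seq I) P (F : I -> C) :
  complex.Re (\sum_(i <- r | P i) F i) = \sum_(i <- r | P i) complex.Re (F i).
Proof. by rewrite raddf_sum. Qed.

Lemma Re_rCM (x : R) (z : C) : complex.Re (rC x * z) = x * complex.Re z.
Proof. by case: z => a b; rewrite /rC /= mul0r subr0. Qed.

Lemma dgE n (d : 'I_n -> R) i j : dg d i j = rC (d i) *+ (i == j).
Proof. by rewrite !mxE; case: eqP => [->|]. Qed.

Lemma dagger_dg n (d : 'I_n -> R) : dagger (dg d) = dg d.
Proof.
apply/matrixP => i j; rewrite daggerE !dgE eq_sym; case: eqP => [->|_].
  by rewrite !mulr1n rC_conj.
by rewrite !mulr0n rmorph0.
Qed.

Lemma dgM n (d e : 'I_n -> R) : dg d *m dg e = dg (fun i => d i * e i).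
Proof.
by rewrite /dg mulmx_diag; congr diag_mx; apply/rowP => i; rewrite !mxE rCM.
Qed.

Lemma mul_dgE m n (A : 'M[C]_(m, n)) d i j : (A *m dg d) i j = A i j * rC (d j).
Proof. by rewrite /dg mul_mx_diag !mxE. Qed.
Lemma dg_mulE m n (A : 'M[C]_(m, n)) d i j : (dg d *m A) i j = rC (d i) * A i j.
Proof. by rewrite /dg mul_diag_mx !mxE. Qed.

Lemma tr_dg n (d : 'I_n -> R) : \tr (dg d) = rC (\sum_i d i).
Proof. by rewrite rC_sum; apply: eq_bigr => i _; rewrite dgE eqxx mulr1n. Qed.

Lemma herm_spf m n (V : 'M[C]_(m, n)) d : herm_mx (spf V d).
Proof. by rewrite /herm_mx /spf !daggerM daggerK dagger_dg mulmxA. Qed.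

Lemma tr_spf m n (V : 'M[C]_(m, n)) d : unitary_mx V ->
  \tr (spf V d) = rC (\sum_i d i).
Proof. by move=> [_ V2]; rewrite /spf mxtrace_mulC mulmxA V2 mul1mx tr_dg. Qed.

Lemma tr_spfM m n (V : 'M[C]_(m, n)) d (M : 'M[C]_m) :
  \tr (spf V d *m M) = \sum_i rC (d i) * (dagger V *m M *m V) i i.
Proof.
rewrite /spf -mulmxA -mulmxA mxtrace_mulC -!mulmxA; apply: eq_bigr => i _.
by rewrite dg_mulE.
Qed.

Lemma spfM m n (V : 'M[C]_(m, n)) d e : unitary_mx V ->
  spf V d *m spf V e = spf V (fun i => d i * e i).
Proof.
move=> [_ V2]; rewrite /spf !mulmxA -[_ *m dagger V *m V]mulmxA V2 mulmx1.
by rewrite -[V *m dg d *m dg e]mulmxA dgM.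
Qed.

Lemma spfB m n (V : 'M[C]_(m, n)) d e :
  spf V d - spf V e = spf V (fun i => d i - e i).
Proof.
rewrite /spf -mulmxBl -mulmxBr; congr (_ *m _ *m _).
by apply/matrixP => i j; rewrite [LHS]mxE [X in _ + X]mxE !dgE rCD rCN mulrnDl mulNrn.
Qed.

Lemma spfZ m n (V : 'M[C]_(m, n)) d (x : R) :
  rC x *: spf V d = spf V (fun i => x * d i).
Proof.
rewrite /spf scalemxAl scalemxAr; congr (_ *m _ *m _).
by apply/matrixP => i j; rewrite [LHS]mxE !dgE rCM mulrnAr.
Qed.

Lemma eq_spf m n (V : 'M[C]_(m, n)) d e : d =1 e -> spf V d = spf V e.
Proof. by move=> /funext ->. Qed.

Lemma spf1 m n (V : 'M[C]_(m, n)) : unitary_mx V -> spf V (fun=> 1) = 1%:M.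
Proof.
move=> [V1 _]; rewrite /spf (_ : dg _ = 1%:M) ?mulmx1 //.
by apply/matrixP => i j; rewrite dgE !mxE.
Qed.

(** Commuting matrices are triangularised by one unitary; a triangular Hermitian matrix is diagonal
    with real entries. *)
Lemma herm_codiag n (A B : 'M[C]_n) : herm_mx A -> herm_mx B ->
  A *m B = B *m A ->
  exists (V : 'M[C]_n) (a b : 'I_n -> R),
    [/\ unitary_mx V, A = spf V a & B = spf V b].
Proof.
move=> hA hB AB.
have [P Pu /andP[PA PB]] := cotrigonalization2 AB.
have Punit := unitarymx_unit Pu.
have dP : (map_mx Num.conj P^T) = dagger P by rewrite /dagger map_trmx.
have P1 : P *m dagger P = 1%:M by rewrite -dP; apply/unitarymxP.
have P2 : dagger P *m P = 1%:M by apply: mulmx1C.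
have key X : herm_mx X -> similar_trig P X ->
    exists a : 'I_n -> R, X = spf (dagger P) a.
  move=> hX; rewrite /similar_to conjymx // dP => tX.
  pose Y := P *m X *m dagger P.
  have hY : dagger Y = Y by rewrite /Y !daggerM daggerK hX mulmxA.
  exists (fun i => complex.Re (Y i i)); rewrite /spf daggerK.
  have -> : dg (fun i => complex.Re (Y i i)) = Y.
    apply/matrixP => i j; rewrite dgE.
    case: (ltngtP i j) => [ij|ij|/val_inj ->].
    - move/is_trig_mxP : tX => /(_ i j ij); rewrite -/Y => ->.
      by rewrite -val_eqE (ltn_eqF ij).
    - move/is_trig_mxP : tX => /(_ j i ij); rewrite -/Y => e.
      by rewrite -hY daggerE e conjc0 -val_eqE (gtn_eqF ij).
    rewrite eqxx mulr1n.
    have := congr1 (fun Z : 'M[C]_n => Z j j) hY; rewrite daggerE.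
    case: (Y j j) => x y /= [] /eqP; rewrite /rC.
    by rewrite -subr_eq0 -opprD oppr_eq0 -mulr2n mulrn_eq0 /= => /eqP ->.
  by rewrite /Y !mulmxA P2 mul1mx -mulmxA P2 mulmx1.
have [a Aa] := key _ hA PA; have [b Bb] := key _ hB PB.
by exists (dagger P), a, b; split => //; split; rewrite daggerK.
Qed.

Lemma herm_diag n (A : 'M[C]_n) : herm_mx A ->
  exists (V : 'M[C]_n) (a : 'I_n -> R), unitary_mx V /\ A = spf V a.
Proof.
move=> hA; have [|V [a [b [uV Aa _]]]] := herm_codiag hA hA; first by [].
by exists V, a.
Qed.

(** Two diagonalisations of one matrix are intertwined by [U], whose entry at (i, j) vanishes unless
    the i-th and j-th eigenvalues agree; hence f of the eigenvalues can be moved through [U] as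
    well. *)
Lemma mfun_spf m n (f : R -> R) (V : 'M[C]_(m, n)) (d : 'I_n -> R) :
  unitary_mx V -> Defs.mfun f (spf V d) = spf V (f \o d).
Proof.
move=> uV; set A := spf V d.
have [W [a [uW AW]]] : exists (W : 'M[C]_m) (a : 'I_m -> R),
  unitary_mx W /\ A = spf W a by apply/herm_diag/herm_spf.
have : spec_dec A (spec_pick A).
  rewrite /spec_pick; apply: (@xgetPex _ _ (spec_dec A)).
  exists (W, \row_i a i); split => //=; rewrite AW /spf /dg; congr (_ *m diag_mx _ *m _).
  by apply/rowP => i; rewrite !mxE.
rewrite /Defs.mfun; case: (spec_pick A) => [W' a'] [/= uW'].
have -> : map_mx (@rC R) a' = \row_i rC (a' 0 i) by apply/rowP => i; rewrite !mxE.
rewrite -/(dg (a' 0)) -/(spf W' (a' 0)) -/(dg (fun i => f (a' 0 i))) => E.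
set U := dagger W' *m V.
have UE : dg (a' 0) *m U = U *m dg d.
  have : dagger W' *m A *m V = dagger W' *m A *m V by [].
  rewrite {1}E /A /spf !mulmxA uW'.2 mul1mx -[_ *m dagger V *m V]mulmxA uV.2 mulmx1.
  by move=> ->.
have UfE : dg (fun i => f (a' 0 i)) *m U = U *m dg (f \o d).
  apply/matrixP => i j; have := congr1 (fun Z : 'M[C]_(_, _) => Z i j) UE.
  rewrite /= !dg_mulE !mul_dgE mulrC => /eqP; rewrite -subr_eq0 -mulrBr mulf_eq0.
  case/orP => [/eqP -> |]; first by rewrite mul0r mulr0.
  by rewrite subr_eq0 => /eqP/rC_inj ->; rewrite mulrC.
rewrite /spf.
have -> : dagger W' = U *m dagger V by rewrite /U -mulmxA uV.1 mulmx1.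
rewrite -[W' *m _ *m _]mulmxA (mulmxA (dg _)) UfE /U !mulmxA uW'.1 mul1mx.
by [].
Qed.

Definition nsq (z : C) : R := complex.Re z ^+ 2 + complex.Im z ^+ 2.

Lemma nsqE (z : C) : conjc z * z = rC (nsq z).
Proof. by case: z => a b; rewrite /rC /nsq /=; simpc; congr (_ +i* _)%C; ring. Qed.

Lemma nsq_ge0 z : 0 <= nsq z.
Proof. by rewrite addr_ge0 ?sqr_ge0. Qed.

Lemma nsq0 : nsq 0 = 0. Proof. by rewrite /nsq /= expr0n /= addr0. Qed.

Lemma nsqM z w : nsq (z * w) = nsq z * nsq w.
Proof. by case: z => a b; case: w => c d; rewrite /nsq /=; ring. Qed.

Lemma nsq_conj z : nsq (conjc z) = nsq z.
Proof. by case: z => a b; rewrite /nsq /= sqrrN. Qed.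

(* The weight xy/(x+y) is close to min(x,y) when x and y have very different sizes. *)
Lemma nsq_harmonic (x y : R) z w : 0 <= x -> 0 < y ->
  x * y / (x + y) * nsq (z + w) <= x * nsq z + y * nsq w.
Proof.
move=> x0 y0; have xy : 0 < x + y by lra.
rewrite mulrAC ler_pdivrMr // -subr_ge0.
case: z => a b; case: w => c d; rewrite /nsq /=.
rewrite (_ : _ - _ = (x * a - y * c) ^+ 2 + (x * b - y * d) ^+ 2); last by ring.
by rewrite addr_ge0 ?sqr_ge0.
Qed.

Lemma dagger_mul_diag m n (A : 'M[C]_(m, n)) i :
  (dagger A *m A) i i = rC (\sum_j nsq (A j i)).
Proof. by rewrite mxE rC_sum; apply: eq_bigr => j _; rewrite daggerE nsqE. Qed.

Lemma unitary_col m n (V : 'M[C]_(m, n)) i : unitary_mx V ->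
  \sum_j nsq (V j i) = 1.
Proof.
move=> [_ V2]; apply: rC_inj; rewrite -dagger_mul_diag V2 mxE eqxx.
by rewrite rC1.
Qed.

Lemma unitary_row m n (V : 'M[C]_(m, n)) i : unitary_mx V ->
  \sum_j nsq (V i j) = 1.
Proof.
move=> /unitary_dagger /unitary_col => /(_ i) <-.
by apply: eq_bigr => j _; rewrite daggerE nsq_conj.
Qed.

Definition proj_mx n (T : 'M[C]_n) := herm_mx T /\ T *m T = T.

Lemma proj_compl n (T : 'M[C]_n) : proj_mx T -> proj_mx (1%:M - T).
Proof.
move=> [hT TT]; split; first by rewrite /herm_mx daggerB dagger1 hT.
by rewrite mulmxBl mul1mx mulmxBr mulmx1 TT subrr subr0.
Qed.

Lemma proj_conj m n (T : 'M[C]_n) (U : 'M[C]_(m, n)) : unitary_mx U ->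
  proj_mx T -> proj_mx (U *m T *m dagger U).
Proof.
move=> [_ U2] [hT TT]; split; first by rewrite /herm_mx !daggerM daggerK hT mulmxA.
by rewrite !mulmxA -[_ *m dagger U *m U]mulmxA U2 mulmx1 -[U *m T *m T]mulmxA TT.
Qed.

(** Since T is its own square and its own adjoint, the quadratic form is the squared norm of T v_i,
    which Parseval expands in the basis [W]. *)
Lemma proj_quad m n k (T : 'M[C]_m) (V : 'M[C]_(m, n)) (W : 'M[C]_(m, k)) i :
  proj_mx T -> unitary_mx W ->
  (dagger V *m T *m V) i i = rC (\sum_j nsq ((dagger W *m T *m V) j i)).
Proof.
move=> [hT TT] [W1 _]; rewrite -dagger_mul_diag.
congr (fun_of_matrix _ i i).
rewrite !daggerM daggerK hT !mulmxA -[_ *m W *m dagger W]mulmxA W1 mulmx1.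
by rewrite -[_ *m T *m T]mulmxA TT.
Qed.

(* Quantum Neyman-Pearson bound in terms of the joint law r_i |<j|i>|^2 of the two eigenbases. *)
Lemma test_bound m n k (V : 'M[C]_(m, n)) (W : 'M[C]_(m, k)) r s (M : 'M[C]_m)
    (l : R) :
  unitary_mx V -> unitary_mx W -> (forall i, 0 <= r i) -> (forall j, 0 < s j) ->
  proj_mx M -> 0 < l ->
  \sum_i \sum_j nsq ((dagger W *m V) j i) * (r i * (l * s j) / (r i + l * s j))
  <= complex.Re (\tr (spf V r *m (1%:M - M))) + l * complex.Re (\tr (spf W s *m M)).
Proof.
move=> uV uW r0 s0 pM l0.
have pN := proj_compl pM.
rewrite !tr_spfM !Re_sum mulr_sumr.
have -> : \sum_i complex.Re (rC (r i) * (dagger V *m (1%:M - M) *m V) i i) =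
    \sum_i \sum_j r i * nsq ((dagger W *m (1%:M - M) *m V) j i).
  by apply: eq_bigr => i _; rewrite (proj_quad _ _ pN uW) Re_rCM rC_Re mulr_sumr.
have -> : \sum_i l * complex.Re (rC (s i) * (dagger W *m M *m W) i i) =
    \sum_i \sum_j l * s j * nsq ((dagger W *m M *m V) j i).
  rewrite exchange_big /=; apply: eq_bigr => j _.
  rewrite (proj_quad _ _ pM uV) Re_rCM rC_Re mulrA mulr_sumr.
  apply: eq_bigr => i _; congr (_ * _).
  rewrite -nsq_conj -daggerE !daggerM daggerK pM.1.
  by rewrite mulmxA.
rewrite -big_split /=; apply: ler_sum => i _.
rewrite -big_split /=; apply: ler_sum => j _.
rewrite mulrC.
(* The overlap is split into its parts through [1 - M] and [M], the two numbers of
   [nsq_harmonic]. *)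
have -> : (dagger W *m V) j i =
    (dagger W *m (1%:M - M) *m V) j i + (dagger W *m M *m V) j i.
  by rewrite mulmxBr mulmx1 mulmxBl !mxE subrK.
by apply: nsq_harmonic => //; rewrite mulr_gt0.
Qed.

Lemma trnorm_spf m n (V : 'M[C]_(m, n)) d : unitary_mx V ->
  trnorm (spf V d) = \sum_i `|d i|.
Proof. by move=> uV; rewrite /trnorm mfun_spf // tr_spf. Qed.

Lemma tdist_spf m n (V : 'M[C]_(m, n)) a b : unitary_mx V ->
  tdist (spf V a) (spf V b) = (\sum_i `|a i - b i|) / 2.
Proof. by move=> uV; rewrite /tdist spfB trnorm_spf. Qed.

(** The eigenvalues of [s - t] sum to 0, so half the trace norm is the sum of their negative parts;
    T collects each of them with a weight q in [0, 1]. *)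
Lemma tdist_proj n (s t T : 'M[C]_n) : herm_mx s -> herm_mx t ->
  \tr s = \tr t -> proj_mx T ->
  complex.Re (\tr (t *m T)) - complex.Re (\tr (s *m T)) <= tdist s t.
Proof.
move=> hs ht st pT; rewrite /tdist.
have hX : herm_mx (s - t) by rewrite /herm_mx daggerB hs ht.
have [V [x [uV E]]] := herm_diag hX.
rewrite E trnorm_spf //.
have x0 : \sum_i x i = 0.
  by apply: rC_inj; rewrite -(tr_spf x uV) -E linearB /= st subrr.
have -> : complex.Re (\tr (t *m T)) - complex.Re (\tr (s *m T)) =
    - complex.Re (\tr ((s - t) *m T)).
  by rewrite mulmxBl linearB /= raddfB opprB.
rewrite E tr_spfM Re_sum.
have -> : (\sum_i `|x i|) / 2 = \sum_i (`|x i| - x i) / 2.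
  by rewrite -mulr_suml sumrB x0 subr0.
rewrite -sumrN; apply: ler_sum => i _.
rewrite (proj_quad _ _ pT (unitary1 n)).
rewrite Re_rCM rC_Re.
set q := \sum_j _.
have q0 : 0 <= q by apply: sumr_ge0 => j _; apply: nsq_ge0.
have q1 : q <= 1.
  have pN := proj_compl pT.
  have h := (proj_quad V i pN (unitary1 n)).
  have h' := (proj_quad V i pT (unitary1 n)).
  have : rC 1 = rC (q + \sum_j nsq ((dagger 1%:M *m (1%:M - T) *m V) j i)).
    have -> : rC 1 = (dagger V *m T *m V + dagger V *m (1%:M - T) *m V) i i.
      by rewrite -mulmxDl -mulmxDr addrC subrK mulmx1 uV.2 mxE eqxx.
    by rewrite mxE h h' rCD.
  move/rC_inj => ->; rewrite lerDl; apply: sumr_ge0 => j _; exact: nsq_ge0.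
case: (lerP 0 (x i)) => xi; first by rewrite ger0_norm //; nra.
by rewrite ltr0_norm //; nra.
Qed.

End LinearAlgebra.

(** * Sums of independent variables and Stein's leave-one-out argument *)

Section IidSums.
Variables (R : realType) (T : finType) (p : T -> R).

(** Expectation of g at the sum of n independent copies of f under p. The recursion shifts the
    argument of g, which avoids product spaces. *)
Fixpoint Ex (f : T -> R) n (g : R -> R) : R :=
  match n with
  | 0 => g 0
  | n'.+1 => \sum_t p t * Ex f n' (fun s => g (f t + s))
  end.

Hypotheses (p0 : forall t, 0 <= p t) (p1 : \sum_t p t = 1).

Implicit Types (f : T -> R) (g h : R -> R).

Lemma eq_Ex f n g h : g =1 h -> Ex f n g = Ex f n h.
Proof. by move=> /funext ->. Qed.

Lemma ExD f n g h : Ex f n (fun s => g s + h s) = Ex f n g + Ex f n h.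
Proof.
elim: n g h => //= n IH g h; rewrite -big_split /=.
by apply: eq_bigr => t _; rewrite -mulrDr -IH.
Qed.

Lemma ExZ f n a g : Ex f n (fun s => a * g s) = a * Ex f n g.
Proof.
elim: n g => //= n IH g; rewrite mulr_sumr.
by apply: eq_bigr => t _; rewrite IH mulrCA.
Qed.

Lemma ExN f n g : Ex f n (fun s => - g s) = - Ex f n g.
Proof.
by rewrite -mulN1r -ExZ; apply: eq_Ex => s; rewrite mulN1r.
Qed.

Lemma ExB f n g h : Ex f n (fun s => g s - h s) = Ex f n g - Ex f n h.
Proof. by rewrite -ExN -ExD. Qed.

Lemma le_Ex f n g h : (forall s, g s <= h s) -> Ex f n g <= Ex f n h.
Proof.
elim: n g h => [|n IH] g h gh /=; first exact: gh.
by apply: ler_sum => t _; apply: ler_wpM2l => //; apply: IH => s; apply: gh.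
Qed.

Lemma Ex_cst f n a : Ex f n (fun=> a) = a.
Proof. by elim: n => //= n IH; rewrite -mulr_suml p1 mul1r. Qed.

Lemma Ex_norm f n g : `|Ex f n g| <= Ex f n (fun s => `|g s|).
Proof.
rewrite ler_norml -ExN; apply/andP; split; apply: le_Ex => s; last exact: ler_norm.
by rewrite lerNl -normrN ler_norm.
Qed.

Lemma Ex_affine f n a b g :
  Ex (fun t => a * f t + b) n g = Ex f n (fun s => g (a * s + n%:R * b)).
Proof.
elim: n g => [|n IH] g /=; first by rewrite mulr0 mul0r addr0.
apply: eq_bigr => t _; congr (_ * _); rewrite IH; apply: eq_Ex => s; congr g.
by rewrite -natr1; ring.
Qed.

(** Exchangeability: each of the n + 1 summands contributes the same amount to the mean of S
    g(S). *)
Lemma Ex_exch f n g : Ex f n.+1 (fun s => s * g s) =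
  n.+1%:R * \sum_t p t * f t * Ex f n (fun s => g (f t + s)).
Proof.
elim: n g => [|n IH] g.
  rewrite mul1r /=; apply: eq_bigr => t _; rewrite addr0; ring.
rewrite [LHS]/=; under eq_bigr => t _ do rewrite -[\sum_t0 _]/(Ex f n.+1 (fun s => (f t + s) * g (f t + s))).
have step t : Ex f n.+1 (fun s => (f t + s) * g (f t + s)) =
   f t * Ex f n.+1 (fun s => g (f t + s)) +
   n.+1%:R * \sum_u p u * f u * Ex f n (fun s => g (f t + (f u + s))).
  rewrite -(IH (fun s => g (f t + s))) -ExZ -ExD.
  by apply: eq_Ex => s; rewrite mulrDl.
under eq_bigr => t _ do rewrite step mulrDr mulrA.
rewrite big_split /= -[n.+2%:R]natr1 mulrDl mul1r addrC; congr (_ + _).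
rewrite mulr_sumr.
under eq_bigr => t _ do rewrite mulrCA mulr_sumr mulr_sumr.
rewrite exchange_big /=; apply: eq_bigr => u _.
rewrite mulr_sumr mulr_sumr; apply: eq_bigr => t _.
rewrite (eq_Ex _ _ (h := fun s => g (f u + (f t + s)))) => [|s]; first by ring.
by rewrite addrCA.
Qed.

Lemma Ex_mean f n : Ex f n id = n%:R * \sum_t p t * f t.
Proof.
elim: n => [|n IH] /=; first by rewrite mul0r.
under eq_bigr => t _ do rewrite ExD Ex_cst IH mulrDr.
by rewrite big_split /= -mulr_suml p1 mul1r -natr1 mulrDl mul1r addrC.
Qed.

Lemma Ex_second f n : \sum_t p t * f t = 0 ->
  Ex f n (fun s => s ^+ 2) = n%:R * \sum_t p t * f t ^+ 2.
Proof.
move=> m0; elim: n => [|n IH]; first by rewrite /= mul0r expr0n.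
rewrite /=; have E t : Ex f n (fun s => (f t + s) ^+ 2) =
    f t ^+ 2 + n%:R * \sum_u p u * f u ^+ 2.
  rewrite -IH -[X in X + _](Ex_cst f n) -[RHS]addr0.
  have <- : (2 * f t) * Ex f n id = 0 by rewrite Ex_mean m0 !mulr0.
  by rewrite -ExZ -!ExD; apply: eq_Ex => s; ring.
under eq_bigr => t _ do rewrite E mulrDr.
by rewrite big_split /= -mulr_suml p1 mul1r -natr1 mulrDl mul1r addrC.
Qed.

Section Stein.
Variables (f : T -> R) (B : R).
Hypotheses (m0 : \sum_t p t * f t = 0) (v1 : \sum_t p t * f t ^+ 2 = 1).
Hypotheses (fB : forall t, `|f t| <= B).
Variables (F F' : R -> R) (K : R).
Hypotheses (K0 : 0 <= K)
  (F1 : forall x y, `|F y - F x - (y - x) * F' x| <= K * (1 + `|x| + `|y|) * (y - x) ^+ 2)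
  (F2 : forall x y, `|F' y - F' x| <= K * (1 + `|x| + `|y|) * `|y - x|).

Lemma Ex_abs_le1 N (a : R) : 0 <= a -> a ^+ 2 * N%:R <= 1 ->
  Ex f N (fun s => `|a * s|) <= 1.
Proof.
move=> a0 aN; have -> : (1 : R) = 2^-1 * (1 + 1) by field.
apply: (@le_trans _ _ (Ex f N (fun s => 2^-1 * (1 + a ^+ 2 * s ^+ 2)))).
  apply: le_Ex => s; rewrite -exprMn -[X in _ <= _ * (1 + X)]real_normK ?num_real //.
  have := sqr_ge0 (`|a * s| - 1); nra.
by rewrite ExZ ExD Ex_cst ExZ Ex_second // v1 mulr1; lra.
Qed.

(** Let W' be the normalised sum without one summand. Exchangeability turns the mean of w F(w) into
    an average of f t F(W' + a f t); by mean 0 and variance 1 its first-order term is the mean of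
    F'(W'), and F2 replaces W' by w. *)
Lemma stein_bound n : `|Ex f n.+1 (fun s =>
    let w := (Num.sqrt n.+1%:R)^-1 * s in F' w - w * F w)|
  <= (Num.sqrt n.+1%:R)^-1 * (K * (3 + B) * (B + B ^+ 3)).
Proof.
set a := (Num.sqrt n.+1%:R)^-1.
have n0 : 0 < n.+1%:R :> R by [].
have a0 : 0 < a by rewrite invr_gt0 sqrtr_gt0.
have a2 : a ^+ 2 * n.+1%:R = 1.
  by rewrite exprVn sqr_sqrtr ?ltW // mulVf // gt_eqF.
have aN : a ^+ 2 * n%:R <= 1.
  by rewrite -[leRHS]a2; apply: ler_wpM2l; rewrite ?sqr_ge0 // ler_nat.
have a1 : a <= 1.
  by rewrite /a invf_le1 ?sqrtr_gt0 // -[X in X <= _]sqrtr1 ler_sqrt // ler1n.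
have B0 : 0 <= B.
  have [t _|nT] := pickP (@predT T); first exact: le_trans (normr_ge0 _) (fB t).
  by move: p1; rewrite big_pred0 // => /esym/eqP; rewrite oner_eq0.
(* The growth factors in F1 and F2 are linear in |W'|, and the mean of |W'| is at most 1. *)
have EW : Ex f n (fun s => 1 + `|a * s| * 2 + B) <= 3 + B.
  rewrite !ExD !Ex_cst (eq_Ex _ _ (h := fun s => 2 * `|a * s|)); last by move=> s; rewrite mulrC.
  have := Ex_abs_le1 (ltW a0) aN; rewrite ExZ; lra.
have nrm t s : 1 + `|a * s| + `|a * (f t + s)| <= 1 + `|a * s| * 2 + B.
  have : `|a * (f t + s)| <= `|a * f t| + `|a * s| by rewrite mulrDr ler_normD.
  have : `|a * f t| <= B.
    rewrite normrM gtr0_norm // (le_trans _ (fB t)) // ler_piMl //.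
  lra.
have Kpos s : 0 <= 1 + `|a * s| * 2 + B by rewrite !addr_ge0 // mulr_ge0.
have daf t s : a * (f t + s) - a * s = a * f t by ring.
have -> : Ex f n.+1 (fun s => let w := a * s in F' w - w * F w) =
  \sum_t p t * Ex f n (fun s => F' (a * (f t + s)) - F' (a * s))
  - a * n.+1%:R * \sum_t p t * f t * Ex f n
     (fun s => F (a * (f t + s)) - F (a * s) - (a * f t) * F' (a * s)).
  rewrite [LHS]ExB /=.
  have -> : \sum_t p t * Ex f n (fun s => a * (f t + s) * F (a * (f t + s))) =
     a * n.+1%:R * \sum_t p t * f t * Ex f n (fun s => F (a * (f t + s))).
    rewrite -mulrA -(Ex_exch f n (fun s => F (a * s))) -ExZ /=.
    by apply: eq_bigr => t _; congr (_ * _); apply: eq_Ex => s; rewrite mulrA.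
  have -> : \sum_t p t * Ex f n (fun s => F' (a * (f t + s)) - F' (a * s)) =
    \sum_t p t * Ex f n (fun s => F' (a * (f t + s))) - Ex f n (fun s => F' (a * s)).
    under eq_bigr => t _ do rewrite ExB mulrBr.
    by rewrite sumrB -mulr_suml p1 mul1r.
  have -> : \sum_t p t * f t * Ex f n
     (fun s => F (a * (f t + s)) - F (a * s) - (a * f t) * F' (a * s)) =
    \sum_t p t * f t * Ex f n (fun s => F (a * (f t + s))) - a * Ex f n (fun s => F' (a * s)).
    under eq_bigr => t _ do rewrite ExB ExB ExZ !mulrBr.
    rewrite !sumrB -mulr_suml m0 mul0r subr0; congr (_ - _).
    transitivity (\sum_t (p t * f t ^+ 2) * (a * Ex f n (fun s => F' (a * s)))).
      by apply: eq_bigr => t _; ring.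
    by rewrite -mulr_suml v1 mul1r.
  rewrite mulrBr !mulrA -[a * _ * a]mulrA [n.+1%:R * a]mulrC mulrA -expr2 a2 mul1r.
  by rewrite opprB addrA subrK.
have D1 : `|\sum_t p t * Ex f n (fun s => F' (a * (f t + s)) - F' (a * s))| <=
    a * (K * (3 + B) * B).
  rewrite (le_trans (ler_norm_sum _ _ _)) // -[leRHS]mul1r -[X in _ <= X * _]p1 mulr_suml.
  apply: ler_sum => t _; rewrite normrM ger0_norm // ler_wpM2l //.
  apply: (le_trans (Ex_norm _ _ _)).
  apply: (@le_trans _ _ (Ex f n (fun s => (a * K * B) * (1 + `|a * s| * 2 + B)))).
    apply: le_Ex => s; apply: (le_trans (F2 _ _)); rewrite daf [`|a * f t|]normrM (gtr0_norm a0).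
    apply: (@le_trans _ _ ((K * (1 + `|a * s| * 2 + B)) * (a * B))); last first.
      by rewrite le_eqVlt; apply/orP; left; apply/eqP; ring.
    apply: ler_pM; rewrite ?ler_wpM2l ?nrm ?(ltW a0) ?fB //.
      by rewrite mulr_ge0 ?addr_ge0.
    by rewrite mulr_ge0 // ltW.
  rewrite ExZ [leRHS](_ : _ = a * K * B * (3 + B)); last by ring.
  by rewrite ler_wpM2l // !mulr_ge0 // ltW.
have D2 : `|\sum_t p t * f t * Ex f n
     (fun s => F (a * (f t + s)) - F (a * s) - (a * f t) * F' (a * s))| <=
    a ^+ 2 * (K * (3 + B) * B ^+ 3).
  rewrite (le_trans (ler_norm_sum _ _ _)) // -[leRHS]mul1r -[X in _ <= X * _]p1 mulr_suml.
  apply: ler_sum => t _; rewrite -mulrA normrM ger0_norm // ler_wpM2l //.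
  rewrite normrM.
  apply: (@le_trans _ _ (B * Ex f n (fun s => (a ^+ 2 * K * B ^+ 2) * (1 + `|a * s| * 2 + B)))).
    apply: ler_pM => //; apply: (le_trans (Ex_norm _ _ _)).
    apply: le_Ex => s; rewrite -[X in X * F' _](daf t s).
    apply: (le_trans (F1 _ _)); rewrite daf.
    apply: (@le_trans _ _ ((K * (1 + `|a * s| * 2 + B)) * (a ^+ 2 * B ^+ 2))); last first.
      by rewrite le_eqVlt; apply/orP; left; apply/eqP; ring.
    apply: ler_pM; rewrite ?sqr_ge0 ?ler_wpM2l ?nrm //.
      by rewrite mulr_ge0 ?addr_ge0.
    rewrite exprMn ler_wpM2l ?sqr_ge0 // -[f t ^+ 2]real_normK ?num_real //.
    by rewrite ler_sqr ?nnegrE.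
  rewrite ExZ [leRHS](_ : _ = B * (a ^+ 2 * K * B ^+ 2 * (3 + B))); last by ring.
  by rewrite !ler_wpM2l // !mulr_ge0 ?sqr_ge0 // ltW.
apply: (le_trans (ler_normB _ _)).
rewrite [leRHS](_ : _ = a * (K * (3 + B) * B) + a * (K * (3 + B) * B ^+ 3)); last by ring.
apply: lerD => //; rewrite normrM ger0_norm ?(mulr_ge0 (ltW a0) (ltW n0)) //.
have -> : a * (K * (3 + B) * B ^+ 3) = a * n.+1%:R * (a ^+ 2 * (K * (3 + B) * B ^+ 3)).
  by rewrite -[LHS]mul1r -[X in X * _ = _]a2; ring.
exact: ler_wpM2l (mulr_ge0 (ltW a0) (ltW n0)) _ _ D2.
Qed.

End Stein.
End IidSums.

(** * Pointwise derivatives and the mean value theorem *)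

Section Calculus.
Variable R : realType.
Implicit Types f df : R -> R.

Lemma is_derive_continuous f df : (forall x : R, is_derive x 1 f (df x)) ->
  continuous f.
Proof.
by move=> fd x; apply/differentiable_continuous/derivable1_diffP; have [] := fd x.
Qed.

Lemma deriveB_pt f g (x a b : R) : is_derive x 1 f a -> is_derive x 1 g b ->
  is_derive x 1 (fun y => f y - g y) (a - b).
Proof. by move=> fa gb; exact: is_deriveB. Qed.

Lemma deriveD_pt f g (x a b : R) : is_derive x 1 f a -> is_derive x 1 g b ->
  is_derive x 1 (fun y => f y + g y) (a + b).
Proof. by move=> fa gb; exact: is_deriveD. Qed.

Lemma deriveM_pt f g (x a b : R) : is_derive x 1 f a -> is_derive x 1 g b ->
  is_derive x 1 (fun y => f y * g y) (a * g x + f x * b).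
Proof.
move=> fa gb; have h := is_deriveM fa gb; rewrite addrC mulrC [a * _]mulrC.
by rewrite [b * _]mulrC.
Qed.

Lemma derive_comp_pt (f g : R -> R) (x a b : R) : is_derive (g x) 1 f a ->
  is_derive x 1 g b -> is_derive x 1 (fun y => f (g y)) (a * b).
Proof. by move=> fa gb; exact: (is_derive1_comp fa gb). Qed.

Lemma deriveZ_pt (k : R) f (x a : R) : is_derive x 1 f a ->
  is_derive x 1 (fun y => k * f y) (k * a).
Proof. by move=> fa; exact: is_deriveZ. Qed.

Lemma derive_affine_pt (k l x : R) : is_derive x 1 (fun y : R => k * y + l) k.
Proof.
rewrite -[X in is_derive _ _ _ X]addr0; apply: deriveD_pt.
by rewrite -[X in is_derive _ _ _ X]mulr1; apply: deriveZ_pt; exact: is_derive_id.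
Qed.

Lemma mean_value f df a b : (forall x : R, is_derive x 1 f (df x)) -> a <= b ->
  exists2 c, a <= c <= b & f b - f a = df c * (b - a).
Proof.
move=> fd ab; have [|c] := @MVT_segment _ f df a b ab.
- exact/continuous_subspaceT/(is_derive_continuous fd).
- by rewrite in_itv /= => cab e; exists c.
Qed.

Lemma derive_ge0_le f df a b : (forall x : R, is_derive x 1 f (df x)) -> a <= b ->
  (forall x, a <= x <= b -> 0 <= df x) -> f a <= f b.
Proof.
move=> fd ab h; have [c cab e] := mean_value fd ab.
by rewrite -subr_ge0 e mulr_ge0 ?h // subr_ge0.
Qed.

Lemma lipschitz_continuous f (L : R) :
  (forall x y, `|f y - f x| <= L * `|y - x|) -> continuous f.
Proof.
move=> h x; apply/cvgrPdist_lt => e e0.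
have L0 : 0 <= L.
  by have := h 0 1; rewrite subr0 normr1 mulr1; apply: le_trans.
near=> y; rewrite (le_lt_trans (h y x)) //.
rewrite (@le_lt_trans _ _ ((L + 1) * `|x - y|)) //.
  by rewrite ler_wpM2r // lerDl.
rewrite mulrC -ltr_pdivlMr; last by rewrite ltr_wpDl.
near: y; apply: (@cvgr_dist_lt _ _ _ (nbhs x) _ id) => //.
by rewrite divr_gt0 // ltr_wpDl.
Unshelve. all: by end_near. Qed.

End Calculus.

(** * Gaussian densities and distribution functions *)

Section Gauss.
Variable R : realType.
Notation mu := (@lebesgue_measure R).
Local Notation phi := (normal_pdf (0 : R) 1).

Definition lint (f : R -> R) (x : R) : R := (\int[mu]_(t in `]-oo, x]) f t)%R.

Definition ncdf (m s : R) : R -> R := lint (normal_pdf m s).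

Lemma ncdfE m s : ncdf m s = lint (normal_pdf m s).
Proof. by []. Qed.

Lemma Phi_ncdf : @Phi R = ncdf 0 1.
Proof. by []. Qed.

Lemma integrable_itvNy (f : R -> R) x : mu.-integrable setT (EFin \o f) ->
  mu.-integrable `]-oo, x] (EFin \o f).
Proof. by apply: integrableS. Qed.

Lemma lint_derive (f : R -> R) (x : R) : mu.-integrable setT (EFin \o f) -> continuous f ->
  is_derive x 1 (lint f) (f x).
Proof.
move=> fi fc.
have [] := @continuous_FTC1 R f -oo%O x (x + 1) _ (integrable_itvNy _ fi) _ (fc x).
- by rewrite ltrDl.
- by rewrite ltNyr.
move=> d e; apply: DeriveDef; first exact: d.
rewrite -derive1E.
exact: e.
Qed.

Lemma lint_ge0 (f : R -> R) (x : R) : (forall t, 0 <= f t) -> 0 <= lint f x.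
Proof.
move=> f0; rewrite /lint /Rintegral fine_ge0 // integral_ge0 // => t _.
by rewrite lee_fin.
Qed.

Lemma lint_le (f g : R -> R) (x : R) : mu.-integrable setT (EFin \o f) ->
  mu.-integrable setT (EFin \o g) -> (forall t, t <= x -> f t <= g t) ->
  lint f x <= lint g x.
Proof.
move=> fi gi fg; apply: le_Rintegral => //; try exact: integrable_itvNy.
Qed.

Section Normal.
Variables (m s : R).
Hypothesis s0 : 0 < s.

Lemma npdf_integrable : mu.-integrable setT (EFin \o normal_pdf m s).
Proof. exact: integrable_normal_pdf. Qed.

Lemma npdf_continuous : continuous (normal_pdf m s).
Proof. by apply: continuous_normal_pdf; rewrite gt_eqF. Qed.

Lemma npdf_gt0 x : 0 < normal_pdf m s x.
Proof.
rewrite normal_pdfE ?gt_eqF // mulr_gt0 // ?expR_gt0 //.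
by rewrite normal_peak_gt0 // gt_eqF.
Qed.

Lemma ncdf_derive (x : R) : is_derive x 1 (ncdf m s) (normal_pdf m s x).
Proof. exact: lint_derive npdf_integrable npdf_continuous. Qed.

Lemma ncdf_continuous : continuous (ncdf m s).
Proof. exact: is_derive_continuous ncdf_derive. Qed.

Lemma ncdf_mono x y : x < y -> ncdf m s x < ncdf m s y.
Proof.
move=> xy; have [c _ e] := mean_value ncdf_derive (ltW xy).
by rewrite -subr_gt0 e mulr_gt0 ?npdf_gt0 // subr_gt0.
Qed.

Lemma ncdf_le x y : x <= y -> ncdf m s x <= ncdf m s y.
Proof. by rewrite le_eqVlt => /predU1P[->//|/ncdf_mono/ltW]. Qed.

Lemma ncdf_prob x : (ncdf m s x)%:E = normal_prob m s `]-oo, x].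
Proof.
rewrite /ncdf /lint /Rintegral fineK //; apply: integrable_fin_num => //.
exact/integrable_itvNy/npdf_integrable.
Qed.

Opaque ncdf.

Lemma ncdf_le1 x : ncdf m s x <= 1.
Proof. by rewrite -lee_fin ncdf_prob; exact: probability_le1. Qed.

Lemma ncdf_large (e : R) : e < 1 -> exists x, e < ncdf m s x.
Proof.
move=> e1; pose F (n : nat) : set R := `]-oo, n%:R].
have FT : \bigcup_n F n = setT.
  rewrite -subTset => t _; exists (Num.truncn t).+1 => //.
  by rewrite /F /= in_itv /= ltW // Num.Theory.truncnS_gt.
have : normal_prob m s \o F @ \oo --> normal_prob m s (\bigcup_n F n).
  apply: nondecreasing_cvg_mu.
  - by move=> n; exact: measurable_itv.
  - by rewrite FT; exact: measurableT.
  - move=> k l kl; apply/subsetPset => t; rewrite /F /= !in_itv /= => /le_trans; apply.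
    by rewrite ler_nat.
rewrite FT probability_setT => /fine_cvg /cvgrPdist_lt /(_ (1 - e)).
rewrite subr_gt0 => /(_ e1) [n _ /(_ n (leqnn n))] /= /ltr_normlW h.
by exists n%:R; rewrite -lte_fin ncdf_prob -[normal_prob _ _ _]fineK ?fin_num_measure // lte_fin; lra.
Qed.

Lemma ncdf_small (e : R) : 0 < e -> exists x, ncdf m s x < e.
Proof.
move=> e0; pose F (n : nat) : set R := `]-oo, - n%:R].
have F0 : \bigcap_n F n = set0.
  rewrite -subset0 => t; move/(_ (Num.truncn (- t)).+1 I).
  rewrite /F /= in_itv /= => h; have := Num.Theory.truncnS_gt (- t).
  by rewrite ltNge lerNr h.
have : normal_prob m s \o F @ \oo --> normal_prob m s (\bigcap_n F n).
  apply: nonincreasing_cvg_mu.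
  - by rewrite (le_lt_trans (probability_le1 _ _)) ?ltry //; exact: measurable_itv.
  - by move=> n; exact: measurable_itv.
  - by rewrite F0; exact: measurable0.
  - move=> k l kl; apply/subsetPset => t; rewrite /F /= !in_itv /= => /le_trans; apply.
    by rewrite lerN2 ler_nat.
rewrite F0 measure0 => /fine_cvg /cvgrPdist_lt /(_ e e0) [n _ /(_ n (leqnn n))] /=.
rewrite sub0r normrN => /ltr_normlW h.
by exists (- n%:R); rewrite -lte_fin ncdf_prob -[normal_prob _ _ _]fineK ?fin_num_measure // lte_fin.
Qed.

Lemma ncdf_gt0 x : 0 < ncdf m s x.
Proof.
rewrite (le_lt_trans _ (@ncdf_mono (x - 1) x _)) ?ltrBlDr ?ltrDl //.
by apply: lint_ge0 => t; apply/ltW/npdf_gt0.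
Qed.

Lemma ncdf_inv (e : R) : 0 < e < 1 -> exists x, ncdf m s x = e.
Proof.
move=> /andP[/ncdf_small [x hx] /ncdf_large [y hy]].
have xy : x <= y.
  by rewrite leNgt; apply/negP => /ncdf_mono; lra.
have [|z _ <-] := @IVT _ (ncdf m s) x y e xy (continuous_subspaceT ncdf_continuous).
  by rewrite ge_min le_max (ltW hx) (ltW hy) orbT.
by exists z.
Qed.

End Normal.

Lemma npdf_scale (m s x : R) : 0 < s ->
  normal_pdf m s x = phi ((x - m) / s) / s.
Proof.
move=> s0; rewrite !normal_pdfE ?oner_eq0 ?gt_eqF // /normal_peak /normal_fun.
rewrite subr0 expr1n mul1r.
rewrite -mulrnAr.
rewrite sqrtrM ?sqr_ge0 // sqrtr_sqr gtr0_norm // invfM.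
rewrite [RHS]mulrC mulrA; congr (_ * expR _).
by rewrite exprMn exprVn -[s ^+ 2 *+ 2]mulr_natr invfM mulNr mulrA mulNr.
Qed.

(** Instead of a change of variables: both sides have the same derivative, so they differ by a
    constant, which is 0 in the limit at minus infinity. *)
Lemma ncdf_scale (m s x : R) : 0 < s -> ncdf m s x = ncdf 0 1 ((x - m) / s).
Proof.
move=> s0; pose D x := ncdf m s (s * x + m) - ncdf 0 1 x.
have n1 : (0 : R) < 1 by [].
have dD (y : R) : is_derive y 1 D 0.
  have d1 := @derive_comp_pt R _ _ y _ _ (ncdf_derive m s0 (s * y + m)) (derive_affine_pt s m y).
  have := deriveB_pt d1 (ncdf_derive 0 n1 y).
  rewrite (npdf_scale _ _ s0) addrK [s * y]mulrC mulfK ?gt_eqF // divfK ?gt_eqF //.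
  by rewrite subrr.
have cD y z : y <= z -> D y = D z.
  move=> yz; have [c _] := mean_value dD yz.
  by rewrite mul0r => /eqP; rewrite subr_eq0 => /eqP.
suff D0 y : D y = 0.
  have := D0 ((x - m) / s); rewrite /D.
  have -> : s * ((x - m) / s) + m = x by rewrite mulrC divfK ?gt_eqF // subrK.
  move=> /eqP.
  by rewrite subr_eq0 => /eqP.
apply/eqP; rewrite -normr_le0; apply/ler_addgt0Pr => e e0; rewrite add0r.
have [y1 h1] := ncdf_small m s e0.
have [y2 h2] := ncdf_small 0 1 e0.
(* A point left of y at which both distribution functions are already below e. *)
pose z := Num.min y (Num.min ((y1 - m) / s) y2).
have zx : z <= y by rewrite ge_min lexx.
have zy1 : s * z + m <= y1.
  by rewrite -lerBrDr mulrC -ler_pdivlMr // !ge_min lexx orbT.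
have zy2 : z <= y2 by rewrite !ge_min lexx !orbT.
rewrite -(cD _ _ zx) /D ler_norml.
move: (ncdf_le m s0 zy1) (ncdf_le 0 n1 zy2).
move: (ncdf_gt0 m s0 (s * z + m)) (ncdf_gt0 0 n1 z) h1 h2.
move: (ncdf m s y1) (ncdf m s (s * z + m)) (ncdf 0 1 z) (ncdf 0 1 y2) => a b c d.
lra.
Qed.

Lemma phi_derive (x : R) : is_derive x 1 phi (- x * phi x).
Proof.
rewrite normal_pdfE ?oner_eq0 //.
have -> : (fun x => normal_peak 1 * normal_fun 0 1 x) =
   (fun x => normal_peak (1 : R) * expR (- 2^-1 * (x * x))).
  apply/funext => y /=; congr (_ * expR _).
  by rewrite subr0 expr1n mulNr mulNr -expr2 mulrC.
have d : is_derive x 1 (fun x : R => - 2^-1 * (x * x)) (- x).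
  have := deriveZ_pt (- 2^-1) (deriveM_pt (is_derive_id x (1 : R)) (is_derive_id x (1 : R))).
  by rewrite (_ : - 2^-1 * _ = - x) //; rewrite mul1r mulr1; field.
have := deriveZ_pt (normal_peak (1 : R)) (@derive_comp_pt R expR _ x _ _ (is_derive_expR (- 2^-1 * (x * x))) d).
rewrite (_ : _ * (_ * - x) = - x * (normal_peak 1 * normal_fun 0 1 x)) //.
rewrite /normal_fun subr0 expr1n mulrCA mulrC mulNr mulNr -mulrN.
by rewrite (_ : 2^-1 * - (x * x) = - x ^+ 2 / 2); [ring|field].
Qed.

End Gauss.

Opaque ncdf.

(** * Stein's equation and the central limit theorem *)

Section CLT.
Variable R : realType.
Notation mu := (@lebesgue_measure R).
Local Notation phi := (normal_pdf (0 : R) 1).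
Local Notation Phi := (ncdf (0 : R) 1).

Let n1 : (0 : R) < 1. Proof. by []. Qed.

(** Otherwise Phi x + phi x / x < 1 is exceeded by some Phi y with y >= x. But - phi - x Phi has
    derivative (z - x) phi z >= 0 on [x, y], which bounds x (Phi y - Phi x) by phi x. The next lemma
    is the mirror image. *)
Lemma mills_pos (x : R) : 0 < x -> x * (1 - Phi x) <= phi x.
Proof.
move=> x0; rewrite leNgt; apply/negP => h.
have /ncdf_large : Phi x + phi x / x < 1.
  by rewrite -ltrBrDl ltr_pdivrMr // mulrC.
move=> /(_ 0 1) [y hy].
have xy : x <= y.
  rewrite leNgt; apply/negP => /(ncdf_mono 0 n1).
  have : 0 < phi x / x by rewrite divr_gt0 // npdf_gt0.
  move: hy; move: (Phi x) (Phi y) (phi x / x) => a b c; lra.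
have := @derive_ge0_le R (fun y => (-1) * phi y - x * Phi y)
  (fun y => (-1) * (- y * phi y) - x * phi y) x y.
have dd (z : R) : is_derive z 1 (fun y => (-1) * phi y - x * Phi y)
    ((-1) * (- z * phi z) - x * phi z).
  exact: deriveB_pt (deriveZ_pt _ (phi_derive z)) (deriveZ_pt _ (ncdf_derive 0 n1 z)).
move=> /(_ dd xy) H.
have {}H : -1 * phi x - x * Phi x <= -1 * phi y - x * Phi y.
  apply: H => z /andP[xz _].
  rewrite (_ : _ - _ = (z - x) * phi z); last by ring.
  by rewrite mulr_ge0 ?subr_ge0 // ltW // npdf_gt0.
have hx : phi x < x * (Phi y - Phi x).
  by rewrite mulrC -ltr_pdivrMr // ltrBrDl.
have := npdf_gt0 0 n1 y.
move: H hx; move: (Phi x) (Phi y) (phi x) (phi y) => a b c d; lra.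
Qed.

Lemma mills_neg (x : R) : x < 0 -> - x * Phi x <= phi x.
Proof.
move=> x0; rewrite leNgt; apply/negP => h.
have nx0 : 0 < - x by rewrite oppr_gt0.
have /ncdf_small : 0 < Phi x - phi x / - x.
  by rewrite subr_gt0 ltr_pdivrMr // mulrC.
move=> /(_ 0 1) [y hy].
have xy : y <= x.
  rewrite leNgt; apply/negP => /(ncdf_mono 0 n1).
  have : 0 < phi x / - x by rewrite divr_gt0 // npdf_gt0.
  move: hy; move: (Phi x) (Phi y) (phi x / - x) => a b c; lra.
have dd (z : R) : is_derive z 1 (fun y => phi y + x * Phi y)
    (- z * phi z + x * phi z).
  exact: deriveD_pt (phi_derive z) (deriveZ_pt _ (ncdf_derive 0 n1 z)).
have H : phi y + x * Phi y <= phi x + x * Phi x.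
  apply: (derive_ge0_le dd xy) => z /andP[_ zx].
  rewrite (_ : _ + _ = (x - z) * phi z); last by ring.
  by rewrite mulr_ge0 ?subr_ge0 // ltW // npdf_gt0.
have hx : phi x < - x * (Phi x - Phi y).
  by rewrite mulrC -ltr_pdivrMr // ltrBrDr -ltrBrDl.
have := npdf_gt0 0 n1 y.
move: H hx; move: (Phi x) (Phi y) (phi x) (phi y) => a b c d; lra.
Qed.

Lemma phi_ge1 (x : R) : `|x| <= 1 -> phi 1 <= phi x.
Proof.
move=> x1; rewrite !normal_pdfE ?oner_eq0 // ler_wpM2l ?normal_peak_ge0 //.
rewrite /normal_fun !subr0 ler_expR ler_pM2r ?invr_gt0 ?mulrn_wgt0 //.
by rewrite lerN2 expr1n -real_normK ?num_real // expr_le1.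
Qed.

Section SteinSolution.
Variables (h : R -> R) (L : R).
Hypotheses (h01 : forall x, 0 <= h x <= 1)
  (hL : forall x y, `|h y - h x| <= L * `|y - x|).

Let hc : continuous h. Proof. exact: lipschitz_continuous hL. Qed.
Let hp t := h t * phi t.
Let hpc : continuous hp.
Proof.
by move=> x; apply: (@continuousM R R h phi x); [exact: hc|exact: npdf_continuous].
Qed.
Let hp0 t : 0 <= hp t.
Proof. by rewrite mulr_ge0 ?(ltW (npdf_gt0 _ _ _)) //; have /andP[] := h01 t. Qed.
Let hple t : hp t <= phi t.
Proof. by rewrite ler_piMl ?(ltW (npdf_gt0 _ _ _)) //; have /andP[] := h01 t. Qed.
Let hpi : mu.-integrable setT (EFin \o hp).
Proof.
apply: (le_integrable _ _ _ (npdf_integrable 0 1)) => //.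
  by apply/measurable_EFinP; exact: continuous_measurable_fun.
move=> x _ /=; rewrite lee_fin !ger0_norm ?hp0 // ?hple //.
exact: le_trans (hp0 x) (hple x).
Qed.

Let G := lint hp.
(** The Gaussian mean of h, as the value at infinity of the increasing partial integrals [G]. *)
Definition stein_mean : R := sup (range G).
Local Notation c := stein_mean.

Let G_derive (x : R) : is_derive x 1 G (hp x).
Proof. exact: lint_derive hpi hpc. Qed.
Let G0 x : 0 <= G x. Proof. exact: lint_ge0. Qed.
Let GPhi x : G x <= Phi x.
Proof. by rewrite ncdfE; apply: lint_le => //; exact: npdf_integrable. Qed.
Let Gle x y : x <= y -> G x <= G y.
Proof. by move=> xy; apply: (derive_ge0_le G_derive xy) => z _; exact: hp0. Qed.
Let Gub : has_ubound (range G).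
Proof.
exists 1 => _ [x _ <-]; apply: le_trans (GPhi x) _; exact: ncdf_le1.
Qed.
Let Gc x : G x <= c.
Proof. by apply: (ub_le_sup Gub); exists x. Qed.
Let cG x : c - G x <= 1 - Phi x.
Proof.
rewrite lerBlDr; apply: ge_sup; first by exists (G 0), 0.
move=> _ [y _ <-].
have [xy|/ltW yx] := leP x y; last first.
  by have := Gle yx; have := ncdf_le1 0 1 x; move: (Phi x) (G x) (G y) => u v w; lra.
have H : G y - G x <= Phi y - Phi x.
  have dd (z : R) : is_derive z 1 (fun y => Phi y - G y) (phi z - hp z).
    exact: deriveB_pt (ncdf_derive 0 n1 z) (G_derive z).
  have d0 z : x <= z <= y -> 0 <= phi z - hp z by rewrite subr_ge0.
  have := derive_ge0_le dd xy d0.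
  by move: (Phi x) (Phi y) (G x) (G y) => u v w t; lra.
have := ncdf_le1 0 1 y.
by move: H; move: (Phi x) (Phi y) (G x) (G y) => u v w t; lra.
Qed.

Lemma stein_mean_ge a : (forall x, x <= a -> h x = 1) -> Phi a <= c.
Proof.
move=> ha; apply: le_trans _ (Gc a); rewrite ncdfE.
apply: lint_le => //; first exact: npdf_integrable.
by move=> t ta; rewrite /hp ha // mul1r.
Qed.

Lemma stein_mean_le b : (forall x, b <= x -> h x = 0) -> c <= Phi b.
Proof.
move=> hb; apply: ge_sup; first by exists (G 0), 0.
move=> _ [y _ <-]; apply: le_trans _ (GPhi b).
have [yb|/ltW by_] := leP y b; first exact: Gle.
have [z /andP[bz _] e] := mean_value G_derive by_.
by rewrite -subr_le0 e /hp hb // !mul0r.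
Qed.

Let c01 : 0 <= c <= 1.
Proof.
rewrite (le_trans (G0 0) (Gc 0)) /=.
have := cG 0; have := GPhi 0; move: (Phi 0) (G 0) c => u v w; lra.
Qed.

Let W x := G x - c * Phi x.
Let Wabs x : `|W x| <= Phi x /\ `|W x| <= 1 - Phi x.
Proof.
have := G0 x; have := GPhi x; have := Gc x; have := cG x; have := c01.
have := ncdf_gt0 0 n1 x; have := ncdf_le1 0 1 x; rewrite /W.
move: (Phi x) (G x) c => u v w h1 h2 /andP[h3 h4] h5 h6 h7 h8.
by split; rewrite ler_norml; apply/andP; split; nra.
Qed.

(** The bounded solution of Stein's equation F'(x) - x F(x) = h(x) - c: [W] is the integral of (h -
    c) phi up to x. *)
Definition steinF x := W x / phi x.
Definition steinF' x := h x - c + x * steinF x.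
Local Notation F := steinF.
Local Notation F' := steinF'.

Lemma steinF_derive (x : R) : is_derive x 1 F (F' x).
Proof.
have p0 : phi x != 0 by rewrite gt_eqF // npdf_gt0.
have dW : is_derive x 1 W (hp x - c * phi x).
  exact: deriveB_pt (G_derive x) (deriveZ_pt _ (ncdf_derive 0 n1 x)).
have dV : is_derive x 1 (fun y => (phi y)^-1) (- phi x ^- 2 * (- x * phi x)).
  exact: is_deriveV p0 (phi_derive x).
have := deriveM_pt dW dV.
rewrite (_ : _ + _ = F' x) // /F' /F /hp.
by move: p0; move: (phi x) (W x) (h x) c => u v w z u0; field.
Qed.

Let K1 := 1 + (phi 1)^-1.

(** [W] is at most either tail of Phi, so Mills' ratio bounds x F(x). Outside [-1, 1] this bounds F
    too; inside, phi is at least phi 1. *)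
Lemma steinF_bound x : `|F x| <= K1 /\ `|x * F x| <= 1.
Proof.
have p0 := npdf_gt0 0 n1 x; have q0 := npdf_gt0 0 n1 1.
have [w1 w2] := Wabs x.
have B : `|x * F x| <= 1.
  rewrite normrM /F normrM normfV (gtr0_norm p0) mulrA ler_pdivrMr // mul1r.
  case: (ltrgt0P x) => x0.
  - have := mills_pos x0.
    by move: w2; move: (Phi x) (phi x) `|W x| => u v w; nra.
  - have := mills_neg x0.
    by move: w1; move: (Phi x) (phi x) `|W x| => u v w; nra.
  - by rewrite mul0r ltW.
split => //; have [x1|x1] := lerP `|x| 1.
  apply: (@le_trans _ _ (phi 1)^-1); last by rewrite /K1 lerDr.
  rewrite /F normrM normfV (gtr0_norm p0) ler_pdivrMr //.
  have h1 : `|W x| <= 1 by apply: le_trans w1 (ncdf_le1 _ _ _).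
  apply: le_trans h1 _; rewrite mulrC -ler_pdivrMr ?invr_gt0 // invrK mul1r.
  exact: phi_ge1.
apply: (@le_trans _ _ 1); last by rewrite /K1 lerDl invr_ge0 ltW.
rewrite leNgt; apply/negP => f1.
have : 1 < `|x| * `|F x|.
  by move: x1 f1; move: `|x| `|F x| => u v; nra.
by rewrite -normrM ltNge B.
Qed.

Let K := 2 * (L + K1 + 2).
Let L0 : 0 <= L.
Proof. by have := hL 0 1; rewrite subr0 normr1 mulr1; apply: le_trans. Qed.
Let K10 : 0 <= K1.
Proof. by rewrite /K1 addr_ge0 // invr_ge0 ltW // npdf_gt0. Qed.

Lemma steinF'_le2 x : `|F' x| <= 2.
Proof.
have [_ b] := steinF_bound x; have := h01 x; have := c01; move: b; rewrite /F'.
rewrite !ler_norml; move: (h x) c (x * F x) => u v w; lra.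
Qed.

Lemma steinF_lip x y : `|F y - F x| <= 2 * `|y - x|.
Proof.
wlog xy : x y / x <= y => [H|].
  by have [|/ltW] := leP x y => /H //; rewrite distrC [`|x - y|]distrC.
have [z _ ->] := mean_value steinF_derive xy.
by rewrite normrM ler_wpM2r // steinF'_le2.
Qed.

Let F'_lip x y : `|F' y - F' x| <= (L + 2 * `|y| + K1) * `|y - x|.
Proof.
have -> : F' y - F' x = (h y - h x) + y * (F y - F x) + (y - x) * F x.
  by rewrite /F'; ring.
rewrite (le_trans (ler_normD _ _)) //.
rewrite [leRHS]mulrDl; apply: lerD; last first.
  by rewrite normrM mulrC ler_wpM2r //; have [] := steinF_bound x.
rewrite (le_trans (ler_normD _ _)) // [leRHS]mulrDl; apply: lerD => //.
by rewrite normrM -mulrA [2 * _]mulrCA ler_wpM2l // steinF_lip.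
Qed.

Lemma steinF2 x y : `|F' y - F' x| <= K * (1 + `|x| + `|y|) * `|y - x|.
Proof.
apply: le_trans (F'_lip x y) _; rewrite ler_wpM2r // /K.
by have := normr_ge0 x; have := normr_ge0 y; move: L0 K10;
  move: `|x| `|y| L K1 => u v l k; nra.
Qed.

Lemma steinF1 x y :
  `|F y - F x - (y - x) * F' x| <= K * (1 + `|x| + `|y|) * (y - x) ^+ 2.
Proof.
(* The mean value point z lies between x and y, whence both size bounds; the Lipschitz bound for F'
   from x to z then gives the quadratic remainder. *)
have [z [zx zy e]] : exists z, [/\ `|z - x| <= `|y - x|, `|z| <= `|x| + `|y|
    & F y - F x = F' z * (y - x)].
  have [xy|/ltW yx] := leP x y.
    have [z /andP[xz zy] e] := mean_value steinF_derive xy; exists z; split => //.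
      by rewrite !ger0_norm ?subr_ge0 // lerB.
    by rewrite ler_norml; have := ler_normr x (- x); have := ler_norm y;
       have := ler_norm (- x); have := normr_ge0 x; have := normr_ge0 y; rewrite normrN; lra.
  have [z /andP[xz zy] e] := mean_value steinF_derive yx; exists z; split => //.
  - by rewrite !ler0_norm ?subr_le0 // lerN2 lerB.
  - by rewrite ler_norml; have := ler_norm x;
       have := ler_norm (- y); have := normr_ge0 x; have := normr_ge0 y; rewrite normrN; lra.
  - by rewrite -opprB e; ring.
rewrite e [(y - x) * _]mulrC -mulrBl normrM.
apply: (@le_trans _ _ ((L + 2 * `|z| + K1) * `|z - x| * `|y - x|)).
  by rewrite ler_wpM2r // F'_lip.
apply: (@le_trans _ _ ((L + 2 * `|z| + K1) * `|y - x| * `|y - x|)).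
  by rewrite ler_wpM2r // ler_wpM2l // (addr_ge0 (addr_ge0 L0 _) K10) // mulr_ge0.
rewrite -mulrA -expr2 real_normK ?num_real // ler_wpM2r ?sqr_ge0 // /K.
have := normr_ge0 x; have := normr_ge0 y; move: L0 K10 zy.
by move: `|x| `|y| `|z| L K1 => u v t l k; nra.
Qed.

Lemma stein_K_ge0 : 0 <= K.
Proof. by rewrite /K mulr_ge0 // (addr_ge0 (addr_ge0 L0 K10)). Qed.

Lemma clt_smooth (T : finType) (p f : T -> R) : (forall t, 0 <= p t) ->
  \sum_t p t = 1 -> \sum_t p t * f t = 0 -> \sum_t p t * f t ^+ 2 = 1 ->
  exists C, forall n, `|Ex p f n.+1 (fun s => h ((Num.sqrt n.+1%:R)^-1 * s)) - c|
    <= (Num.sqrt n.+1%:R)^-1 * C.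
Proof.
move=> p0 p1 m0 v1; pose B := \sum_t `|f t|.
have fB t : `|f t| <= B by rewrite /B (bigD1 t) //= lerDl sumr_ge0.
exists (K * (3 + B) * (B + B ^+ 3)) => n.
have := stein_bound p0 p1 m0 v1 fB stein_K_ge0 steinF1 steinF2 n.
rewrite (eq_Ex p f n.+1 (h := fun s => h ((Num.sqrt n.+1%:R)^-1 * s) - c)).
  by rewrite ExB Ex_cst.
by move=> s /=; rewrite /F' addrK.
Qed.

End SteinSolution.

(** Linear from 1 at a to 0 at b: Lipschitz, hence admissible for Stein's method, and squeezed
    between the indicators of x <= a and x <= b. *)
Definition ramp (a b x : R) : R := Num.min 1 (Num.max 0 ((b - x) / (b - a))).

Section Ramp.
Variables (a b : R).
Hypothesis ab : a < b.
Let ba : 0 < b - a. Proof. by rewrite subr_gt0. Qed.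

Lemma ramp01 x : 0 <= ramp a b x <= 1.
Proof. by rewrite /ramp le_min ler01 le_max lexx ge_min lexx. Qed.

Lemma ramp_left x : x <= a -> ramp a b x = 1.
Proof.
move=> xa; apply/min_idPl; rewrite le_max ler_pdivlMr // mul1r; apply/orP; right.
by rewrite lerB.
Qed.

Lemma ramp_right x : b <= x -> ramp a b x = 0.
Proof.
move=> bx; rewrite /ramp (max_idPl _) ?minEle ?ler10 //.
by rewrite ler_pdivrMr // mul0r subr_le0.
Qed.

Lemma ramp_lip x y : `|ramp a b y - ramp a b x| <= (b - a)^-1 * `|y - x|.
Proof.
wlog xy : x y / x <= y => [H|].
  by have [|/ltW] := leP x y => /H //; rewrite distrC [`|x - y|]distrC.
rewrite [`|y - x|]ger0_norm ?subr_ge0 // /ramp.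
have e : (b - a)^-1 * (y - x) = (b - x) / (b - a) - (b - y) / (b - a) by ring.
have : (b - y) / (b - a) <= (b - x) / (b - a) by rewrite ler_pM2r ?invr_gt0 // lerB.
rewrite e; move: (_ / _) (_ / _) => u v uv.
rewrite ler_norml; have [v0|v0] := leP v 0; have [u0|u0] := leP u 0;
  rewrite ?minEle; (do ?case: ifP); lra.
Qed.
End Ramp.

Variables (T : finType) (p f : T -> R).
Hypotheses (p0 : forall t, 0 <= p t) (p1 : \sum_t p t = 1).
Let D := \sum_t p t * f t.
Let V := \sum_t p t * (f t - D) ^+ 2.
Hypothesis V0 : 0 < V.

Definition cdfn n (x : R) := Ex p f n (fun s => (s <= x)%R%:R).

(** The indicator lies between the ramps on [x - d, x] and [x, x + d]. First d is chosen from
    continuity of Phi, then n from the Stein bound, whose constant grows as d shrinks. *)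
Lemma clt x e : 0 < e -> exists N, forall n, (N <= n)%N ->
  `|cdfn n (n%:R * D + Num.sqrt n%:R * Num.sqrt V * x) - Phi x| <= e.
Proof.
move=> e0.
have sV : 0 < Num.sqrt V by rewrite sqrtr_gt0.
pose f' t := (Num.sqrt V)^-1 * f t + - D / Num.sqrt V.
have f'E t : f' t = (f t - D) / Num.sqrt V by rewrite /f' mulrBl mulNr mulrC.
have m0 : \sum_t p t * f' t = 0.
  under eq_bigr => t _ do rewrite f'E mulrA mulrBr.
  by rewrite -mulr_suml sumrB -mulr_suml p1 mul1r subrr mul0r.
have v1 : \sum_t p t * f' t ^+ 2 = 1.
  under eq_bigr => t _ do rewrite f'E exprMn mulrA.
  by rewrite -mulr_suml exprVn sqr_sqrtr ?ltW // divff // gt_eqF.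
have cf n : (0 < n)%N -> cdfn n (n%:R * D + Num.sqrt n%:R * Num.sqrt V * x) =
    Ex p f' n (fun s => ((Num.sqrt n%:R)^-1 * s <= x)%R%:R).
  move=> n0; rewrite /f' Ex_affine; apply: eq_Ex => s; congr (nat_of_bool _)%:R.
  have sn : 0 < Num.sqrt (n%:R : R) by rewrite sqrtr_gt0 ltr0n.
  have -> : (Num.sqrt n%:R)^-1 * ((Num.sqrt V)^-1 * s + n%:R * (- D / Num.sqrt V)) =
     (s - n%:R * D) / (Num.sqrt n%:R * Num.sqrt V).
    by rewrite invfM; ring.
  by rewrite ler_pdivrMr ?mulr_gt0 // lerBlDl [x * _]mulrC.
have [d d0 [hd1 hd2]] : exists2 d, 0 < d & Phi (x + d) <= Phi x + e / 2 /\ Phi x - e / 2 <= Phi (x - d).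
  have e2 : 0 < e / 2 by rewrite divr_gt0.
  have /cvgrPdist_le /(_ _ e2) := @ncdf_continuous _ 0 1 n1 x.
  move=> [/= r r0 hr]; exists (r / 2); first by rewrite divr_gt0.
  have h1 := hr (x + r / 2); have h2 := hr (x - r / 2).
  have r2 : `|r / 2| < r by rewrite gtr0_norm ?divr_gt0 // ltr_pdivrMr // ltr_pMr // ltr1n.
  have e1 : x - (x + r / 2) = - (r / 2) by ring.
  have e2' : x - (x - r / 2) = r / 2 by ring.
  move: h1 h2; rewrite /ball_ /= e1 e2' normrN.
  move=> /(_ r2) h1 /(_ r2) h2.
  by move: h1 h2; rewrite !ler_norml; move: (Phi _) (Phi _) (Phi _) => u v w; lra.
have xl : x < x + d by rewrite ltrDl.
have xr : x - d < x by rewrite ltrBlDr ltrDl.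
have [C1 hC1] := clt_smooth (ramp01 x (x + d)) (ramp_lip xl) p0 p1 m0 v1.
have [C2 hC2] := clt_smooth (ramp01 (x - d) x) (ramp_lip xr) p0 p1 m0 v1.
have l1 := stein_mean_le (ramp01 x (x + d)) (ramp_lip xl) (fun y => @ramp_right _ _ xl y).
have l2 := stein_mean_ge (ramp01 (x - d) x) (ramp_lip xr) (fun y => @ramp_left _ _ xr y).
pose C := Num.max 1 (Num.max C1 C2).
have C0 : 0 < C by rewrite lt_max ltr01.
pose q := C / (e / 2); have q0 : 0 < q by rewrite !divr_gt0.
(* From here on sqrt n >= q, which makes both Stein errors at most e / 2. *)
exists (Num.truncn (q ^+ 2)).+1 => n hn; have n0 : (0 < n)%N by apply: leq_trans hn.
rewrite cf //; case: n n0 hn => // n _ hn.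
have small : (Num.sqrt n.+1%:R)^-1 * C <= e / 2.
  rewrite mulrC ler_pdivrMr ?sqrtr_gt0 // mulrC -ler_pdivrMr ?divr_gt0 //.
  rewrite -/q -[X in X <= _](ger0_norm (ltW q0)) -sqrtr_sqr ler_sqrt //.
  by rewrite (le_trans (ltW (Num.Theory.truncnS_gt _))) // ler_nat.
have sn0 : 0 <= (Num.sqrt (n.+1%:R : R))^-1 by rewrite invr_ge0 sqrtr_ge0.
have le1 : Ex p f' n.+1 (fun s => ((Num.sqrt n.+1%:R)^-1 * s <= x)%R%:R) <=
    Ex p f' n.+1 (fun s => ramp x (x + d) ((Num.sqrt n.+1%:R)^-1 * s)).
  apply: le_Ex => // s; case: (leP ((Num.sqrt n.+1%:R)^-1 * s) x) => h; first by rewrite ramp_left.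
  by case/andP: (ramp01 x (x + d) ((Num.sqrt n.+1%:R)^-1 * s)).
have le2 : Ex p f' n.+1 (fun s => ramp (x - d) x ((Num.sqrt n.+1%:R)^-1 * s)) <=
   Ex p f' n.+1 (fun s => ((Num.sqrt n.+1%:R)^-1 * s <= x)%R%:R).
  apply: le_Ex => // s; case: (leP ((Num.sqrt n.+1%:R)^-1 * s) x) => h; last by rewrite ramp_right // ltW.
  by case/andP: (ramp01 (x - d) x ((Num.sqrt n.+1%:R)^-1 * s)).
have b1 : (Num.sqrt n.+1%:R)^-1 * C1 <= e / 2.
  by apply: le_trans small; rewrite ler_wpM2l // !le_max lexx orbT.
have b2 : (Num.sqrt n.+1%:R)^-1 * C2 <= e / 2.
  by apply: le_trans small; rewrite ler_wpM2l // !le_max lexx !orbT.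
have := le_trans (hC1 n) b1; have := le_trans (hC2 n) b2.
move: le1 le2 l1 l2 hd1 hd2; rewrite !ler_norml.
move: (Ex _ _ _ _) (Ex _ _ _ _) (Ex _ _ _ _) (stein_mean _) (stein_mean _) (Phi x) (Phi (x + d)) (Phi (x - d)).
move=> *; lra.
Qed.

End CLT.

(** * The distance S_nu and its quantile *)

Section Sesquinormal.
Variable R : realType.
Notation mu := (@lebesgue_measure R).
Local Notation phi := (normal_pdf (0 : R) 1).
Local Notation Phi := (ncdf (0 : R) 1).
Local Notation Ny u := (`]-oo, u]%classic : set R).
Implicit Types (f g : R -> R) (x u z : R).

Let n1 : (0 : R) < 1. Proof. by []. Qed.

Lemma lint_restrict f x u : lint (f \_ (Ny u)) x = lint f (Num.min x u).
Proof.
rewrite /lint -Rintegral_mkcondr; congr Rintegral; apply/seteqP; split => t /=.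
  by rewrite !in_itv /= le_min => -[-> ->].
by rewrite !in_itv /= le_min => /andP[-> ->].
Qed.

Lemma rint_restrict f u : (\int[mu]_t (f \_ (Ny u)) t = lint f u)%R.
Proof. by rewrite -Rintegral_mkcond. Qed.

Lemma integrable_restrict f u : mu.-integrable setT (EFin \o f) ->
  mu.-integrable setT (EFin \o (f \_ (Ny u))).
Proof.
move=> fi; have : mu.-integrable (Ny u) (EFin \o f) by exact: integrable_itvNy.
move/(@integrable_mkcond _ _ R mu (Ny u) (EFin \o f) (measurable_itv _)).1.
by congr (mu.-integrable _ _); apply/funext => t; rewrite /patch /=; case: ifP.
Qed.

Lemma integrableD_R f g : mu.-integrable setT (EFin \o f) ->
  mu.-integrable setT (EFin \o g) -> mu.-integrable setT (EFin \o (fun t => f t + g t)).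
Proof. by move=> fi gi; have := integrableD measurableT fi gi. Qed.

Lemma integrableB_R f g : mu.-integrable setT (EFin \o f) ->
  mu.-integrable setT (EFin \o g) -> mu.-integrable setT (EFin \o (fun t => f t - g t)).
Proof. by move=> fi gi; have := integrableB measurableT fi gi. Qed.

Lemma integrable_norm_R f : mu.-integrable setT (EFin \o f) ->
  mu.-integrable setT (EFin \o (fun t => `|f t|)).
Proof. by move=> fi; have := integrable_abse fi. Qed.

Lemma lintD f g x : mu.-integrable setT (EFin \o f) ->
  mu.-integrable setT (EFin \o g) ->
  lint (fun t => f t + g t) x = lint f x + lint g x.
Proof. by move=> fi gi; rewrite /lint RintegralD //; exact: integrable_itvNy. Qed.

Lemma dominating_integrable a : dominating_density a ->
  mu.-integrable setT (EFin \o a).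
Proof.
move=> [ma a0 a1 _]; apply/integrableP; split; first exact/measurable_EFinP.
rewrite (_ : (\int[mu]_x _)%E = 1%E) ?ltry // -a1.
by apply: eq_integral => t _ /=; rewrite ger0_norm.
Qed.

(** Both densities have mass 1, so the excess of a on the half-line equals its deficit on the
    complement; each is at most the L1 distance on its own side. *)
Lemma half_l1 a b x : mu.-integrable setT (EFin \o a) ->
  mu.-integrable setT (EFin \o b) ->
  (\int[mu]_t a t = 1)%R -> (\int[mu]_t b t = 1)%R ->
  lint a x - lint b x <= (\int[mu]_t `|a t - b t|)%R / 2.
Proof.
move=> ai bi a1 b1.
have di := integrableB_R ai bi; have ni := integrable_norm_R di.
have mL : measurable (Ny x) by exact: measurable_itv.
have mR : measurable (~` Ny x) by exact: measurableC.
have LR : Ny x `|` ~` Ny x = setT by rewrite setUv.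
have dis : [disjoint Ny x & ~` Ny x] by apply/disj_setPS; rewrite setICr.
have spl f : mu.-integrable setT (EFin \o f) ->
    (\int[mu]_t f t = \int[mu]_(t in Ny x) f t + \int[mu]_(t in ~` Ny x) f t)%R.
  by move=> fi; rewrite -{1}LR Rintegral_setU // LR.
have sub f D : measurable D -> mu.-integrable setT (EFin \o f) ->
    mu.-integrable D (EFin \o f) by move=> mD; apply: integrableS.
have d0 : (\int[mu]_t (a t - b t) = 0)%R by rewrite RintegralB // a1 b1 subrr.
have dE : lint a x - lint b x = (\int[mu]_(t in Ny x) (a t - b t))%R.
  by rewrite RintegralB //; apply: sub.
have p1 : (\int[mu]_(t in Ny x) (a t - b t) <= \int[mu]_(t in Ny x) `|a t - b t|)%R.
  by apply: le_Rintegral => //; try exact: sub; move=> t _; exact: ler_norm.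
have p2 : (- (\int[mu]_(t in ~` Ny x) (a t - b t)) <= \int[mu]_(t in ~` Ny x) `|a t - b t|)%R.
  rewrite lerNl; have := @le_normr_Rintegral _ _ _ mu _ (fun t => a t - b t) mR (sub _ _ mR di).
  by rewrite ler_norml => /andP[].
have := spl _ di; have := spl _ ni; rewrite d0 dE.
move: p1 p2; move: (Rintegral _ _ _) (Rintegral _ _ _) (Rintegral _ _ _) (Rintegral _ _ _) (Rintegral _ _ _).
move=> *; lra.
Qed.

Section Sfun.
Variables (m s : R).
Hypothesis s0 : 0 < s.
Local Notation b := (normal_pdf m s).
Local Notation B := (ncdf m s).

Let bi := npdf_integrable m s.
Let pi_ := npdf_integrable (0 : R) 1.

Lemma rint_normal m' s' : (\int[mu]_t normal_pdf m' s' t = 1)%R.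
Proof. by rewrite /Rintegral integral_normal_pdf. Qed.

Lemma phi_dominating : dominating_density phi.
Proof.
split.
- exact: measurable_normal_pdf.
- by move=> t; exact: normal_pdf_ge0.
- exact: integral_normal_pdf.
- by move=> x.
Qed.

Lemma Sfun_ge x : Phi x - B x <= inf [set fine (\int[mu]_t (`|a t - b t|)%:E) / 2
      | a in @dominating_density R].
Proof.
apply: lb_le_inf.
  by exists (fine (\int[mu]_t (`|phi t - b t|)%:E) / 2); exists phi => //; exact: phi_dominating.
move=> _ [a da <-]; have ai := dominating_integrable da.
have [_ _ a1 hA] := da.
have a1' : (\int[mu]_t a t = 1)%R by rewrite /Rintegral a1.
apply: le_trans (half_l1 x ai bi a1' (rint_normal _ _)).
by rewrite ncdfE ncdfE lerD2r; exact: hA.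
Qed.

(** Cut points for [Sfun_le]: u is the g-quantile of Phi, and at z the density b together with the
    part of phi left of u has collected mass 1. If that happens only after u, then B z = 1 - g;
    otherwise the intermediate value theorem finds z below u. *)
Lemma tail_cut (g : R) : 0 < g < 1 -> exists u z, Phi u = g /\ B z + Phi (Num.min z u) = 1.
Proof.
move=> g01; have /andP[g0 g1] := g01; have [u hu] := ncdf_inv 0 n1 g01.
exists u; have [h|h] := leP (B u + Phi u) 1.
  have [z hz] : exists z, B z = 1 - g.
    by apply: (ncdf_inv _ s0); rewrite subr_gt0 g1 ltrBlDr ltrDl.
  exists z; split=> //; rewrite (min_idPr _) ?hz ?hu ?subrK //.
  rewrite leNgt; apply/negP => /(ncdf_mono m s0); rewrite hz.
  by move: h; rewrite hu; move: (B u) => v; lra.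
have [y hy] : exists y, B y + Phi y < 1.
  have h20 : 0 < 2^-1 :> R by rewrite invr_gt0.
  have [y1 h1] := @ncdf_small R m s 2^-1 h20.
  have [y2 h2] := @ncdf_small R 0 1 2^-1 h20.
  exists (Num.min y1 y2).
  have : B (Num.min y1 y2) <= B y1 by apply: ncdf_le; rewrite // ge_min lexx.
  have : Phi (Num.min y1 y2) <= Phi y2 by apply: ncdf_le; rewrite // ge_min lexx orbT.
  by move: h1 h2; move: (ncdf _ _ _) (ncdf _ _ _) (ncdf _ _ _) (ncdf _ _ _) => *; lra.
have yu : y <= u.
  rewrite leNgt; apply/negP => uy; have := ncdf_mono m s0 uy; have := ncdf_mono 0 n1 uy.
  by move: h hy; move: (ncdf _ _ _) (ncdf _ _ _) (ncdf _ _ _) (ncdf _ _ _) => *; lra.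
have cc : {within `[y, u], continuous (fun z => B z + Phi z)}.
  apply: continuous_subspaceT => x.
  by apply: (@continuousD R R^o R^o B Phi x); exact: ncdf_continuous.
have [|z] := @IVT R (fun z => B z + Phi z) y u 1 yu cc.
  by rewrite ge_min le_max (ltW hy) (ltW h) orbT.
by rewrite in_itv /= => /andP[_ zu] hz; exists z; rewrite (min_idPl zu).
Qed.

(** The optimal dominating law adds to b the mass g of phi left of u and drops everything right of
    z. It dominates Phi left of u because b is nonnegative, between u and z because Phi - B <= g,
    and beyond z because its mass is exhausted. *)
Lemma Sfun_le (g : R) : 0 < g < 1 -> (forall x, Phi x - B x <= g) ->
  inf [set fine (\int[mu]_t (`|a t - b t|)%:E) / 2 | a in @dominating_density R] <= g.
Proof.
move=> g01 hg; have [u [z [hu hz]]] := tail_cut g01.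
pose f1 t := b t + (phi \_ (Ny u)) t.
pose a := f1 \_ (Ny z).
have f1i : mu.-integrable setT (EFin \o f1).
  exact: integrableD_R bi (integrable_restrict u pi_).
have ai : mu.-integrable setT (EFin \o a) by exact: integrable_restrict.
have L1 x : lint f1 x = B x + Phi (Num.min x u).
  by rewrite lintD // ?lint_restrict ?ncdfE //; exact: integrable_restrict.
have r0 t : 0 <= (phi \_ (Ny u)) t.
  by rewrite /patch; case: ifP => // _; exact: normal_pdf_ge0.
have f10 t : 0 <= f1 t by rewrite addr_ge0 // normal_pdf_ge0.
have a0 t : 0 <= a t by rewrite /a /patch; case: ifP.
have a1 : (\int[mu]_t a t = 1)%R by rewrite rint_restrict L1.
have A x : lint a x = lint f1 (Num.min x z) by rewrite lint_restrict.
have da : dominating_density a.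
  split => //.
  - by move/integrableP: ai => [/measurable_EFinP].
  - by rewrite -[LHS]fineK ?integrable_fin_num // -[fine _]/(Rintegral _ _ _) a1.
  - move=> x; rewrite -[X in _ <= X]/(lint a x) A L1 -[Defs.Phi x]/(lint phi x) -ncdfE.
    have [xz|zx] := leP x z; last by rewrite hz ncdf_le1.
    have [xu|ux] := leP x u; first by rewrite lerDr ltW // ncdf_gt0.
    by rewrite hu -lerBlDl; exact: hg.
apply: le_trans (_ : fine (\int[mu]_t (`|a t - b t|)%:E) / 2 <= _).
  apply: ge_inf; last by exists a.
  exists 0 => _ [a' _ <-]; apply: divr_ge0 => //.
  by apply: fine_ge0; apply: integral_ge0 => t _; rewrite lee_fin.
rewrite ler_pdivrMr // -[X in X <= _]/(\int[mu]_t `|a t - b t|)%R.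
(* A majorant of |a - b| with integral g + (1 - B z), where 1 - B z is Phi at the smaller of z and
   u, hence at most g. *)
pose c t := (phi \_ (Ny u)) t + (b t - (b \_ (Ny z)) t).
have ci : mu.-integrable setT (EFin \o c).
  apply: integrableD_R; first exact: integrable_restrict.
  by apply: integrableB_R => //; exact: integrable_restrict.
apply: (@le_trans _ _ (\int[mu]_t c t)%R).
  apply: le_Rintegral => //; first exact/integrable_norm_R/integrableB_R.
  move=> t _; rewrite /a /c /f1 /patch; have := r0 t; have := normal_pdf_ge0 m s t.
  rewrite /patch; case: (t \in Ny z) => h1 h2.
    by rewrite addrC addKr ger0_norm // subrr addr0.
  by rewrite sub0r normrN ger0_norm // subr0 lerDr.
rewrite RintegralD //; last 2 first.
- exact: integrable_restrict.
- by apply: integrableB_R => //; exact: integrable_restrict.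
rewrite RintegralB // ?rint_normal ?rint_restrict; last exact: integrable_restrict.
rewrite -!ncdfE hu.
have : Phi (Num.min z u) <= Phi u by apply: ncdf_le; rewrite // ge_min lexx orbT.
by move: hz hu; move: (ncdf _ _ _) (B z) (ncdf _ _ _) => *; lra.
Qed.

End Sfun.

Lemma phi_le x y : `|x| <= `|y| -> phi y <= phi x.
Proof.
move=> xy; rewrite !normal_pdfE ?oner_eq0 // ler_wpM2l ?normal_peak_ge0 //.
rewrite /normal_fun !subr0 ler_expR ler_pM2r ?invr_gt0 ?mulrn_wgt0 //.
by rewrite lerN2 -[x ^+ 2]real_normK ?num_real // -[y ^+ 2]real_normK ?num_real // ler_sqr ?nnegrE.
Qed.

Section Quantile.
Variables (nu eps : R).
Hypotheses (nu0 : 0 < nu) (eps01 : 0 < eps < 1).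
Local Notation s := (Num.sqrt nu).
Let s0 : 0 < s. Proof. by rewrite sqrtr_gt0. Qed.
Let e0 : 0 < eps. Proof. by case/andP: eps01. Qed.

(* The gap is small outside a compact interval, on which the decrease is uniform. *)
Lemma gap_strict m' m : m' < m -> (forall x, Phi x - ncdf m s x <= eps) ->
  exists2 g, 0 < g < eps & forall x, Phi x - ncdf m' s x <= g.
Proof.
move=> mm h.
have e2 : 0 < eps / 2 by rewrite divr_gt0.
have e21 : 1 - eps / 2 < 1 by rewrite ltrBlDr ltrDl.
have [a ha] := @ncdf_small R 0 1 _ e2.
have [c hc] := @ncdf_large R m' s _ e21.
pose M := Num.max `|(a - m') / s| (Num.max `|(a - m) / s| (Num.max `|(c - m') / s| `|(c - m) / s|)).
(* On the window from a to c, moving the mean from m to m' lowers the gap by at least d: the density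
   between the two normalised arguments is at least phi M. *)
pose d := phi M * ((m - m') / s).
have d0 : 0 < d by rewrite mulr_gt0 ?npdf_gt0 // divr_gt0 ?subr_gt0.
exists (Num.max (eps / 2) (eps - d)).
  rewrite lt_max e2 gt_max /= ltr_pdivrMr // ltr_pMr // ltr1n /=.
  by rewrite ltrBlDr ltrDl.
move=> x; rewrite le_max.
have [xa|ax] := leP x a.
  apply/orP; left; have := ncdf_le 0 n1 xa; have := ncdf_gt0 m' s0 x.
  by move: ha; move: (ncdf _ _ _) (ncdf _ _ _) (ncdf _ _ _) => *; lra.
have [cx|xc] := leP c x.
  apply/orP; left; have := ncdf_le m' s0 cx; have := ncdf_le1 0 1 x.
  by move: hc; move: (ncdf _ _ _) (ncdf _ _ _) (ncdf _ _ _) => *; lra.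
apply/orP; right.
have := h x; rewrite !(ncdf_scale _ _ s0).
have le : (x - m) / s <= (x - m') / s by rewrite ler_pM2r ?invr_gt0 // lerB // ltW.
have [y /andP[y1 y2] e] := mean_value (ncdf_derive 0 n1) le.
have yM : `|y| <= `|M|.
  rewrite [`|M|]ger0_norm; last by rewrite !le_max normr_ge0.
  have u1 : (a - m) / s <= (x - m) / s by rewrite ler_pM2r ?invr_gt0 // lerB // ltW.
  have u2 : (x - m') / s <= (c - m') / s by rewrite ler_pM2r ?invr_gt0 // lerB // ltW.
  have v1 : - M <= (a - m) / s.
    rewrite lerNl; apply: le_trans (ler_norm _) _.
    by rewrite normrN !le_max lexx !orbT.
  have v2 : (c - m') / s <= M by rewrite !le_max ler_norm !orbT.
  by rewrite ler_norml (le_trans v1 (le_trans u1 y1)) (le_trans y2 (le_trans u2 v2)).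
have := phi_le yM.
have E : (x - m') / s - (x - m) / s = (m - m') / s by rewrite -mulrBl; congr (_ / _); ring.
rewrite E in e.
have k0 : 0 < (m - m') / s by rewrite divr_gt0 ?subr_gt0.
rewrite /d; move: e k0; move: ((m - m') / s) (phi y) (phi M) (Phi _) (Phi _) (Phi _).
move=> k p q v w t e k0 hpq hh; nra.
Qed.

Let S := Sfun nu.

(** Together with [Sfun_set_lbound] it makes the infimum in [qinv] a genuine one; [inf] of an empty
    or unbounded set would only be a default value. *)
Lemma Sfun_set_nonempty : [set m | eps <= S m] !=set0.
Proof.
have /andP[_ e1] := eps01.
have h1 : (1 + eps) / 2 < 1 by rewrite ltr_pdivrMr // mul1r; lra.
have h2 : 0 < (1 - eps) / 2 by rewrite divr_gt0 // subr_gt0.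
have [x hx] := @ncdf_large R 0 1 _ h1; have [y hy] := @ncdf_small R 0 1 _ h2.
exists (x - s * y) => /=; apply: le_trans (Sfun_ge (x - s * y) s x).
rewrite (ncdf_scale _ _ s0) (_ : (x - _) / s = y); last by field; rewrite gt_eqF.
by move: hx hy; move: (ncdf _ _ _) (ncdf _ _ _) => *; lra.
Qed.

Lemma Sfun_set_lbound : has_lbound [set m | eps <= S m].
Proof.
have e2 : 0 < eps / 2 by rewrite divr_gt0.
have e21 : 1 - eps / 2 < 1 by rewrite ltrBlDr ltrDl.
have [a ha] := @ncdf_small R 0 1 _ e2.
have [c hc] := @ncdf_large R 0 1 _ e21.
exists (a - s * c) => m /= em; rewrite leNgt; apply/negP => hm; move: em; apply/negP; rewrite -ltNge.
apply: (@le_lt_trans _ _ (eps / 2)); last by rewrite ltr_pdivrMr // ltr_pMr // ltr1n.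
apply: Sfun_le => //.
  by rewrite e2 /= ltr_pdivrMr // mul1r; have /andP[_] := eps01; lra.
move=> x; have [xa|ax] := leP x a.
  have := ncdf_le 0 n1 xa; have := ncdf_gt0 m s0 x.
  by move: ha; move: (ncdf _ _ _) (ncdf _ _ _) (ncdf _ _ _) => *; lra.
have cx : c <= (x - m) / s.
  by rewrite ler_pdivlMr // mulrC; move: hm ax; move: (s * c) => *; lra.
have := ncdf_le 0 n1 cx; have := ncdf_le1 0 1 x; rewrite (ncdf_scale _ _ s0).
by move: hc; move: (ncdf _ _ _) (ncdf _ _ _) (ncdf _ _ _) => *; lra.
Qed.

Lemma qinv_Sfun_below m : m < qinv S eps ->
  exists2 g, g < eps & forall x, Phi x - ncdf m s x <= g.
Proof.
move=> hm; exists (S m); last by move=> x; exact: Sfun_ge.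
rewrite ltNge; apply/negP => h; move: hm; rewrite ltNge => /negP; apply.
exact: (ge_inf Sfun_set_lbound).
Qed.

(** Some m' < m satisfies eps <= S m'. If the gap at m never exceeded eps, [gap_strict] would keep
    the gap at m' below some g < eps, and [Sfun_le] would give S m' <= g. Monotonicity of S is
    avoided. *)
Lemma qinv_Sfun_above m : qinv S eps < m -> exists x, eps < Phi x - ncdf m s x.
Proof.
rewrite -subr_gt0 => hm; apply: contrapT => H.
have h x : Phi x - ncdf m s x <= eps.
  by rewrite leNgt; apply/negP => hx; apply: H; exists x.
have [|m' /= em'] := @inf_adherent R [set m | eps <= S m] _ hm.
  by split; [exact: Sfun_set_nonempty|exact: Sfun_set_lbound].
rewrite addrC subrK => m'm.
have [g /andP[g0 ge] hg] := gap_strict m'm h.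
have := @Sfun_le m' s s0 g; rewrite g0 (lt_trans ge) ?(andP eps01).2 // => /(_ isT hg).
by rewrite leNgt (lt_le_trans ge em').
Qed.

Lemma qinv_Phi_below y : y < qinv Phi eps -> Phi y < eps.
Proof.
move=> hy; rewrite ltNge; apply/negP => h; move: hy; rewrite ltNge => /negP; apply.
apply: ge_inf; last exact: h.
have [a ha] := @ncdf_small R 0 1 _ e0; exists a => x /= hx.
rewrite leNgt; apply/negP => /(ncdf_mono 0 n1).
by move: ha hx; move: (ncdf _ _ _) (ncdf _ _ _) => *; lra.
Qed.

End Quantile.
End Sesquinormal.

(** * The converse bound for a single thermal operation *)

Section ThermalConverse.
Variable R : realType.
Local Notation C := (complex R).

Lemma sum_mxtens (S : nmodType) m n (F : 'I_(m * n) -> S) :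
  \sum_k F k = \sum_i \sum_j F (mxtens_index (i, j)).
Proof.
rewrite pair_big /= (reindex (@mxtens_index m n)) /=; last first.
  by exists (@mxtens_unindex m n) => k _; rewrite ?mxtens_indexK ?mxtens_unindexK.
by apply: eq_bigr => -[i j] _.
Qed.

Lemma tr_tens m n (A : 'M[C]_m) (B : 'M[C]_n) : \tr (A *t B) = \tr A * \tr B.
Proof.
rewrite /mxtrace sum_mxtens mulr_suml; apply: eq_bigr => i _.
by rewrite mulr_sumr; apply: eq_bigr => j _; rewrite tensmxE.
Qed.

Lemma tr_ptr2M m k (A : 'M[C]_(m * k)) (T : 'M[C]_m) :
  \tr (ptr2 A *m T) = \tr (A *m (T *t (1%:M : 'M[C]_k))).
Proof.
rewrite /mxtrace sum_mxtens; apply: eq_bigr => i _.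
under [RHS]eq_bigr => l _ do rewrite mxE sum_mxtens exchange_big /=.
transitivity (\sum_j \sum_(l < k) A (mxtens_index (i, l)) (mxtens_index (j, l)) * T j i).
  by rewrite mxE; apply: eq_bigr => j _; rewrite mxE mulr_suml.
rewrite exchange_big /=; apply: eq_bigr => l _.
rewrite [RHS](bigD1 l) //= [X in _ = _ + X]big1 ?addr0 => [|l' ll'].
  by apply: eq_bigr => j _; rewrite tensmxE mxE eqxx mulr1.
by apply: big1 => j _; rewrite tensmxE [1%:M _ _]mxE (negbTE ll') !mulr0.
Qed.

Lemma tr_ptr2 m k (A : 'M[C]_(m * k)) : \tr (ptr2 A) = \tr A.
Proof. by rewrite -[ptr2 A]mulmx1 tr_ptr2M tens11 mulmx1. Qed.

Lemma herm_ptr2 m k (A : 'M[C]_(m * k)) : herm_mx A -> herm_mx (ptr2 A).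
Proof.
move=> hA; apply/matrixP => i j; rewrite daggerE !mxE rmorph_sum.
by apply: eq_bigr => l _; rewrite -{2}hA daggerE.
Qed.

Definition tfun (op : R -> R -> R) m n (a : 'I_m -> R) (b : 'I_n -> R) (k : 'I_(m * n)) :=
  op (a (mxtens_unindex k).1) (b (mxtens_unindex k).2).

Lemma tfunE op m n (a : 'I_m -> R) (b : 'I_n -> R) i j :
  tfun op a b (mxtens_index (i, j)) = op (a i) (b j).
Proof. by rewrite /tfun mxtens_indexK. Qed.

Lemma dg_tens m n (a : 'I_m -> R) (b : 'I_n -> R) :
  dg a *t dg b = dg (tfun *%R a b).
Proof.
apply/matrixP => k l; case: (mxtens_indexP k) => i j; case: (mxtens_indexP l) => i' j'.
rewrite tensmxE !dgE tfunE (can_eq (@mxtens_indexK _ _)) xpair_eqE.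
case: eqP => _; rewrite ?mulr0n ?mul0r //; case: eqP => _; rewrite ?mulr0n ?mulr0 //.
by rewrite !mulr1n rCM.
Qed.

Lemma spf_tens m n p q (V : 'M[C]_(m, n)) (W : 'M[C]_(p, q)) a b :
  spf V a *t spf W b = spf (V *t W) (tfun *%R a b).
Proof. by rewrite /spf -!tensmx_mul dg_tens dagger_tens. Qed.

Lemma spfD m n (V : 'M[C]_(m, n)) d e :
  spf V d + spf V e = spf V (fun i => d i + e i).
Proof.
rewrite /spf -mulmxDl -mulmxDr; congr (_ *m _ *m _).
by apply/matrixP => i j; rewrite mxE !dgE -mulrnDl rCD.
Qed.

Lemma hsum_spf m n p q (V : 'M[C]_(m, n)) (W : 'M[C]_(p, q)) a b :
  unitary_mx V -> unitary_mx W ->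
  hsum (spf V a) (spf W b) = spf (V *t W) (tfun +%R a b).
Proof.
move=> uV uW; rewrite /hsum -(spf1 uV) -(spf1 uW) !spf_tens spfD.
by apply: eq_spf => k; rewrite /tfun mulr1 mul1r.
Qed.

Definition gw (beta : R) n (E : 'I_n -> R) (i : 'I_n) : R :=
  expR (- beta * E i) / \sum_j expR (- beta * E j).

Lemma gibbs_spf beta m n (V : 'M[C]_(m, n)) E : unitary_mx V ->
  gibbs beta (spf V E) = spf V (gw beta E).
Proof.
move=> uV; rewrite /gibbs /mexp -rCN spfZ mfun_spf // tr_spf //.
rewrite -[X in X *: _](fmorphV (@real_complex R)) -/(rC _) spfZ.
by apply: eq_spf => i; rewrite mulrC.
Qed.

Lemma gw_sum_gt0 beta n (E : 'I_n -> R) (i : 'I_n) : 0 < \sum_j expR (- beta * E j).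
Proof.
rewrite (bigD1 i) //= ltr_pwDl ?expR_gt0 // sumr_ge0 // => j _; exact: expR_ge0.
Qed.

Lemma gw_gt0 beta n (E : 'I_n -> R) i : 0 < gw beta E i.
Proof. by rewrite divr_gt0 ?expR_gt0 // (gw_sum_gt0 _ _ i). Qed.

Lemma gw_sum1 beta n (E : 'I_n -> R) : (0 < n)%N -> \sum_i gw beta E i = 1.
Proof.
case: n E => // n E _; rewrite -mulr_suml divff // gt_eqF //.
exact: (gw_sum_gt0 _ _ ord0).
Qed.

Lemma gw_tfun beta m n (E : 'I_m -> R) (F : 'I_n -> R) k :
  gw beta (tfun +%R E F) k = tfun *%R (gw beta E) (gw beta F) k.
Proof.
case: (mxtens_indexP k) => i j; rewrite tfunE /gw tfunE.
rewrite sum_mxtens.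
under eq_bigr => i' _ do under eq_bigr => j' _ do rewrite tfunE mulrDr expRD.
under eq_bigr => i' _ do rewrite -mulr_sumr.
by rewrite -mulr_suml mulrDr expRD invfM mulrACA.
Qed.

Lemma spf_conj m n k (V : 'M[C]_(m, n)) (U : 'M[C]_(m, k)) d :
  dagger U *m spf V d *m U = spf (dagger U *m V) d.
Proof. by rewrite /spf daggerM daggerK !mulmxA. Qed.

Lemma proj_spf n k (V : 'M[C]_(n, k)) (P : pred 'I_k) : unitary_mx V ->
  proj_mx (spf V (fun i => (P i)%:R)).
Proof.
move=> uV; split; first exact: herm_spf.
by rewrite spfM //; apply: eq_spf => i; case: (P i); rewrite ?mulr1 ?mulr0.
Qed.

Lemma tr_spf2 n k (V : 'M[C]_(n, k)) d e : unitary_mx V ->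
  \tr (spf V d *m spf V e) = rC (\sum_i d i * e i).
Proof. by move=> uV; rewrite spfM // tr_spf. Qed.

Lemma herm_conj m n (A : 'M[C]_m) (U : 'M[C]_(m, n)) :
  herm_mx A -> herm_mx (dagger U *m A *m U).
Proof. by move=> hA; rewrite /herm_mx !daggerM daggerK hA mulmxA. Qed.

(** The Gibbs state is a function of the total Hamiltonian, so energy conservation carries it along;
    for non-interacting parts it factorises on both sides. *)
Lemma gibbs_hsum_conj beta dS dB dO dK (HS : 'M[C]_dS) (HB : 'M[C]_dB)
    (HO : 'M[C]_dO) (HK : 'M[C]_dK) (U : 'M[C]_(dS * dB, dO * dK)) :
  herm_mx HS -> herm_mx HB -> herm_mx HO -> herm_mx HK -> unitary_mx U ->
  dagger U *m hsum HS HB *m U = hsum HO HK ->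
  dagger U *m (gibbs beta HS *t gibbs beta HB) *m U = gibbs beta HO *t gibbs beta HK.
Proof.
move=> /herm_diag[VS [ES [uS ->]]] /herm_diag[VB [EB [uB ->]]].
move=> /herm_diag[VO [EO [uO ->]]] /herm_diag[VK [EK [uK ->]]] uU.
rewrite !hsum_spf // => E.
rewrite !gibbs_spf // !spf_tens.
rewrite -(eq_spf _ (gw_tfun beta ES EB)) -(eq_spf _ (gw_tfun beta EO EK)).
rewrite -!gibbs_spf; try exact: unitary_tens.
rewrite -E !spf_conj !gibbs_spf //; try exact: unitary_tens.
  by rewrite spf_conj.
by apply: unitary_mul; [exact: unitary_dagger|exact: unitary_tens].
Qed.

(** The output test is pulled back through the unitary to a projection [M] on system and bath. There
    the Gibbs state of the input passes it with the Gibbs probability of the output, and the bath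
    factors cancel in [test_bound], so no bath dimension survives. *)
Lemma TO_converse beta dS dO kS kO (VS : 'M[C]_(dS, kS)) (ES r : 'I_kS -> R)
    (W : 'M[C]_(dS, kS)) (VO : 'M[C]_(dO, kO)) (EO t : 'I_kO -> R)
    (P : pred 'I_kO) (l eps : R) :
  unitary_mx VS -> unitary_mx W -> unitary_mx VO ->
  (forall i, 0 <= r i) -> \sum_i r i = 1 -> \sum_i t i = 1 -> 0 < l ->
  TO_eps beta (spf VS ES) (spf VO EO) (spf W r) (spf VO t) eps ->
  \sum_i t i * (P i)%:R +
  \sum_i \sum_j nsq ((dagger VS *m W) j i) *
     (r i * (l * gw beta ES j) / (r i + l * gw beta ES j))
  <= 1 + eps + l * \sum_i gw beta EO i * (P i)%:R.
Proof.
move=> uS uW uO r0 r1 t1 l0 [dB [HB [dK [HK [U [dB0 [dK0 [hB [hK [uU [UE td]]]]]]]]]]].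
have gE := gibbs_hsum_conj beta (herm_spf _ _) hB (herm_spf _ _) hK uU UE.
have [VB [EB [uB EBE]]] := herm_diag hB.
have [VK [EK [uK EKE]]] := herm_diag hK.
pose T := spf VO (fun i => (P i)%:R).
have pT : proj_mx T by exact: proj_spf.
pose T1 := T *t (1%:M : 'M[C]_dK).
have pT1 : proj_mx T1.
  split; first by rewrite /herm_mx dagger_tens dagger1 pT.1.
  by rewrite tensmx_mul pT.2 mulmx1.
pose M := U *m T1 *m dagger U.
have pM : proj_mx M by exact: proj_conj.
move: td; rewrite EBE gibbs_spf // spf_tens.
set rB := spf (W *t VB) _ => td.
have trR : \tr rB = 1.
  rewrite tr_spf; last exact: unitary_tens.
  rewrite sum_mxtens (_ : \sum_i _ = 1) //.
  under eq_bigr => i _ do under eq_bigr => j _ do rewrite tfunE.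
  by under eq_bigr => i _ do rewrite -mulr_sumr gw_sum1 // mulr1.
set sg := ptr2 _ in td.
have trs : \tr sg = 1.
  by rewrite tr_ptr2 mxtrace_mulC mulmxA uU.1 mul1mx.
have hs : herm_mx sg by apply/herm_ptr2/herm_conj/herm_spf.
have lb : complex.Re (\tr (spf VO t *m T)) - complex.Re (\tr (sg *m T)) <= eps.
  apply: le_trans td; apply: tdist_proj => //; first exact: herm_spf.
  by rewrite trs tr_spf // t1.
have sgT : \tr (sg *m T) = \tr (rB *m M).
  by rewrite tr_ptr2M -/T1 /M -!mulmxA mxtrace_mulC !mulmxA.
have gT : \tr (spf (VS *t VB) (tfun *%R (gw beta ES) (gw beta EB)) *m M) =
    rC (\sum_i gw beta EO i * (P i)%:R).
  rewrite /M -spf_tens -!gibbs_spf // -EBE 2!mulmxA mxtrace_mulC !mulmxA.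
  rewrite -[_ *m U *m T1]mulmxA [_ *m (U *m T1)]mulmxA gE /T1 tensmx_mul mulmx1.
  rewrite tr_tens EKE !gibbs_spf // tr_spf2 // tr_spf // gw_sum1 //.
  by rewrite rC1 mulr1.
have := @test_bound _ _ _ _ (W *t VB) (VS *t VB) (tfun *%R r (gw beta EB))
   (tfun *%R (gw beta ES) (gw beta EB)) M l.
move=> /(_ (unitary_tens uW uB) (unitary_tens uS uB)) H.
have {H} : \sum_i \sum_j nsq ((dagger VS *m W) j i) *
     (r i * (l * gw beta ES j) / (r i + l * gw beta ES j)) <=
   1 - complex.Re (\tr (rB *m M)) + l * \sum_i gw beta EO i * (P i)%:R.
  rewrite (_ : 1 - _ = complex.Re (\tr (rB *m (1%:M - M)))); last first.
    by rewrite mulmxBr mulmx1 !raddfB /= trR.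
  rewrite -[X in _ + l * X]rC_Re -gT.
  refine (le_trans _ (H _ _ pM l0)).
  - rewrite sum_mxtens; apply: ler_sum => i _.
    apply: (@le_trans _ _ (\sum_b gw beta EB b * (\sum_j nsq ((dagger VS *m W) j i) *
       (r i * (l * gw beta ES j) / (r i + l * gw beta ES j))))).
      by rewrite -mulr_suml gw_sum1 // mul1r.
    apply: ler_sum => b _; rewrite sum_mxtens mulr_sumr; apply: ler_sum => j _.
    (* Only equal bath indices are kept, where the bath overlap is 1; the other terms are
       nonnegative. *)
    rewrite (bigD1 b) //= ler_wpDr //.
      apply: sumr_ge0 => b' _; rewrite mulr_ge0 ?nsq_ge0 // !tfunE.
      have h1 := gw_gt0 beta ES j; have h2 := gw_gt0 beta EB b'; have h3 := gw_gt0 beta EB b.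
      have u0 := mulr_ge0 (r0 i) (ltW h3).
      have v0 := mulr_ge0 (ltW l0) (mulr_ge0 (ltW h1) (ltW h2)).
      exact: divr_ge0 (mulr_ge0 u0 v0) (addr_ge0 u0 v0).
    rewrite !tfunE dagger_tens tensmx_mul tensmxE uB.2 [1%:M _ _]mxE eqxx mulr1.
    have h1 := gw_gt0 beta ES j; have h3 := gw_gt0 beta EB b.
    have h4 : 0 < r i + l * gw beta ES j by rewrite ltr_wpDl // mulr_gt0.
    rewrite le_eqVlt; apply/orP; left; apply/eqP.
    rewrite mulrCA; congr (_ * _); field.
    rewrite (gt_eqF h4) /= gt_eqF // (_ : _ + _ = (r i + l * gw beta ES j) * gw beta EB b); last by ring.
    by rewrite mulr_gt0.
  - by move=> k; case: (mxtens_indexP k) => i b; rewrite tfunE mulr_ge0 // ltW // gw_gt0.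
  - by move=> k; case: (mxtens_indexP k) => i b; rewrite tfunE mulr_gt0 // gw_gt0.
move: lb; rewrite tr_spf2 // rC_Re sgT.
move: (complex.Re _) => X h1 h2; lra.
Qed.

End ThermalConverse.

(** * Monotone coupling of two finite laws *)

Section Coupling.
Variable R : realType.

Lemma sum_seq_index (T : eqType) (S : nmodType) (s : seq T) (F : nat -> S) :
  uniq s -> \sum_(i <- s) F (index i s) = \sum_(0 <= j < size s) F j.
Proof.
case: s => [|x s] us; first by rewrite big_nil big_nil.
rewrite (big_nth x) !big_nat; apply: eq_bigr => j /andP[_ js].
by rewrite index_uniq.
Qed.

(** Length of the intersection of [a, a'] and [b, b'], written with minima so that sums over
    adjacent intervals telescope. *)
Definition overlap (a a' b b' : R) :=
  Num.min a' b' - Num.min a b' - Num.min a' b + Num.min a b.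

Lemma overlap_ge0 a a' b b' : a <= a' -> b <= b' -> 0 <= overlap a a' b b'.
Proof.
move=> aa bb; rewrite /overlap; have [] := leP a' b'; have [] := leP a b';
  have [] := leP a' b; have [] := leP a b; lra.
Qed.

Lemma overlap_eq0 a a' b b' : a <= a' -> b <= b' -> a' <= b -> overlap a a' b b' = 0.
Proof.
move=> aa bb ab; rewrite /overlap !(min_idPl _) //; try lra.
Qed.

Lemma min_lip (a a' c : R) : a <= a' -> Num.min a' c - Num.min a c <= a' - a.
Proof. by move=> aa; have [] := leP a' c; have [] := leP a c; lra. Qed.

Lemma min_mono (a a' c : R) : a <= a' -> 0 <= Num.min a' c - Num.min a c.
Proof. by move=> aa; have [] := leP a' c; have [] := leP a c; lra. Qed.

Section Cumul.
Variables (T : finType) (p r : T -> R).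
Hypothesis p0 : forall i, 0 <= p i.

Definition rsort := sort (fun i j => r i <= r j) (enum T).
Definition cum (j : nat) := \sum_(i <- take j rsort) p i.
Definition pos (i : T) := index i rsort.

Lemma perm_rsort : perm_eq rsort (enum T).
Proof. by rewrite perm_sort. Qed.

Lemma uniq_rsort : uniq rsort.
Proof. by rewrite (perm_uniq perm_rsort) enum_uniq. Qed.

Lemma mem_rsort i : i \in rsort.
Proof. by rewrite (perm_mem perm_rsort) mem_enum. Qed.

Lemma sum_rsort (S : nmodType) (F : T -> S) : \sum_(i <- rsort) F i = \sum_i F i.
Proof. by rewrite (perm_big _ perm_rsort) /= big_enum. Qed.

Lemma cum0 : cum 0 = 0. Proof. by rewrite /cum take0 big_nil. Qed.

Lemma cum_size : cum (size rsort) = \sum_i p i.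
Proof. by rewrite /cum take_size sum_rsort. Qed.

Lemma cumS i : cum (pos i).+1 = cum (pos i) + p i.
Proof.
rewrite /cum (take_nth i) ?index_mem ?mem_rsort // -cats1 big_cat big_seq1 /=.
by rewrite nth_index // mem_rsort.
Qed.

Lemma sum_pos (S : zmodType) (F : nat -> S) :
  \sum_i (F (pos i).+1 - F (pos i)) = F (size rsort) - F 0%N.
Proof.
rewrite -sum_rsort (sum_seq_index (fun j => F j.+1 - F j) uniq_rsort).
exact: telescope_sumr.
Qed.

Let rtrans : transitive (fun i j => r i <= r j).
Proof. by move=> x y z; apply: le_trans. Qed.

Lemma rsorted : sorted (fun i j => r i <= r j) rsort.
Proof. by apply: sort_sorted => x y; apply: le_total. Qed.

Lemma pos_le i j : (pos i <= pos j)%N -> r i <= r j.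
Proof.
move=> ij; have := sorted_leq_index rtrans (fun x => lexx (r x)) rsorted.
by apply; rewrite ?mem_rsort.
Qed.

Lemma mem_take_pos i j : (i \in take j rsort) = (pos i < j)%N.
Proof. by rewrite in_take // mem_rsort. Qed.

Lemma big_take (j : nat) (F : T -> R) :
  \sum_(i <- take j rsort) F i = \sum_(i | (pos i < j)%N) F i.
Proof.
rewrite -[RHS]big_filter; apply: perm_big; apply: uniq_perm.
- by rewrite take_uniq // uniq_rsort.
- by rewrite filter_uniq // index_enum_uniq.
- by move=> i; rewrite mem_take_pos mem_filter mem_index_enum andbT.
Qed.

(** With [cum_ge] it places the interval of i relative to the distribution function of r; these are
    inequalities because ties may be sorted in any order. *)
Lemma cumS_le i : cum (pos i).+1 <= \sum_j p j * (r j <= r i)%R%:R.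
Proof.
rewrite /cum big_take big_mkcond /=; apply: ler_sum => j _.
rewrite ltnS; case: ifP => [/pos_le ->|_]; first by rewrite mulr1.
by rewrite mulr_ge0.
Qed.

Lemma cum_ge i c : c < r i -> \sum_j p j * (r j <= c)%R%:R <= cum (pos i).
Proof.
move=> ci; rewrite /cum big_take [leRHS]big_mkcond /=; apply: ler_sum => j _.
have [jc|] := leP (r j) c; last by rewrite mulr0; case: ifP.
rewrite mulr1 ifT // ltnNge; apply/negP => /pos_le h.
by move: ci; rewrite ltNge (le_trans h).
Qed.

End Cumul.

(* Lay out both laws on the unit interval in increasing order of their ratios r and q, the second one shifted by e; X is the overlap of the resulting intervals. *)
Lemma coupling (I O : finType) (p r : I -> R) (t q : O -> R) (e : R) :
  (forall i, 0 <= p i) -> (forall k, 0 <= t k) ->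
  \sum_i p i = 1 -> \sum_k t k = 1 -> 0 <= e <= 1 ->
  (forall c, \sum_i p i * (r i <= c)%R%:R <= e + \sum_k t k * (q k <= c)%R%:R) ->
  exists X : I -> O -> R,
    [/\ forall i k, 0 <= X i k, forall i, \sum_k X i k <= p i,
      forall k, \sum_i X i k <= t k, \sum_i \sum_k X i k = 1 - e &
      forall i k, 0 < X i k -> q k <= r i].
Proof.
move=> p0 t0 p1 t1 /andP[e0 e1] H.
pose a i := cum p r (pos r i); pose a' i := cum p r (pos r i).+1.
pose b k := e + cum t q (pos q k); pose b' k := e + cum t q (pos q k).+1.
have aa i : a i <= a' i by rewrite /a /a' cumS lerDl.
have bb k : b k <= b' k by rewrite /b /b' cumS addrA lerDl.
pose G := Num.min : R -> R -> R.
have sumk (x : R) : \sum_k (Num.min x (b' k) - Num.min x (b k)) = Num.min x (1 + e) - Num.min x e.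
  rewrite (sum_pos q (fun j => Num.min x (e + cum t q j))).
  by rewrite cum_size cum0 t1 addr0 [1 + e]addrC.
have sumi (y : R) : \sum_i (Num.min (a' i) y - Num.min (a i) y) = Num.min 1 y - Num.min 0 y.
  by rewrite (sum_pos r (fun j => Num.min (cum p r j) y)) cum_size cum0 p1.
have rowE i : \sum_k overlap (a i) (a' i) (b k) (b' k) =
    (Num.min (a' i) (1 + e) - Num.min (a' i) e) - (Num.min (a i) (1 + e) - Num.min (a i) e).
  rewrite -!sumk -sumrB; apply: eq_bigr => k _; rewrite /overlap; ring.
have colE k : \sum_i overlap (a i) (a' i) (b k) (b' k) =
    (Num.min 1 (b' k) - Num.min 0 (b' k)) - (Num.min 1 (b k) - Num.min 0 (b k)).
  rewrite -!sumi -sumrB; apply: eq_bigr => i _; rewrite /overlap; ring.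
have cb0 k : 0 <= b k.
  by rewrite addr_ge0 // /cum sumr_ge0.
exists (fun i k => overlap (a i) (a' i) (b k) (b' k)); split.
- by move=> i k; apply: overlap_ge0.
- move=> i; rewrite rowE.
  have := min_lip (1 + e) (aa i); have := min_mono e (aa i).
  have : a' i - a i = p i by rewrite /a /a' cumS addrC addKr.
  lra.
- move=> k; rewrite colE !(min_idPl (le_trans (cb0 k) _)) //.
  have := min_lip 1 (bb k); rewrite ![Num.min _ 1]minC.
  have : b' k - b k = t k by rewrite /b /b' cumS; ring.
  lra.
(* The two layouts fill [0, 1] and [e, 1 + e], which share length 1 - e. *)
- under eq_bigr => i _ do rewrite rowE.
  have -> : \sum_i ((Num.min (a' i) (1 + e) - Num.min (a' i) e) -
      (Num.min (a i) (1 + e) - Num.min (a i) e)) =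
    \sum_i (Num.min (a' i) (1 + e) - Num.min (a i) (1 + e)) -
    \sum_i (Num.min (a' i) e - Num.min (a i) e).
    by rewrite -sumrB; apply: eq_bigr => i _; ring.
  rewrite !sumi (min_idPl _) ?lerDl // (min_idPr e1) (min_idPl e0) (min_idPl _) //.
    by ring.
  by rewrite addr_ge0.
- move=> i k X0; rewrite leNgt; apply/negP => rq.
  (* If r i < q k, the hypothesis at c = r i puts the whole interval of i left of that of k. *)
  suff : a' i <= b k by move/(overlap_eq0 (aa i) (bb k)) => E; rewrite E ltxx in X0.
  apply: le_trans (cumS_le r p0 i) _; apply: le_trans (H _) _.
  by rewrite lerD2l; apply: cum_ge.
Qed.

End Coupling.

(** * Permutations realising integer transport plans *)

Section Labels.
Variable W : finType.

Lemma perm_of_labels (L : eqType) (l1 l2 : W -> L) :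
  (forall x, #|[pred w | l1 w == x]| = #|[pred w | l2 w == x]|) ->
  exists f : {perm W}, forall w, l2 (f w) = l1 w.
Proof.
move=> H.
have E : perm_eq (codom_tuple l1) (codom_tuple l2).
  apply/allP => x _ /=.
  rewrite /image_mem !count_map; apply/eqP.
  have cE (l : W -> L) : count (preim l (pred1 x)) (Finite.enum W) = #|[pred w | l w == x]|.
    by rewrite -enumT -sum1_count big_enum_cond -sum1_card; apply: eq_bigl => w; rewrite !inE.
  exact: etrans (cE l1) (etrans (H x) (esym (cE l2))).
move/tuple_permP : E => [s hs].
have sE (i : 'I_#|W|) : l1 (enum_val i) = l2 (enum_val (s i)).
  have := congr1 (fun t => tnth t i) (val_inj hs : codom_tuple l1 = [tuple tnth (codom_tuple l2) (s j) | j < #|W|]).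
  have tE (l : W -> L) (k : 'I_#|W|) : tnth (codom_tuple l) k = l (enum_val k).
    by rewrite (tnth_nth (l (enum_val k))) /= nth_codom.
  by rewrite tnth_mktuple !tE.
pose f w := enum_val (s (enum_rank w)).
have fi : injective f by move=> x y /enum_val_inj /perm_inj /enum_rank_inj.
exists (perm fi) => w; rewrite permE /f -sE enum_rankK.
by [].
Qed.

(** Each fibre is enumerated against a list holding n i k copies of [Some k]; positions past its end
    read the default [None]. *)
Lemma fibre_labels (A O : finType) (a : W -> A) (n : A -> O -> nat) :
  (forall i, \sum_k n i k <= #|[pred w | a w == i]|)%N ->
  exists l : W -> option O, forall i k,
    #|[pred w | (a w == i) && (l w == Some k)]| = n i k.
Proof.
move=> H.
pose E i := enum [pred w | a w == i].
pose S i := [seq Some k | k <- flatten [seq nseq (n i k) k | k <- enum O]].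
have szS i : (size (S i) <= size (E i))%N.
  rewrite size_map size_flatten /shape -map_comp -cardE.
  apply: leq_trans (H i); rewrite sumnE big_map big_enum /=.
  by apply: leq_sum => k _; rewrite /= size_nseq.
exists (fun w => nth None (S (a w)) (index w (E (a w)))) => i k.
have -> : #|[pred w | (a w == i) && (nth None (S (a w)) (index w (E (a w))) == Some k)]|
    = count (fun w => nth None (S i) (index w (E i)) == Some k) (E i).
  rewrite -sum1_count big_enum_cond -sum1_card; apply: eq_bigl => w.
  by rewrite !inE /=; case: eqP => [->|].
have -> : count (fun w => nth None (S i) (index w (E i)) == Some k) (E i) =
   count_mem (Some k) [seq nth None (S i) (index w (E i)) | w <- E i].
  by rewrite count_map.
have -> : [seq nth None (S i) (index w (E i)) | w <- E i] =
    S i ++ nseq (size (E i) - size (S i)) None.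
  have [w0 _|E0] := pickP (mem (E i)); last first.
    have Ei : E i = [::] by case: (E i) E0 => // x s /(_ x); rewrite /= inE eqxx.
    by move: (szS i); rewrite Ei /= leqn0 size_eq0 => /eqP ->.
  apply: (@eq_from_nth _ None); first by rewrite size_map size_cat size_nseq subnKC.
  rewrite size_map => j js; rewrite (nth_map w0) // index_uniq ?enum_uniq //.
  rewrite nth_cat; case: ltnP => // sj; rewrite nth_default // nth_nseq.
  by case: ifP.
rewrite count_cat [X in (_ + X)%N](_ : _ = 0%N) ?addn0; last first.
  by apply/eqP; rewrite -leqn0 leqNgt -has_count; apply/hasPn => x /nseqP[-> _].
rewrite count_map (eq_count (a2 := pred1 k)) //.
rewrite count_flatten -map_comp sumnE big_map big_enum /= (bigD1 k) //=.
rewrite count_nseq /= eqxx mul1n big1 ?addn0 // => k' kk'.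
by rewrite count_nseq /= (negbTE kk') mul0n.
Qed.

(** Planned sources are marked by their target and planned targets by their source. Both markings
    use each pair (i, k) equally often in a class, hence also leave equally many elements unmarked,
    and [perm_of_labels] matches the marks. Classes are restricted to the codomain of c to have
    finitely many. *)
Lemma perm_labels (Cl : choiceType) (I O : finType) (c : W -> Cl) (a : W -> I) (h : W -> O)
    (n : Cl -> I -> O -> nat) :
  (forall x i, \sum_k n x i k <= #|[pred w | (c w == x) && (a w == i)]|)%N ->
  (forall x k, \sum_i n x i k <= #|[pred w | (c w == x) && (h w == k)]|)%N ->
  exists f : {perm W}, (forall w, c (f w) = c w) /\
   forall x i k, (n x i k <= #|[pred w | [&& c w == x, a w == i & h (f w) == k]]|)%N.
Proof.
move=> H1 H2.
pose CF : finType := seq_sub (codom c).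
have cP w : c w \in codom c by apply: codom_f.
pose cf w : CF := SeqSub (cP w).
have cE w (x : CF) : (cf w == x) = (c w == val x) by rewrite -val_eqE.
have [|l1 hl1] := @fibre_labels (CF * I)%type O (fun w => (cf w, a w))
   (fun xi => n (val xi.1) xi.2).
  move=> [x i] /=; apply: leq_trans (H1 _ _) _.
  by apply/eq_leq/eq_card => w; rewrite !inE -[RHS]/((cf w == x) && (a w == i)) cE.
have [|l2 hl2] := @fibre_labels (CF * O)%type I (fun w => (cf w, h w))
   (fun xk i => n (val xk.1) i xk.2).
  move=> [x k] /=; apply: leq_trans (H2 _ _) _.
  by apply/eq_leq/eq_card => w; rewrite !inE -[RHS]/((cf w == x) && (h w == k)) cE.
pose m1 w : CF * option (I * O) := (cf w, omap (fun k => (a w, k)) (l1 w)).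
pose m2 w : CF * option (I * O) := (cf w, omap (fun i => (i, h w)) (l2 w)).
have e1 x i k : #|[pred w | m1 w == (x, Some (i, k))]| = n (val x) i k.
  rewrite -(hl1 (x, i) k); apply: eq_card => w.
  rewrite !inE -[RHS]/((cf w == x) && (a w == i) && (l1 w == Some k)) -andbA.
  rewrite -[LHS]/((cf w == x) && (omap (fun k => (a w, k)) (l1 w) == Some (i, k))).
  by congr (_ && _); case: (l1 w) => [k'|] /=; rewrite ?andbF.
have e2 x i k : #|[pred w | m2 w == (x, Some (i, k))]| = n (val x) i k.
  rewrite -(hl2 (x, k) i); apply: eq_card => w.
  rewrite !inE -[RHS]/((cf w == x) && (h w == k) && (l2 w == Some i)) -andbA.
  rewrite -[LHS]/((cf w == x) && (omap (fun i => (i, h w)) (l2 w) == Some (i, k))).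
  congr (_ && _); case: (l2 w) => [i'|] /=; rewrite ?andbF //.
  by rewrite -[LHS]/((i', h w) == (i, k)) xpair_eqE andbC.
(* Unmarked elements are counted by complement: sources and targets are the same set W with the same
   classes. *)
have tot (m : W -> CF * option (I * O)) x : (forall w, (m w).1 = cf w) ->
   #|[pred w | cf w == x]| = (#|[pred w | m w == (x, None)]| +
     \sum_(ik : I * O) #|[pred w | m w == (x, Some ik)]|)%N.
  move=> hm; rewrite -!sum1_card (partition_big (fun w => (m w).2) xpredT) //=.
  rewrite -[X in _ = (X + _)%N]/(\sum_(w | m w == (x, None)) 1)%N.
  have P y : (\sum_(w | (w \in [pred w | cf w == x]) && ((m w).2 == y)) 1 =
     #|[pred w | m w == (x, y)]|)%N.
    by rewrite sum1_card; apply: eq_card => w;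
      rewrite -[LHS]/((cf w == x) && ((m w).2 == y)) -[RHS]/(m w == (x, y)) -hm; case: (m w).
  rewrite (bigD1 None) //= P sum1_card; congr (_ + _)%N.
  rewrite (reindex_omap Some id) /=; last by case.
  by apply: eq_big => [ik|ik _]; rewrite ?eqxx // P.
have [|f hf] := @perm_of_labels _ m1 m2.
  move=> [x [[i k]|]]; first by rewrite e1 e2.
  apply/eqP; rewrite -(eqn_add2r (\sum_(ik : I * O) #|[pred w | m1 w == (x, Some ik)]|)).
  rewrite -(tot m1) // (eq_bigr (fun ik => #|[pred w | m2 w == (x, Some ik)]|)).
    by rewrite -(tot m2).
  by move=> [i k] _; rewrite e1 e2.
exists f; split.
  by move=> w; have /(congr1 (fun z => val z.1)) := hf w.
move=> x i k; have [xc|xc] := boolP (x \in codom c); last first.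
  have : (\sum_k n x i k <= 0)%N.
    apply: leq_trans (H1 x i) _; rewrite leqn0; apply/eqP/eq_card0 => w.
    rewrite !inE; apply/negbTE/negP => /andP[/eqP cw _].
    by move/negP: xc; apply; rewrite -cw.
  by rewrite (bigD1 k) //= leqn0 addn_eq0 => /andP[/eqP -> _].
rewrite -(e1 (SeqSub xc)); apply/subset_leq_card/fintype.subsetP => w.
rewrite !inE => /eqP mw.
have := hf w; rewrite mw /m2 => -[_].
move: mw; rewrite /m1 => -[-> ].
case: (l1 w) => // k' [-> _]; case: (l2 (f w)) => // i' [_ ->].
by rewrite !eqxx.
Qed.

End Labels.

(** * Thermal operations from bijections of energy levels *)

Section PermutationUnitaries.
Variable R : realType.
Local Notation C := (complex R).

Definition bijmx m n (F : 'I_m -> 'I_n) : 'M[C]_(m, n) :=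
  \matrix_(k, l) (F k == l)%:R.

Lemma bijmx_conj m n (F : 'I_m -> 'I_n) Fi (Y : 'M[C]_m) :
  cancel F Fi -> cancel Fi F ->
  dagger (bijmx F) *m Y *m bijmx F = \matrix_(l, l') Y (Fi l) (Fi l').
Proof.
move=> FK FiK; apply/matrixP => l l'; rewrite !mxE (bigD1 (Fi l')) //= big1 ?addr0.
  rewrite !mxE FiK eqxx mulr1 (bigD1 (Fi l)) //= big1 ?addr0.
    by rewrite daggerE mxE FiK eqxx rmorph1 mul1r.
  move=> k kl; rewrite daggerE mxE (_ : (F k == l) = false) ?rmorph0 ?mul0r //.
  by apply: contraNF kl => /eqP <-; rewrite FK.
move=> k kl; rewrite [X in _ * X]mxE (_ : (F k == l') = false) ?mulr0 //.
by apply: contraNF kl => /eqP <-; rewrite FK.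
Qed.

Lemma dagger_bijmx m n (F : 'I_m -> 'I_n) Fi : cancel F Fi -> cancel Fi F ->
  dagger (bijmx F) = bijmx Fi.
Proof.
move=> FK FiK; apply/matrixP => i j; rewrite daggerE !mxE (can2_eq FK FiK) eq_sym.
by rewrite rmorph_nat.
Qed.

Lemma unitary_bijmx m n (F : 'I_m -> 'I_n) Fi : cancel F Fi -> cancel Fi F ->
  unitary_mx (bijmx F).
Proof.
have H m' n' (G : 'I_m' -> 'I_n') Gi : cancel G Gi -> cancel Gi G ->
    dagger (bijmx G) *m bijmx G = 1%:M.
  move=> GK GiK; rewrite -[dagger _]mulmx1 (bijmx_conj _ GK GiK).
  by apply/matrixP => l l'; rewrite !mxE (can_eq GiK).
move=> FK FiK; split; last exact: H FK FiK.
by have := H _ _ Fi F FiK FK; rewrite -(dagger_bijmx FK FiK) daggerK.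
Qed.

Lemma spf_id n (d : 'I_n -> R) : spf 1%:M d = dg d.
Proof. by rewrite /spf dagger1 mul1mx mulmx1. Qed.

Lemma ptr2_conj_tens m n k (V : 'M[C]_(m, n)) (Y : 'M[C]_(n * k)) :
  ptr2 ((V *t (1%:M : 'M[C]_k)) *m Y *m dagger (V *t (1%:M : 'M[C]_k))) =
  V *m ptr2 Y *m dagger V.
Proof.
apply/matrixP => i j; rewrite !mxE.
have E l : ((V *t (1%:M : 'M[C]_k)) *m Y *m dagger (V *t (1%:M : 'M[C]_k)))
     (mxtens_index (i, l)) (mxtens_index (j, l)) =
   \sum_b \sum_a V i a * Y (mxtens_index (a, l)) (mxtens_index (b, l)) * conjc (V j b).
  rewrite mxE sum_mxtens; apply: eq_bigr => b _.
  rewrite (bigD1 l) //= big1 ?addr0 => [|l' ll']; last first.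
    by rewrite daggerE tensmxE [1%:M _ _]mxE eq_sym (negbTE ll') mulr0 rmorph0 mulr0.
  rewrite daggerE tensmxE [1%:M _ _]mxE eqxx mulr1 mxE sum_mxtens mulr_suml.
  apply: eq_bigr => a _; congr (_ * _).
  rewrite (bigD1 l) //= big1 ?addr0 => [|l' ll']; last first.
    by rewrite tensmxE [1%:M _ _]mxE eq_sym (negbTE ll') mulr0 mul0r.
  by rewrite tensmxE [1%:M _ _]mxE eqxx mulr1.
under eq_bigr => l _ do rewrite E.
rewrite exchange_big /=; apply: eq_bigr => b _.
rewrite exchange_big /= daggerE mxE mulr_suml; apply: eq_bigr => a _.
by rewrite mxE mulr_sumr mulr_suml.
Qed.

Section TOofBij.
Variables (beta : R) (dS dO : nat) (VS : 'M[C]_dS) (VO : 'M[C]_dO).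
Variables (ES p : 'I_dS -> R) (EO t : 'I_dO -> R) (rho : 'M[C]_dS).
Variables (BT KT : finType) (EB : BT -> R) (EK : KT -> R).
Variables (f : 'I_dS * BT -> 'I_dO * KT) (fi : 'I_dO * KT -> 'I_dS * BT).
Variables (b0 : BT) (k0 : KT).
Hypotheses (uS : unitary_mx VS) (uO : unitary_mx VO).
Hypothesis rhoE : forall s, (dagger VS *m rho *m VS) s s = rC (p s).
Hypotheses (fK : cancel f fi) (fiK : cancel fi f).
Hypothesis fE : forall s b, ES s + EB b = EO (f (s, b)).1 + EK (f (s, b)).2.
Hypothesis fdeph : forall s s' b, (f (s, b)).2 = (f (s', b)).2 -> s = s'.

Definition bweight (b : BT) := expR (- beta * EB b) / \sum_b' expR (- beta * EB b').

Definition TO_out (o : 'I_dO) :=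
  \sum_s \sum_b p s * bweight b * ((f (s, b)).1 == o)%:R.

Let F (k : 'I_(dS * #|BT|)) : 'I_(dO * #|KT|) :=
  let: (s, b) := mxtens_unindex k in
  mxtens_index ((f (s, enum_val b)).1, enum_rank (f (s, enum_val b)).2).
Let Fi (l : 'I_(dO * #|KT|)) : 'I_(dS * #|BT|) :=
  let: (o, k) := mxtens_unindex l in
  mxtens_index ((fi (o, enum_val k)).1, enum_rank (fi (o, enum_val k)).2).

Let FK : cancel F Fi.
Proof.
move=> k; case: (mxtens_indexP k) => s b; rewrite /Fi /F !mxtens_indexK enum_rankK.
by rewrite -surjective_pairing fK enum_valK.
Qed.
Let FiK : cancel Fi F.
Proof.
move=> k; case: (mxtens_indexP k) => s b; rewrite /Fi /F !mxtens_indexK enum_rankK.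
by rewrite -surjective_pairing fiK enum_valK.
Qed.

Let eB (b : 'I_#|BT|) := EB (enum_val b).
Let eK (k : 'I_#|KT|) := EK (enum_val k).

Let FE k : tfun +%R ES eB k = tfun +%R EO eK (F k).
Proof.
case: (mxtens_indexP k) => s b; rewrite /F mxtens_indexK !tfunE fE /eK.
by rewrite enum_rankK.
Qed.

Let gwB b : gw beta eB b = bweight (enum_val b).
Proof. by rewrite /gw /bweight; congr (_ / _); rewrite [RHS](reindex _ (onW_bij _ (enum_val_bij _))). Qed.

Let U := (VS *t (1%:M : 'M[C]_#|BT|)) *m bijmx F *m dagger (VO *t (1%:M : 'M[C]_#|KT|)).

Let uSB : unitary_mx (VS *t (1%:M : 'M[C]_#|BT|)).
Proof. by apply: unitary_tens => //; exact: unitary1. Qed.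
Let uOK : unitary_mx (VO *t (1%:M : 'M[C]_#|KT|)).
Proof. by apply: unitary_tens => //; exact: unitary1. Qed.

Let uU : unitary_mx U.
Proof.
apply: unitary_mul; last exact: (unitary_dagger uOK).
exact: unitary_mul uSB (unitary_bijmx FK FiK).
Qed.

Let conjU (X : 'M[C]_(dS * #|BT|)) : dagger U *m X *m U =
  (VO *t 1%:M) *m (\matrix_(l, l') (dagger (VS *t 1%:M) *m X *m (VS *t 1%:M)) (Fi l) (Fi l'))
  *m dagger (VO *t 1%:M).
Proof. by rewrite -(bijmx_conj _ FK FiK) /U !daggerM daggerK !mulmxA. Qed.

Let U_energy : dagger U *m hsum (spf VS ES) (dg eB) *m U = hsum (spf VO EO) (dg eK).
Proof.
rewrite -!spf_id !hsum_spf //; try exact: unitary1.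
rewrite conjU; congr (_ *m _ *m _).
rewrite /spf !mulmxA uSB.2 mul1mx -mulmxA uSB.2 mulmx1.
apply/matrixP => l l'; rewrite mxE !dgE (can_eq FiK) FE FiK.
by [].
Qed.

Let outE : ptr2 (dagger U *m (rho *t gibbs beta (dg eB)) *m U) = spf VO TO_out.
Proof.
rewrite conjU ptr2_conj_tens /spf; congr (_ *m _ *m _).
rewrite -spf_id gibbs_spf ?spf_id; last exact: unitary1.
rewrite dagger_tens dagger1 !tensmx_mul mul1mx mulmx1.
apply/matrixP => o o'; rewrite dgE mxE.
have E k : (\matrix_(l, l') ((dagger VS *m rho *m VS) *t dg (gw beta eB)) (Fi l) (Fi l'))
   (mxtens_index (o, k)) (mxtens_index (o', k)) =
   rC (p (fi (o, enum_val k)).1 * bweight (fi (o, enum_val k)).2) *+ (o == o').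
  rewrite mxE /Fi !mxtens_indexK tensmxE dgE.
  have [eo|eo] := eqVneq o o'.
    by rewrite -eo rhoE eqxx !mulr1n gwB enum_rankK rCM.
  (* A surviving off-diagonal element would need equal bath levels on both sides; equal discarded
     levels then force equal inputs by [fdeph], so the two outputs could not differ. *)
  rewrite mulr0n; case: eqP => [/enum_rank_inj bb|_]; last by rewrite mulr0n mulr0.
  case/negP: eo; apply/eqP.
  have e1 := fiK (o, enum_val k); have e2 := fiK (o', enum_val k).
  have ss : (fi (o, enum_val k)).1 = (fi (o', enum_val k)).1.
    apply: (fdeph (b := (fi (o, enum_val k)).2)).
    by rewrite {2}bb -!surjective_pairing e1 e2.
  have : fi (o, enum_val k) = fi (o', enum_val k).
    by rewrite [LHS]surjective_pairing [RHS]surjective_pairing ss bb.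
  by move/(congr1 f); rewrite e1 e2 => -[].
under eq_bigr => k _ do rewrite E.
rewrite sumrMnl; congr (_ *+ _); rewrite -rC_sum; congr rC.
rewrite /TO_out pair_big /= (reindex (fun l : 'I_dO * KT => fi l)) /=; last first.
  by exists f => x _; rewrite ?fK ?fiK.
rewrite (eq_bigr (fun l : 'I_dO * KT => (p (fi l).1 * bweight (fi l).2) * (l.1 == o)%:R)); last first.
  by move=> l _; rewrite -surjective_pairing fiK.
transitivity (\sum_o1 \sum_k (p (fi (o1, k)).1 * bweight (fi (o1, k)).2) * (o1 == o)%:R); last first.
  by rewrite pair_bigA /=; apply: eq_bigr; case=> x k _.
rewrite (bigD1 o) //= [X in _ = _ + X]big1 ?addr0 => [|o1 oo1]; last first.
  by apply: big1 => k _; rewrite (negbTE oo1) mulr0.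
rewrite [RHS](reindex _ (onW_bij _ (enum_val_bij _))) /=.
by apply: eq_bigr => k _; rewrite eqxx mulr1.
Qed.

(** Only the diagonal of [rho] in the energy basis [VS] enters: what is discarded identifies the
    input level once the bath level is known, which destroys coherences. *)
Lemma TO_of_bij eps : (\sum_o `|TO_out o - t o|) / 2 <= eps ->
  TO_eps beta (spf VS ES) (spf VO EO) rho (spf VO t) eps.
Proof.
move=> h; exists #|BT|, (dg eB), #|KT|, (dg eK), U.
split; first by apply/card_gt0P; exists b0.
split; first by apply/card_gt0P; exists k0.
split; first exact: dagger_dg.
split; first exact: dagger_dg.
split; first exact: uU.
split; first exact: U_energy.
by rewrite outE tdist_spf.
Qed.

End TOofBij.
End PermutationUnitaries.

(** * The lattice bath *)

Section Lattice.
Variable R : realType.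
Local Notation C := (complex R).

(** |s - t| is s + t minus twice the minimum, and y lies below both. *)
Lemma tv_lower n (s t y : 'I_n -> R) (e : R) : \sum_i s i = 1 -> \sum_i t i = 1 ->
  (forall i, y i <= s i) -> (forall i, y i <= t i) -> 1 - e <= \sum_i y i ->
  (\sum_i `|s i - t i|) / 2 <= e.
Proof.
move=> s1 t1 ys yt ye.
have : \sum_i `|s i - t i| <= \sum_i (s i + t i - 2 * y i).
  apply: ler_sum => i _; have := ys i; have := yt i; rewrite ler_norml; lra.
by rewrite sumrB big_split /= s1 t1 -mulr_sumr; move: (\sum_i y i) ye (\sum_i `|_|) => *; lra.
Qed.

Lemma big_enough (T : finType) (al : T -> R) (b : R) : 0 <= b ->
  exists2 M, 0 < M & forall M', M <= M' -> forall x, 0 < al x -> b <= M' * al x.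
Proof.
move=> b0; exists (1 + \sum_x b / `|al x|).
  by rewrite ltr_pwDl // sumr_ge0 // => x _; rewrite divr_ge0.
move=> M' hM x ax; rewrite -ler_pdivrMr //; apply: le_trans hM.
rewrite (bigD1 x) //= gtr0_norm // addrCA lerDl addr_ge0 //.
by rewrite sumr_ge0 // => y _; rewrite divr_ge0.
Qed.

Lemma bernoulli_ineq (x : R) n : 0 <= x <= 1 -> 1 - n%:R * x <= (1 - x) ^+ n.
Proof.
move=> /andP[x0 x1]; elim: n => [|n IH]; first by rewrite mul0r subr0 expr0.
rewrite exprS; apply: (@le_trans _ _ ((1 - x) * (1 - n%:R * x))).
  have : 0 <= n%:R * x ^+ 2 by rewrite mulr_ge0 ?sqr_ge0.
  by rewrite -natr1; move: (n%:R : R) => u; nra.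
by rewrite ler_wpM2l // subr_ge0.
Qed.

Lemma truncn_bounds (y : R) : 0 <= y -> (Num.truncn y)%:R <= y /\ y - 1 <= (Num.truncn y)%:R.
Proof.
move=> y0; split; first by rewrite Num.Theory.truncn_le.
have := ltW (Num.Theory.truncnS_gt y); rewrite -natr1; lra.
Qed.

Section Bath.
Variables (beta : R) (dS' dO : nat).
Local Notation dS := dS'.+1.
Variables (ES : 'I_dS -> R) (EO : 'I_dO -> R) (L : nat) (M : R).
Hypothesis M0 : 0 < M.

Local Notation J := ('I_dS + 'I_dO)%type.
Definition jE (j : J) : R := match j with inl i => ES i | inr k => EO k end.

Local Notation A := {ffun J -> 'I_L.+1}.
(** The lattice point [a] holds [a j] quanta of the energy of level [j], so absorbing or releasing a
    system level is one lattice step. *)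
Definition aE (a : A) : R := \sum_j (a j)%:R * jE j.
(* The degeneracy cancels the Boltzmann factor up to rounding, so the bath is uniform. *)
Definition mult (a : A) : nat := Num.truncn (M * expR (beta * aE a)).
Definition lat := {a : A & 'I_(mult a)}.
Local Notation Om := ('I_dS * 'I_dO * lat)%type.
Local Notation Sh := {ffun J -> nat}.

(** The conserved label. Equal shells have equal total energy whatever the values of [ES] and [EO],
    so coincidences among real energies never have to be decided. *)
Definition shell (w : Om) : Sh :=
  [ffun j => (tag w.2 j + (j == inl w.1.1) + (j == inr w.1.2))%N].
Definition shE (c : Sh) : R := \sum_j (c j)%:R * jE j.

Lemma sum_delta (j0 : J) : \sum_j (j == j0)%:R * jE j = jE j0.
Proof.
rewrite (bigD1 j0) //= eqxx mul1r big1 ?addr0 // => j /negbTE ->.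
by rewrite mul0r.
Qed.

Lemma shell_energy (w : Om) : shE (shell w) = ES w.1.1 + EO w.1.2 + aE (tag w.2).
Proof.
rewrite /shE; under eq_bigr => j _ do rewrite ffunE !natrD !mulrDl.
by rewrite !big_split /= !sum_delta /= -addrA addrC.
Qed.

(** All coordinates lie in 1..L, so removing one quantum of an input level and one of an output
    level stays in the lattice. There are L^|J| such shells against (L + 1)^|J| lattice points. *)
Definition inner (c : {ffun J -> 'I_L}) : Sh := [ffun j => (c j).+1].

Lemma inner_inj : injective inner.
Proof.
move=> c d /ffunP h; apply/ffunP => j; apply: val_inj.
by have := h j; rewrite !ffunE => -[].
Qed.

Definition sub_shell (c : {ffun J -> 'I_L}) i k : A :=
  [ffun j => inord ((c j).+1 - (j == inl i) - (j == inr k))%N].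

Lemma sub_shellE c i k j : sub_shell c i k j = ((c j).+1 - (j == inl i) - (j == inr k))%N :> nat.
Proof. by rewrite ffunE inordK // ltnS -subnDA (leq_trans (leq_subr _ _)). Qed.

Lemma shell_sub c i k (x : 'I_(mult (sub_shell c i k))) :
  shell (i, k, Tagged (fun a => 'I_(mult a)) x) = inner c.
Proof.
apply/ffunP => j; rewrite ffunE [RHS]ffunE /= sub_shellE.
case: (altP (j =P inl i)) => [->|_] /=; last first.
  by rewrite subn0 addn0; case: eqP => _ /=; rewrite ?subn1 ?addn1 ?subn0 ?addn0.
by rewrite !subn1 subn0 addn0 addn1.
Qed.

Lemma sub_shell_energy c i k : aE (sub_shell c i k) = shE (inner c) - ES i - EO k.
Proof.
have h (j : J) : ((sub_shell c i k) j)%:R * jE j =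
   ((inner c) j)%:R * jE j - (j == inl i)%:R * jE j - (j == inr k)%:R * jE j.
  rewrite sub_shellE ffunE; case: (altP (j =P inl i)) => [->|_] /=.
    by rewrite subn0 mul0r subr0 subn1 /= -natr1 mulrDl mul1r addrK.
  rewrite subn0 mul0r subr0; case: eqP => [->|_] /=.
    by rewrite subn1 /= mul1r -natr1 mulrDl mul1r addrK.
  by rewrite subn0 mul0r subr0.
by rewrite /aE; under eq_bigr => j _ do rewrite h; rewrite !sumrB !sum_delta.
Qed.

Lemma mult_bounds a : (mult a)%:R <= M * expR (beta * aE a) /\
  M * expR (beta * aE a) - 1 <= (mult a)%:R.
Proof. by apply: truncn_bounds; rewrite mulr_ge0 ?expR_ge0 // ltW. Qed.

Lemma card_shell_in c i :
  (\sum_k mult (sub_shell c i k) <= #|[pred w : Om | (shell w == inner c) && (w.1.1 == i)]|)%N.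
Proof.
pose T := {k : 'I_dO & 'I_(mult (sub_shell c i k))}.
pose g (x : T) : Om := (i, tag x, Tagged (fun a => 'I_(mult a)) (tagged x)).
have gi : injective g.
  move=> [k x] [k' x'] /= [ekk]; case: k' / ekk x' => x' /= _ h.
  by rewrite (Eqdep_dec.inj_pair2_eq_dec _ (@eq_comparable _) _ _ _ _ h).
have -> : (\sum_k mult (sub_shell c i k) = #|{: T}|)%N.
  by rewrite card_tagged sumnE big_map big_enum; apply: eq_bigr => k _; rewrite card_ord.
rewrite -(card_codom gi); apply/subset_leq_card/fintype.subsetP => _ /codomP[x ->].
by rewrite !inE shell_sub !eqxx.
Qed.

Lemma card_shell_out c k :
  (\sum_i mult (sub_shell c i k) <= #|[pred w : Om | (shell w == inner c) && (w.1.2 == k)]|)%N.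
Proof.
pose T := {i : 'I_dS & 'I_(mult (sub_shell c i k))}.
pose g (x : T) : Om := (tag x, k, Tagged (fun a => 'I_(mult a)) (tagged x)).
have gi : injective g.
  move=> [i x] [i' x'] /= [ekk]; case: i' / ekk x' => x' /= _ h.
  by rewrite (Eqdep_dec.inj_pair2_eq_dec _ (@eq_comparable _) _ _ _ _ h).
have -> : (\sum_i mult (sub_shell c i k) = #|{: T}|)%N.
  by rewrite card_tagged sumnE big_map big_enum; apply: eq_bigr => i _; rewrite card_ord.
rewrite -(card_codom gi); apply/subset_leq_card/fintype.subsetP => _ /codomP[x ->].
by rewrite !inE shell_sub !eqxx.
Qed.

Definition latZ := \sum_(b : lat) expR (- beta * aE (tag b)).

(** Degeneracies are rounded down, so every lattice point has total weight at most M. *)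
Lemma latZ_le : latZ <= M * (L.+1 ^ #|{: J}|)%:R.
Proof.
rewrite /latZ.
rewrite -(sig_big_dep predT (fun a => predT) (fun a (x : 'I_(mult a)) => expR (- beta * aE a))) /=.
have -> : M * (L.+1 ^ #|{: J}|)%:R = \sum_(a : A) M.
  by rewrite sumr_const -[RHS]mulr_natr card_ffun card_ord.
apply: ler_sum => a _; rewrite sumr_const card_ord -mulr_natr.
have [h _] := mult_bounds a.
rewrite mulrC; apply: (le_trans (ler_wpM2r (expR_ge0 _) h)).
by rewrite -mulrA -expRD mulNr subrr expR0 mulr1.
Qed.

Section Permuted.
Variable f : {perm Om}.
Hypothesis fsh : forall w, shell (f w) = shell w.

(** The output system starts thermal inside the bath and the input system ends in the discarded
    part. Thus a permutation of [Om] yields the required bijection although dS and dO may differ. *)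
Local Notation BT := ('I_dO * lat * 'I_dS)%type.
Local Notation KT := ('I_dS * lat * 'I_dS)%type.
Let EB (b : BT) := EO b.1.1 + aE (tag b.1.2).
Let EK (b : KT) := ES b.1.1 + aE (tag b.1.2).

(* The register in the last component is uniformly distributed and records the input level; discarding it dephases the input. *)
Let F (x : 'I_dS * BT) : 'I_dO * KT :=
  let w := f (x.1, x.2.1.1, x.2.1.2) in (w.1.2, (w.1.1, w.2, x.2.2 + x.1)).
Let Fi (y : 'I_dO * KT) : 'I_dS * BT :=
  let w := (f^-1)%g (y.2.1.1, y.1, y.2.1.2) in (w.1.1, (w.1.2, w.2, y.2.2 - w.1.1)).

Let FK : cancel F Fi.
Proof.
move=> [s [[k b] r]]; rewrite /Fi /F /=.
have -> : ((f (s, k, b)).1.1, (f (s, k, b)).1.2, (f (s, k, b)).2) = f (s, k, b).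
  by case: (f _) => [[]].
by rewrite permK /= addrK.
Qed.

Let FiK : cancel Fi F.
Proof.
move=> [k [[s b] r]]; rewrite /Fi /F /=.
have -> : (((f^-1)%g (s, k, b)).1.1, ((f^-1)%g (s, k, b)).1.2, ((f^-1)%g (s, k, b)).2)
   = (f^-1)%g (s, k, b) by case: ((f^-1)%g _) => [[]].
by rewrite permKV /= subrK.
Qed.

Let FE s b : ES s + EB b = EO (F (s, b)).1 + EK (F (s, b)).2.
Proof.
case: b => [[k b] r]; rewrite /EB /EK /F /=.
have := shell_energy (f (s, k, b)); rewrite fsh shell_energy /=.
by move: (aE _) (aE _) (ES _) (EO _) => u v x y; lra.
Qed.

Let Fdeph s s' b : (F (s, b)).2 = (F (s', b)).2 -> s = s'.
Proof. by rewrite /F /= => /(congr1 (fun y => y.2)) /= /addrI. Qed.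

Definition OmW (w : Om) : R :=
  expR (- beta * (EO w.1.2 + aE (tag w.2))) / ((\sum_k expR (- beta * EO k)) * latZ).

Lemma TO_out_perm (p : 'I_dS -> R) o :
  TO_out beta p EB F o = \sum_(w : Om) p w.1.1 * OmW w * ((f w).1.2 == o)%:R.
Proof.
have ZE : \sum_(b : BT) expR (- beta * EB b) =
    ((\sum_k expR (- beta * EO k)) * latZ) * dS%:R.
  rewrite -(pair_bigA _ (fun (kb : 'I_dO * lat) (r : 'I_dS) => expR (- beta * (EO kb.1 + aE (tag kb.2))))) /=.
  under eq_bigr => kb _ do rewrite sumr_const card_ord -mulr_natr mulrDr expRD.
  rewrite -mulr_suml; congr (_ * _).
  rewrite -(pair_bigA _ (fun k (b : lat) => expR (- beta * EO k) * expR (- beta * aE (tag b)))) /=.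
  by rewrite mulr_suml; apply: eq_bigr => k _; rewrite mulr_sumr.
rewrite /TO_out.
transitivity (\sum_s \sum_(kb : 'I_dO * lat) p s * OmW (s, kb.1, kb.2) * ((f (s, kb.1, kb.2)).1.2 == o)%:R).
  apply: eq_bigr => s _.
  transitivity (\sum_(kb : 'I_dO * lat) \sum_(r : 'I_dS) p s * bweight beta EB (kb, r) * ((F (s, (kb, r))).1 == o)%:R).
    by rewrite pair_bigA /=; apply: eq_bigr; case.
  apply: eq_bigr; case=> k b _; rewrite /F /=.
  under eq_bigr => r _ do rewrite /bweight ZE /EB /=.
  rewrite sumr_const card_ord -mulr_natr /OmW /=.
  have dn : (dS%:R : R) != 0 by rewrite pnatr_eq0.
  rewrite [in LHS]invfM.
  move: (expR _) (_ * latZ)^-1 ((_ == o)%:R) (p s) => u v x y.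
  by field.
rewrite pair_bigA /= (reindex (fun w : Om => (w.1.1, (w.1.2, w.2)))) /=.
  by apply: eq_bigr; case; case.
by exists (fun w => (w.1, w.2.1, w.2.2)) => [[[]]|[? []]].
Qed.

Lemma TO_of_perm (VS : 'M[C]_dS) (VO : 'M[C]_dO) (rho : 'M[C]_dS) p t eps :
  unitary_mx VS -> unitary_mx VO ->
  (forall s, (dagger VS *m rho *m VS) s s = rC (p s)) ->
  Om ->
  (\sum_o `|(\sum_(w : Om) p w.1.1 * OmW w * ((f w).1.2 == o)%:R) - t o|) / 2 <= eps ->
  TO_eps beta (spf VS ES) (spf VO EO) rho (spf VO t) eps.
Proof.
move=> uS uO rhoE w0 h.
apply: (TO_of_bij (BT := BT) (KT := KT) (EB := EB) (EK := EK) (f := F) (fi := Fi)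
  (w0.1.2, w0.2, ord0) (w0.1.1, w0.2, ord0) uS uO rhoE FK FiK FE Fdeph).
by under eq_bigr => o _ do rewrite TO_out_perm.
Qed.

End Permuted.
End Bath.
End Lattice.

(** * One-shot achievability for given populations *)

Section Achieve.
Variable R : realType.
Local Notation C := (complex R).

(** The admissible relative loss x is split in halves: (1 - x/4)^2 covers two roundings, and a
    further factor 1 - x/2 covers the boundary of the lattice. *)
Lemma slack_ineq (x : R) : 0 < x -> x <= 1 ->
  [/\ 0 <= 1 - x / 2, 1 - x / 2 <= (1 - x / 4) ^+ 2 & 1 - x <= (1 - x / 2) * (1 - x / 2)].
Proof. by move=> x0 x1; split; nra. Qed.

Section Fixed.
Variables (beta : R) (dS' dO : nat).
Local Notation dS := dS'.+1.
Variables (ES p : 'I_dS -> R) (EO t : 'I_dO -> R).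
Hypotheses (p0 : forall i, 0 <= p i) (t0 : forall k, 0 <= t k).
Local Notation g := (gw beta ES).
Local Notation g' := (gw beta EO).
Local Notation r := (fun i => p i / g i).
Local Notation q := (fun k => t k / g' k).
Variable X : 'I_dS -> 'I_dO -> R.
Hypotheses (X0 : forall i k, 0 <= X i k) (Xp : forall i, \sum_k X i k <= p i)
  (Xt : forall k, \sum_i X i k <= t k) (Xr : forall i k, 0 < X i k -> q k <= r i).

(** The coupling in units of Gibbs weight, hence of microstates. Where p i = 0 the ratio is 0, but
    so is X i k, and the convention x / 0 = 0 does no harm. *)
Definition flow i k := X i k / r i.

Lemma X_le_p i k : X i k <= p i.
Proof. by apply: le_trans (Xp i); rewrite (bigD1 k) //= lerDl sumr_ge0. Qed.

Lemma X_le_t i k : X i k <= t k.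
Proof. by apply: le_trans (Xt k); rewrite (bigD1 i) //= lerDl sumr_ge0. Qed.

Lemma flow_ge0 i k : 0 <= flow i k.
Proof. by rewrite divr_ge0 // divr_ge0 // ltW // gw_gt0. Qed.

Lemma flowK i k : r i * flow i k = X i k.
Proof.
have [pi0|pi0] := eqVneq (p i) 0.
  have x0 : X i k = 0 by apply/eqP; rewrite eq_le X0 andbT -pi0 X_le_p.
  by rewrite /flow x0 mul0r mulr0.
by rewrite /flow mulrC divfK // mulf_neq0 // invr_eq0 gt_eqF // gw_gt0.
Qed.

Lemma flow_row i : \sum_k flow i k <= g i.
Proof.
rewrite -mulr_suml; have [pi0|pi0] := eqVneq (p i) 0.
  by rewrite pi0 mul0r invr0 mulr0 ltW // gw_gt0.
have pi1 : 0 < p i by rewrite lt_def pi0 p0.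
rewrite invf_div mulrA ler_pdivrMr // mulrC ler_wpM2l // ltW //; exact: gw_gt0.
Qed.

(** The order of the ratios enters here: dividing by r i gives at most X i k / q k, and these sum
    over i to at most t k / q k, the Gibbs weight of k. *)
Lemma flow_col k : \sum_i flow i k <= g' k.
Proof.
have [tk0|tk0] := eqVneq (t k) 0.
  rewrite big1 ?(ltW (gw_gt0 _ _ _)) // => i _; rewrite /flow.
  have -> : X i k = 0 by apply/eqP; rewrite eq_le X0 andbT -tk0 X_le_t.
  by rewrite mul0r.
have tk1 : 0 < t k by rewrite lt_def tk0 t0.
have gk := gw_gt0 beta EO k.
apply: (@le_trans _ _ (\sum_i X i k * (g' k / t k))).
  apply: ler_sum => i _; rewrite /flow.
  have [x0|x0] := eqVneq (X i k) 0; first by rewrite x0 !mul0r.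
  have x1 : 0 < X i k by rewrite lt_def x0 X0.
  have qk : 0 < t k / g' k by exact: divr_gt0.
  have rk := lt_le_trans qk (Xr x1).
  by rewrite ler_wpM2l // -[g' k / t k]invf_div lef_pV2; [exact: Xr|exact: rk|exact: qk].
rewrite -mulr_suml mulrA ler_pdivrMr // mulrC ler_wpM2l ?Xt //; exact: ltW.
Qed.

Variables (kap M : R) (L : nat).
Hypotheses (kap01 : 0 < kap < 1) (M0 : 0 < M).
Local Notation J := ('I_dS + 'I_dO)%type.
Local Notation ZS := (\sum_i expR (- beta * ES i)).
Local Notation ZO := (\sum_k expR (- beta * EO k)).
Local Notation Sh := {ffun J -> nat}.
Local Notation cE c := (expR (beta * shE ES EO c)).
Hypotheses
 (M1 : forall (c : {ffun J -> 'I_L}) i,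
   dO%:R <= M * ((1 - kap) * (cE (inner c) * expR (- beta * ES i) * ZO)))
 (M2 : forall (c : {ffun J -> 'I_L}) k,
   dS%:R <= M * ((1 - kap) * (cE (inner c) * expR (- beta * EO k) * ZS)))
 (M3 : forall (c : {ffun J -> 'I_L}) i k, 0 < flow i k ->
   1 <= M * ((1 - kap) * (kap * cE (inner c) * ZS * ZO * flow i k))).

Let k0 : 0 < kap. Proof. by case/andP: kap01. Qed.
Let ZS0 : 0 < ZS. Proof. exact: (gw_sum_gt0 _ _ ord0). Qed.
Hypothesis ZO0 : 0 < ZO.

(** Ideal number of microstates of shell c moved from i to k. The factor kap leaves room for
    rounding: one microstate lost per lattice point is covered by [M1] and [M2], the one lost in
    [cnt] by [M3]. *)
Definition want (c : Sh) i k : R := kap * M * (cE c * ZS * ZO * flow i k).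
(** Boundary shells get no plan; the permutation is arbitrary within them. *)
Definition cnt (c : Sh) i k : nat :=
  if [exists c' : {ffun J -> 'I_L}, inner c' == c] then Num.truncn (want c i k) else 0%N.

Lemma want_ge0 c i k : 0 <= want c i k.
Proof.
by apply: mulr_ge0; [exact: ltW (mulr_gt0 k0 M0)|apply: mulr_ge0 (flow_ge0 _ _); rewrite !mulr_ge0 ?expR_ge0 ?(ltW ZS0) ?(ltW ZO0)].
Qed.

Lemma gwS i : ZS * g i = expR (- beta * ES i).
Proof. by rewrite /gw mulrC divfK // gt_eqF. Qed.
Lemma gwO k : ZO * g' k = expR (- beta * EO k).
Proof. by rewrite /gw mulrC divfK // gt_eqF. Qed.

Lemma sub_shell_expR (c : {ffun J -> 'I_L}) i k :
  expR (beta * aE ES EO (sub_shell c i k)) =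
  cE (inner c) * expR (- beta * ES i) * expR (- beta * EO k).
Proof. by rewrite sub_shell_energy -!expRD; congr expR; ring. Qed.

Lemma cnt_row (c : Sh) i : (\sum_k cnt c i k <=
  #|[pred w : 'I_dS * 'I_dO * lat beta ES EO L M | (shell w == c) && (w.1.1 == i)]|)%N.
Proof.
rewrite /cnt; case: existsP => [[c' /eqP <-]|_]; last by rewrite big1.
apply: (leq_trans _ (@card_shell_in _ _ _ _ _ _ _ _ _ _)); rewrite -(ler_nat R) !natr_sum.
apply: (@le_trans _ _ (\sum_k want (inner c') i k)).
  by apply: ler_sum => k _; have [] := truncn_bounds (want_ge0 (inner c') i k).
apply: (@le_trans _ _ (kap * M * (cE (inner c') * expR (- beta * ES i) * ZO))).
  rewrite /want -mulr_sumr ler_wpM2l ?mulr_ge0 ?(ltW k0) ?(ltW M0) //.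
  rewrite -mulr_sumr -(gwS i).
  have := flow_row i; have := expR_gt0 (beta * shE ES EO (inner c')).
  move: (cE _) ZS0 ZO0; move: (\sum_k flow i k) (g i) ZS ZO => u v w x y h1 h2 h3 h4.
  have -> : y * (w * v) * x = y * w * x * v by ring.
  by rewrite ler_wpM2l // !mulr_ge0 // ltW.
apply: (@le_trans _ _ (\sum_k (M * expR (beta * aE ES EO (sub_shell c' i k)) - 1))); last first.
  apply: ler_sum => k _; have [_] := mult_bounds beta ES EO M0 (sub_shell c' i k).
  by [].
rewrite sumrB sumr_const card_ord -mulr_sumr.
under [X in _ <= _ * X - _]eq_bigr => k _ do rewrite sub_shell_expR.
rewrite -mulr_sumr; have := M1 c' i.
move: (cE _ * _ * _) => u; rewrite (_ : M * ((1 - kap) * u) = M * u - kap * M * u); last by ring.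
by move: (M * u) (kap * M * u) (dO%:R : R) => *; lra.
Qed.

Lemma cnt_col (c : Sh) k : (\sum_i cnt c i k <=
  #|[pred w : 'I_dS * 'I_dO * lat beta ES EO L M | (shell w == c) && (w.1.2 == k)]|)%N.
Proof.
rewrite /cnt; case: existsP => [[c' /eqP <-]|_]; last by rewrite big1.
apply: (leq_trans _ (@card_shell_out _ _ _ _ _ _ _ _ _ _)); rewrite -(ler_nat R) !natr_sum.
apply: (@le_trans _ _ (\sum_i want (inner c') i k)).
  by apply: ler_sum => i _; have [] := truncn_bounds (want_ge0 (inner c') i k).
apply: (@le_trans _ _ (kap * M * (cE (inner c') * expR (- beta * EO k) * ZS))).
  rewrite /want -mulr_sumr ler_wpM2l ?mulr_ge0 ?(ltW k0) ?(ltW M0) //.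
  rewrite -mulr_sumr -(gwO k).
  have := flow_col k; have := expR_gt0 (beta * shE ES EO (inner c')).
  move: (cE _) ZS0 ZO0; move: (\sum_i flow i k) (g' k) ZS ZO => u v w x y h1 h2 h3 h4.
  have -> : y * (x * v) * w = y * w * x * v by ring.
  by rewrite ler_wpM2l // !mulr_ge0 // ltW.
apply: (@le_trans _ _ (\sum_i (M * expR (beta * aE ES EO (sub_shell c' i k)) - 1))); last first.
  apply: ler_sum => i _; have [_] := mult_bounds beta ES EO M0 (sub_shell c' i k).
  by [].
rewrite sumrB sumr_const card_ord -mulr_sumr.
under [X in _ <= _ * X - _]eq_bigr => i _ do rewrite sub_shell_expR mulrAC.
rewrite -mulr_sumr; have := M2 c' k.
move: (cE _ * _ * _) => u; rewrite (_ : M * ((1 - kap) * u) = M * u - kap * M * u); last by ring.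
by move: (M * u) (kap * M * u) (dS%:R : R) => *; lra.
Qed.

Lemma cnt_ge (c : {ffun J -> 'I_L}) i k :
  kap * want (inner c) i k <= (cnt (inner c) i k)%:R.
Proof.
rewrite /cnt ifT; last by apply/existsP; exists c.
have [f0|f0] := eqVneq (flow i k) 0.
  by rewrite /want f0 !mulr0 ler0n.
have f1 : 0 < flow i k by rewrite lt_def f0 flow_ge0.
have [_ h] := truncn_bounds (want_ge0 (inner c) i k).
apply: le_trans h; have := M3 c f1; rewrite /want.
move: (cE _) ZS ZO (flow i k) => a b d f h.
rewrite -subr_ge0 (_ : _ - _ = M * ((1 - kap) * (kap * a * b * d * f)) - 1) ?subr_ge0 //.
by ring.
Qed.

Hypothesis latZ0 : 0 < latZ beta ES EO L M.

(** In a shell the weight depends on the input level only, so moved mass is weight times count. Each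
    inner shell sends at least kap^2 (M / latZ) X i o from i to o; L^|J| shells and [latZ_le] give
    the factor. *)
Lemma out_lower (f : {perm ('I_dS * 'I_dO * lat beta ES EO L M)}) o :
  (forall w, shell (f w) = shell w) ->
  (forall x i k, (cnt x i k <= #|[pred w | [&& shell w == x, w.1.1 == i & (f w).1.2 == k]]|)%N) ->
  kap ^+ 2 * (L%:R / L.+1%:R) ^+ #|{: J}| * \sum_i X i o <=
  \sum_w p w.1.1 * OmW w * ((f w).1.2 == o)%:R.
Proof.
move=> fsh fcnt.
pose Y (c' : {ffun J -> 'I_L}) i := \sum_w p w.1.1 * OmW w * ((f w).1.2 == o)%:R *
   ((shell w == inner c') && (w.1.1 == i))%:R.
have OmW0 (w : 'I_dS * 'I_dO * lat beta ES EO L M) : 0 <= OmW w.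
  by rewrite /OmW divr_ge0 ?expR_ge0 // mulr_ge0 // ltW.
have term0 w : 0 <= p w.1.1 * OmW w * ((f w).1.2 == o)%:R.
  by rewrite mulr_ge0 ?ler0n // mulr_ge0.
apply: (@le_trans _ _ (\sum_(c' : {ffun J -> 'I_L}) \sum_i Y c' i)); last first.
  rewrite /Y; under eq_bigr => c' _ do rewrite exchange_big /=.
  rewrite exchange_big /=; apply: ler_sum => w _.
  under eq_bigr => c' _ do rewrite -mulr_sumr.
  rewrite -mulr_sumr ler_piMr //.
  have E c' : \sum_(i < dS) ((shell w == inner c') && (w.1.1 == i))%:R = (shell w == inner c')%:R :> R.
    rewrite (bigD1 w.1.1) //= eqxx andbT big1 ?addr0 // => i /negbTE.
    by rewrite eq_sym => ->; rewrite andbF.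
  under eq_bigr => c' _ do rewrite E.
  have [/existsP [c0 /eqP h]|/existsPn h] := boolP [exists c' : {ffun J -> 'I_L}, shell w == inner c'].
    rewrite (bigD1 c0) //= h eqxx big1 ?addr0 // => c' /negbTE.
    by rewrite (inj_eq (@inner_inj _ _ _)) eq_sym => ->.
  by rewrite big1 // => c' _; rewrite (negbTE (h c')).
apply: (@le_trans _ _ (\sum_(c' : {ffun J -> 'I_L}) \sum_i kap ^+ 2 * (M / latZ beta ES EO L M) * X i o)).
  rewrite sumr_const card_ffun card_ord -mulr_sumr -[leRHS]mulr_natr.
  rewrite [leRHS]mulrAC; apply: ler_wpM2r; first by rewrite sumr_ge0.
  rewrite -[leRHS]mulrA; apply: ler_wpM2l; first by rewrite sqr_ge0.
  have := latZ_le beta ES EO L M0; rewrite expr_div_n !natrX.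
  have := latZ0; have : 0 < L.+1%:R ^+ #|{: J}| :> R by rewrite exprn_gt0 ?ltr0n.
  have : 0 <= L%:R ^+ #|{: J}| :> R by rewrite exprn_ge0.
  move: (latZ _ _ _ _ _) (L%:R ^+ _) (L.+1%:R ^+ _) => Z x y x0 y0 z0 hZ.
  rewrite [x / y]mulrC; apply: (ler_wpM2r x0).
  by rewrite ler_pdivlMr // mulrC ler_pdivrMr.
apply: ler_sum => c' _; apply: ler_sum => i _.
(* The weights of output level and bath combine to the Boltzmann factor of the shell energy, divided
   by that of the input level. *)
have wE (w : 'I_dS * 'I_dO * lat beta ES EO L M) : shell w == inner c' -> w.1.1 == i ->
    p w.1.1 * OmW w = p i * expR (beta * ES i) * expR (- beta * shE ES EO (inner c')) / (ZO * latZ beta ES EO L M).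
  move=> /eqP sh /eqP wi; rewrite -sh shell_energy wi /OmW.
  set u := EO _; set v := aE _ _ _.
  have -> : - beta * (u + v) = beta * ES i + - beta * (ES i + u + v) by ring.
  by rewrite expRD !mulrA.
have -> : Y c' i = #|[pred w | [&& shell w == inner c', w.1.1 == i & (f w).1.2 == o]]|%:R *
   (p i * expR (beta * ES i) * expR (- beta * shE ES EO (inner c')) / (ZO * latZ beta ES EO L M)).
  rewrite mulr_natl -sumr_const /Y [RHS]big_mkcond /=; apply: eq_bigr => w _.
  rewrite !inE; have [h1|] := boolP (shell w == inner c'); last by rewrite mulr0.
  have [h2|] := boolP (w.1.1 == i); last by rewrite mulr0.
  by rewrite -(wE w h1 h2) /=; case: eqP => _ /=; rewrite ?mulr1n ?mulr0n ?mulr1 ?mulr0 ?mul0r.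
apply: (@le_trans _ _ (kap * want (inner c') i o *
  (p i * expR (beta * ES i) * expR (- beta * shE ES EO (inner c')) / (ZO * latZ beta ES EO L M)))).
  rewrite le_eqVlt; apply/orP; left; apply/eqP.
  have eN x : expR (- beta * x) = (expR (beta * x))^-1 by rewrite mulNr expRN.
  rewrite -flowK /want eN; have -> : g i = (expR (beta * ES i))^-1 / ZS by rewrite -eN.
  have e1 := expR_gt0 (beta * ES i); have e2 := expR_gt0 (beta * shE ES EO (inner c')).
  move: ZS0 ZO0 latZ0 e1 e2; move: (latZ _ _ _ _ _) ZS ZO (expR _) (expR _) (flow i o) (p i).
  move=> a b c d e f' x h1 h2 h3 h4 h5; field.
  by rewrite !gt_eqF.
apply: ler_wpM2r.
  by rewrite divr_ge0 ?mulr_ge0 ?expR_ge0 // ltW.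
apply: le_trans (cnt_ge c' i o) _; rewrite ler_nat; exact: fcnt.
Qed.

End Fixed.

Lemma TO_achieve beta dS dO (VS : 'M[C]_dS) (VO : 'M[C]_dO) (ES p : 'I_dS -> R)
    (EO t : 'I_dO -> R) (rho : 'M[C]_dS) (e eps : R) :
  unitary_mx VS -> unitary_mx VO ->
  (forall s, (dagger VS *m rho *m VS) s s = rC (p s)) ->
  (forall i, 0 <= p i) -> \sum_i p i = 1 -> (forall k, 0 <= t k) -> \sum_k t k = 1 ->
  0 <= e -> e < eps -> eps < 1 ->
  (forall c, \sum_i p i * (p i / gw beta ES i <= c)%R%:R <=
     e + \sum_k t k * (t k / gw beta EO k <= c)%R%:R) ->
  TO_eps beta (spf VS ES) (spf VO EO) rho (spf VO t) eps.
Proof.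
case: dS VS ES p rho => [|dS'] VS ES p rho uS uO rhoE p0 p1 t0 t1 e0 ee e1 H.
  by move: p1; rewrite big_ord0 => /esym/eqP; rewrite oner_eq0.
have e01 : 0 <= e <= 1 by rewrite e0 (ltW (lt_trans ee e1)).
have [X [X0 Xp Xt X1 Xr]] := coupling p0 t0 p1 t1 e01 H.
have [k1 _|n0] := pickP (@predT 'I_dO); last first.
  by move: t1; rewrite big_pred0 // => /esym/eqP; rewrite oner_eq0.
pose J := ('I_dS'.+1 + 'I_dO)%type.
(* The relative loss that turns mass 1 - e into 1 - eps. *)
pose dl := (eps - e) / (1 - e).
have e1' : 0 < 1 - e by rewrite subr_gt0 (lt_trans ee).
have dl0 : 0 < dl by rewrite divr_gt0 // subr_gt0.
have dl1 : dl <= 1 by rewrite ler_pdivrMr // mul1r lerB // ltW.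
pose kap := 1 - dl / 4.
have kap01 : 0 < kap < 1 by rewrite /kap; lra.
(* By Bernoulli's inequality (L / (L + 1))^|J| is at least 1 - |J| / (L + 1), hence at least 1 - dl
   / 2. *)
pose L := (Num.truncn (2 * #|{: J}|%:R / dl)).+1.
have hL : 1 - dl / 2 <= (L%:R / L.+1%:R) ^+ #|{: J}|.
  have -> : L%:R / L.+1%:R = 1 - (L.+1%:R)^-1 :> R.
    by rewrite -[L.+1%:R]natr1; field; rewrite natr1 pnatr_eq0.
  apply: le_trans (bernoulli_ineq _ _); last first.
    by rewrite invr_ge0 ler0n /= invf_le1 // ler1n.
  have dl2 : 0 < dl / 2 by rewrite divr_gt0.
  rewrite lerB // ler_pdivrMr ?ltr0n // mulrC -ler_pdivrMr //.
  have := ltW (Num.Theory.truncnS_gt (2 * #|{: J}|%:R / dl)).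
  rewrite -/L => h; apply: le_trans (_ : L%:R <= _); last by rewrite ler_nat.
  by apply: le_trans h; rewrite invf_div mulrA [2 * _]mulrC.
pose cE (c : {ffun J -> 'I_L}) := expR (beta * shE ES EO (inner c)).
pose ZS := \sum_i expR (- beta * ES i).
pose ZO := \sum_k expR (- beta * EO k).
have ZS0 : 0 < ZS := gw_sum_gt0 beta ES ord0.
have ZO0 : 0 < ZO := gw_sum_gt0 beta EO k1.
have kp : 0 < 1 - kap by rewrite subr_gt0; case/andP: kap01.
have k0 : 0 < kap by case/andP: kap01.
have [Ma Ma0 hMa] := @big_enough R ({ffun J -> 'I_L} * 'I_dS'.+1)%type
  (fun x => (1 - kap) * (cE x.1 * expR (- beta * ES x.2) * ZO)) dO%:R (ler0n _ _).
have [Mb Mb0 hMb] := @big_enough R ({ffun J -> 'I_L} * 'I_dO)%type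
  (fun x => (1 - kap) * (cE x.1 * expR (- beta * EO x.2) * ZS)) dS'.+1%:R (ler0n _ _).
have [Mc Mc0 hMc] := @big_enough R ({ffun J -> 'I_L} * 'I_dS'.+1 * 'I_dO)%type
  (fun x => (1 - kap) * (kap * cE x.1.1 * ZS * ZO * flow beta ES p X x.1.2 x.2)) 1 ler01.
(* One scale serves all roundings; the summand 1 gives the zero lattice point a positive degeneracy,
   so the bath is not empty. *)
pose M := 1 + (Ma + (Mb + Mc)).
have M1 : 1 <= M by rewrite lerDl !addr_ge0 // ltW.
have M0 : 0 < M by apply: lt_le_trans M1.
have ca c i : dO%:R <= M * ((1 - kap) * (cE c * expR (- beta * ES i) * ZO)).
  apply: (hMa M _ (c, i)); last by rewrite !mulr_gt0 ?expR_gt0.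
  by rewrite /M addrCA lerDl !addr_ge0 // ltW.
have cb c k : dS'.+1%:R <= M * ((1 - kap) * (cE c * expR (- beta * EO k) * ZS)).
  apply: (hMb M _ (c, k)); last by rewrite !mulr_gt0 ?expR_gt0.
  by rewrite /M addrA addrCA lerDl !addr_ge0 // ltW.
have cc c i k : 0 < flow beta ES p X i k ->
    1 <= M * ((1 - kap) * (kap * cE c * ZS * ZO * flow beta ES p X i k)).
  move=> fl; apply: (hMc M _ (c, i, k)); last by rewrite mulr_gt0 // mulr_gt0 // mulr_gt0 // mulr_gt0 // mulr_gt0 // expR_gt0.
  by rewrite /M !addrA lerDr !addr_ge0 // ltW.
have [w0] : inhabited ('I_dS'.+1 * 'I_dO * lat beta ES EO L M)%type.
  pose a : {ffun J -> 'I_L.+1} := [ffun=> ord0].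
  have ha : (0 < mult beta ES EO M a)%N.
    rewrite /mult Num.Theory.truncn_gt0 /aE big1 ?mulr0 ?expR0 ?mulr1 //.
    by move=> j _; rewrite ffunE mul0r.
  exact: (inhabits (ord0, k1, Tagged (fun a => 'I_(mult beta ES EO M a)) (Ordinal ha))).
have latZ0 : 0 < latZ beta ES EO L M.
  rewrite /latZ (bigD1 w0.2) //= ltr_pwDl ?expR_gt0 //.
  by apply: sumr_ge0 => b _; exact: expR_ge0.
have [f [fsh fcnt]] := perm_labels
  (cnt_row p0 X0 Xp kap01 M0 ca ZO0) (cnt_col p0 t0 X0 Xt Xr kap01 M0 cb ZO0).
apply: (TO_of_perm fsh uS uO rhoE w0).
(* This is 1 - dl; th times the output margin of the coupling lies below both laws and has mass 1 -
   eps. *)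
pose th := (1 - eps) / (1 - e).
apply: (@tv_lower _ _ _ _ (fun o => th * \sum_i X i o)) => //.
- rewrite exchange_big /= -[RHS]p1.
  under eq_bigr => w _.
    rewrite -mulr_sumr (bigD1 (f w).1.2) //= eqxx big1 ?addr0 ?mulr1; last first.
      by move=> o /negbTE; rewrite eq_sym => ->.
    over.
  transitivity (\sum_(x : 'I_dS'.+1 * 'I_dO) \sum_(b : lat beta ES EO L M)
      p x.1 * (expR (- beta * EO x.2) * expR (- beta * aE ES EO (tag b)) / (ZO * latZ beta ES EO L M))).
    rewrite pair_bigA /=; apply: eq_bigr => w _.
    by rewrite /OmW mulrDr expRD.
  transitivity (\sum_(x : 'I_dS'.+1 * 'I_dO) p x.1 * (expR (- beta * EO x.2) / ZO)).
    apply: eq_bigr => x _; rewrite -mulr_sumr -mulr_suml -mulr_sumr -/(latZ _ _ _ _ _).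
    congr (_ * _); have := lt0r_neq0 latZ0; have := lt0r_neq0 ZO0.
    by move: (latZ _ _ _ _ _) (expR _) => u v h1 h2; field; rewrite h1 h2.
  rewrite -(pair_bigA _ (fun i k => p i * (expR (- beta * EO k) / ZO))) /=.
  apply: eq_bigr => i _; rewrite -mulr_sumr -mulr_suml divff ?mulr1 //.
  exact: lt0r_neq0.
- move=> o; have := out_lower p0 X0 Xp kap01 M0 cc ZO0 latZ0 o fsh fcnt.
  apply: le_trans.
  rewrite ler_wpM2r ?sumr_ge0 //.
  apply: (@le_trans _ _ ((1 - dl / 2) * (1 - dl / 2))).
    have -> : th = 1 - dl by rewrite /th /dl; field; exact: lt0r_neq0.
    by have [_ _ ->] := slack_ineq dl0 dl1.
  by have [h1 h2 _] := slack_ineq dl0 dl1; exact: ler_pM.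
- move=> o; apply: le_trans (Xt o).
  rewrite ler_piMl ?sumr_ge0 // /th ler_pdivrMr // mul1r lerB //; exact: ltW.
- by rewrite -mulr_sumr exchange_big /= X1 /th divfK // lt0r_neq0.
Qed.

End Achieve.

(** * Pinching a coherent state to energy classes *)

Section Pinching.
Variable R : realType.
Local Notation C := (complex R).

(** The pinching [M'] commutes with the diagonal matrix of class numbers; in a common eigenbasis
    every vector is supported on a single class, where [M] and [M'] have the same matrix
    elements. *)
Lemma pinch_basis N (T : finType) (cl : 'I_N -> T) (M : 'M[C]_N) : herm_mx M ->
  exists (V : 'M[C]_N) (col : 'I_N -> T) (p : 'I_N -> R),
  [/\ unitary_mx V, forall i j, cl i != col j -> V i j = 0 &
      forall j j', col j = col j' -> (dagger V *m M *m V) j j' = rC (p j) *+ (j == j')].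
Proof.
move=> hM.
pose M' : 'M[C]_N := \matrix_(i, j) (M i j *+ (cl i == cl j)).
(* Classes are coded as distinct reals, so that eigenvalues of a diagonal matrix tell them apart. *)
pose kap i : R := (enum_rank (cl i) : nat)%:R.
have hM' : herm_mx M'.
  apply/matrixP => i j; rewrite daggerE !mxE eq_sym; case: eqP => _.
    by rewrite !mulr1n -daggerE hM.
  by rewrite !mulr0n rmorph0.
have comm : M' *m dg kap = dg kap *m M'.
  apply/matrixP => i j; rewrite mul_dgE dg_mulE mxE; case: eqP => [e|_].
    by rewrite mulr1n mulrC /kap e.
  by rewrite mulr0n mul0r mulr0.
have hk : herm_mx (dg kap) by rewrite /herm_mx dagger_dg.
have [V [a [b [uV Ma kb]]]] := herm_codiag hM' hk comm.
have supp i j : V i j != 0 -> kap i = b j.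
  move=> Vij; have : (dg kap *m V) i j = (V *m dg b) i j.
    by rewrite kb /spf -mulmxA uV.2 mulmx1.
  rewrite dg_mulE mul_dgE mulrC => /(mulfI Vij); exact: rC_inj.
have kapI i i' : kap i = kap i' -> cl i = cl i'.
  by move=> /eqP; rewrite eqr_nat => /eqP /ord_inj /enum_rank_inj.
have ex j : exists i, V i j != 0.
  apply/existsP; apply: contraT; rewrite negb_exists => /forallP h.
  have := unitary_col j uV; rewrite big1 => [/esym/eqP|i _]; first by rewrite oner_eq0.
  by have := h i; rewrite negbK => /eqP ->; rewrite nsq0.
pose col j := cl (xchoose (ex j)).
have clcol i j : V i j != 0 -> cl i = col j.
  by move=> h; apply: kapI; rewrite (supp _ _ h) (supp _ _ (xchooseP (ex j))).
exists V, col, a; split=> //.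
  by move=> i j; apply: contraNeq => h; apply/eqP; exact: clcol.
move=> j j' ejj.
have <- : (dagger V *m M' *m V) j j' = rC (a j) *+ (j == j').
  have -> : dagger V *m M' *m V = dg a.
    by rewrite Ma /spf !mulmxA uV.2 mul1mx -mulmxA uV.2 mulmx1.
  by rewrite dgE.
rewrite !mxE; apply: eq_bigr => i' _.
have [->|Vi'] := eqVneq (V i' j') 0; first by rewrite !mulr0.
congr (_ * _); rewrite !mxE; apply: eq_bigr => i _.
have [Vi|Vi] := eqVneq (V i j) 0; first by rewrite daggerE Vi rmorph0 !mul0r.
by rewrite !mxE (clcol _ _ Vi) (clcol _ _ Vi') ejj eqxx.
Qed.

(** The state is tested on x, the part of the eigenvector w_i0 spanned by the new vectors in B. In
    the new basis the quadratic form is the right-hand side; in the old one only the term i0 is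
    kept. *)
Lemma quad_diag_ge (N : nat) (G : 'M[C]_N) (r : 'I_N -> R) (B : pred 'I_N)
    (p : 'I_N -> R) (i0 : 'I_N) :
  (forall i, 0 <= r i) ->
  (forall j j', B j -> B j' -> (dagger G *m dg r *m G) j j' = rC (p j) *+ (j == j')) ->
  r i0 * (\sum_(j | B j) nsq (G i0 j)) ^+ 2 <= \sum_(j | B j) p j * nsq (G i0 j).
Proof.
move=> r0 diagG.
pose x := (\col_j (conjc (G i0 j) *+ B j) : 'cV[C]_N).
have q1 : (dagger x *m (dagger G *m dg r *m G) *m x) 0 0 =
    rC (\sum_(j | B j) p j * nsq (G i0 j)).
  rewrite mxE rC_sum [RHS]big_mkcond /=; apply: eq_bigr => j' _.
  have [Bj'|nB] := boolP (B j'); last by rewrite [x _ _]mxE (negbTE nB) mulr0n mulr0.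
  rewrite mxE (bigD1 j') //= big1 => [|j jj']; last first.
    have [Bj|nB] := boolP (B j).
      by rewrite diagG // (negbTE jj') mulr0n mulr0.
    by rewrite daggerE [x _ _]mxE (negbTE nB) mulr0n rmorph0 mul0r.
  rewrite addr0 diagG // eqxx mulr1n mulrAC daggerE nsqE.
  by rewrite mxE Bj' mulr1n nsq_conj -rCM mulrC.
have q2 : (dagger x *m (dagger G *m dg r *m G) *m x) 0 0 =
    rC (\sum_i r i * nsq ((G *m x) i 0)).
  have -> : dagger x *m (dagger G *m dg r *m G) *m x = dagger (G *m x) *m dg r *m (G *m x).
    by rewrite daggerM !mulmxA.
  rewrite mxE rC_sum; apply: eq_bigr => i _.
  by rewrite mul_dgE mulrAC daggerE nsqE -rCM mulrC.
have Gx : (G *m x) i0 0 = rC (\sum_(j | B j) nsq (G i0 j)).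
  rewrite mxE rC_sum [RHS]big_mkcond /=; apply: eq_bigr => j _.
  rewrite mxE; case: (B j); last by rewrite mulr0n mulr0.
  by rewrite mulr1n mulrC nsqE.
have <- : \sum_i r i * nsq ((G *m x) i 0) = \sum_(j | B j) p j * nsq (G i0 j).
  by apply: rC_inj; rewrite -q1 -q2.
rewrite [leRHS](bigD1 i0) //= Gx {2}/nsq /= expr0n addr0 lerDl sumr_ge0 // => i _.
by rewrite mulr_ge0 // nsq_ge0.
Qed.

(* If P projects on the new eigenvectors of one class with p <= c g, then r_i |P w_i|^2 <= c g, while at most (c g e^tau)^-1 of the r_i exceed c g e^tau: each class contributes at most e^(-tau). *)
Lemma coherent_basis beta N (V W : 'M[C]_N) (E r : 'I_N -> R) (T : finType)
    (cl : 'I_N -> T) (ce : T -> R) :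
  unitary_mx V -> unitary_mx W -> (forall i, 0 <= r i) -> \sum_i r i = 1 ->
  (forall i, E i = ce (cl i)) ->
  exists (V2 : 'M[C]_N) (E2 p : 'I_N -> R),
  [/\ unitary_mx V2, spf V E = spf V2 E2,
      forall s, (dagger V2 *m spf W r *m V2) s s = rC (p s),
      (forall s, 0 <= p s) /\ \sum_s p s = 1 &
      forall c tau, \sum_s p s * (p s / gw beta E2 s <= c)%R%:R <=
        \sum_i \sum_j r i * nsq ((dagger V *m W) j i) *
           (r i / gw beta E j <= c * expR tau)%R%:R + #|T|%:R * expR (- tau)].
Proof.
move=> uV uW r0 r1 Ecl.
have hM : herm_mx (dagger V *m spf W r *m V) by exact/herm_conj/herm_spf.
have [V' [col [p [uV' supp diagp]]]] := pinch_basis cl hM.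
pose V2 := V *m V'; pose E2 j := ce (col j).
have uV2 : unitary_mx V2 by exact: unitary_mul.
pose G := dagger W *m V2.
have uG : unitary_mx G by apply: unitary_mul => //; exact: unitary_dagger.
have GE : dagger G *m dg r *m G = dagger V' *m (dagger V *m spf W r *m V) *m V'.
  by rewrite /G /V2 /spf !daggerM daggerK !mulmxA.
have diagG j j' : col j = col j' -> (dagger G *m dg r *m G) j j' = rC (p j) *+ (j == j').
  by rewrite GE; exact: diagp.
have pE j : p j = \sum_i r i * nsq (G i j).
  apply: rC_inj; have := diagG j j erefl; rewrite eqxx mulr1n => <-.
  rewrite mxE rC_sum; apply: eq_bigr => i _.
  by rewrite mul_dgE mulrAC daggerE nsqE -rCM mulrC.
have EV : dg E *m V' = V' *m dg E2.
  apply/matrixP => i j; rewrite dg_mulE mul_dgE.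
  have [e|ne] := eqVneq (cl i) (col j); first by rewrite mulrC Ecl e.
  by rewrite supp // mul0r mulr0.
(* The change of basis V' acts within classes, so it preserves the weight of w_i on each class. *)
have class_norm i (k : T) : \sum_(j | col j == k) nsq (G i j) =
    \sum_(l | cl l == k) nsq ((dagger V *m W) l i).
  have GW : G = dagger W *m V *m V' by rewrite /G /V2 mulmxA.
  pose P := spf V' (fun j => (col j == k)%:R).
  have PE : P = dg (fun l => (cl l == k)%:R).
    rewrite /P /spf -[RHS]mulmx1 -uV'.1 [RHS]mulmxA; congr (_ *m _).
    apply/matrixP => l j; rewrite dg_mulE mul_dgE mulrC.
    have [-> //|ne] := eqVneq (cl l) (col j); by rewrite supp // !mulr0.
  have Y (n' : nat) (A : 'M[C]_(n', N)) (Q : pred 'I_N) (i' : 'I_n') :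
      (A *m dg (fun j => (Q j)%:R) *m dagger A) i' i' = rC (\sum_(j | Q j) nsq (A i' j)).
    rewrite mxE rC_sum [RHS]big_mkcond /=; apply: eq_bigr => j _.
    rewrite mul_dgE daggerE mulrAC [A i' j * _]mulrC nsqE.
    by case: (Q j); rewrite /= ?mulr1n ?mulr0n ?rC1 ?rC0 ?mulr1 ?mulr0.
  apply: rC_inj; rewrite -Y GW daggerM.
  have -> : dagger W *m V *m V' *m dg (fun j => (col j == k)%:R) *m
     (dagger V' *m dagger (dagger W *m V)) = (dagger W *m V) *m P *m dagger (dagger W *m V).
    by rewrite /P /spf !mulmxA.
  rewrite PE Y; congr rC; apply: eq_bigr => l _.
  by rewrite -nsq_conj -daggerE daggerM daggerK.
(* The Hamiltonian is the same, so the partition functions agree; the squared entries of V' are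
   doubly stochastic and link only equal energies. *)
have ZE : \sum_j expR (- beta * E2 j) = \sum_i expR (- beta * E i).
  transitivity (\sum_j \sum_i nsq (V' i j) * expR (- beta * E i)).
    apply: eq_bigr => j _; rewrite -[LHS]mul1r -(unitary_col j uV') mulr_suml.
    apply: eq_bigr => i _; have [e|ne] := eqVneq (cl i) (col j).
      by rewrite Ecl e.
    by rewrite supp // nsq0 !mul0r.
  rewrite exchange_big /=; apply: eq_bigr => i _.
  by rewrite -mulr_suml (unitary_row _ uV') mul1r.
pose s (k : T) := expR (- beta * ce k) / \sum_i expR (- beta * E i).
have gE2 j : gw beta E2 j = s (col j) by rewrite /gw ZE.
have gE l : gw beta E l = s (cl l) by rewrite /gw Ecl.
exists V2, E2, p; split=> //.
- rewrite /spf /V2 daggerM !mulmxA -[V *m V' *m dg E2]mulmxA -EV.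
  by rewrite -!mulmxA [V' *m (dagger V' *m _)]mulmxA uV'.1 mul1mx.
- move=> j; have := diagG j j erefl; rewrite eqxx mulr1n => <-.
  by congr (fun_of_matrix _ j j); rewrite /G /spf daggerM daggerK !mulmxA.
- split=> [j|]; first by rewrite pE sumr_ge0 // => i _; rewrite mulr_ge0 // nsq_ge0.
  under eq_bigr => j _ do rewrite pE.
  rewrite exchange_big /= -[RHS]r1; apply: eq_bigr => i _.
  by rewrite -mulr_sumr (unitary_row _ uG) mulr1.
move=> c tau.
pose bad (k : T) j := (col j == k) && (p j <= c * s k).
have s0 k l : cl l = k -> 0 < s k by move=> <-; rewrite -gE gw_gt0.
have s0' j : 0 < s (col j) by rewrite -gE2 gw_gt0.
pose big k i := c * expR tau * s k < r i.
have splitbad : \sum_j p j * (p j / gw beta E2 j <= c)%R%:R =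
    \sum_k \sum_i r i * \sum_(j | bad k j) nsq (G i j).
  under [RHS]eq_bigr => k _ do under eq_bigr => i _ do rewrite mulr_sumr.
  under [RHS]eq_bigr => k _ do rewrite exchange_big /=.
  under [RHS]eq_bigr => k _ do under eq_bigr => j _ do rewrite -pE.
  under [RHS]eq_bigr => k _ do rewrite big_mkcond.
  rewrite [RHS]exchange_big /=; apply: eq_bigr => j _.
  rewrite (bigD1 (col j)) //= big1 ?addr0 => [|k /negbTE]; last by rewrite /bad eq_sym => ->.
  rewrite /bad eqxx /= gE2 ler_pdivrMr //.
  by case: ifP => _; rewrite ?mulr1 ?mulr0.
rewrite splitbad.
(* When r i is not big, the event on the right-hand side holds throughout the class, and
   [class_norm] transfers the weight. *)
have good_part k : \sum_(i | ~~ big k i) r i * \sum_(j | bad k j) nsq (G i j) <=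
    \sum_i \sum_(l | cl l == k) r i * nsq ((dagger V *m W) l i) *
       (r i / gw beta E l <= c * expR tau)%R%:R.
  rewrite [leLHS]big_mkcond; apply: ler_sum => i _ /=; case: ifP => bi; last first.
    rewrite sumr_ge0 // => l _; rewrite !mulr_ge0 //; exact: nsq_ge0.
  apply: (@le_trans _ _ (r i * \sum_(j | col j == k) nsq (G i j))).
    rewrite ler_wpM2l // [leRHS](bigID (fun j => p j <= c * s k)) /= lerDl.
    by apply: sumr_ge0 => j _; exact: nsq_ge0.
  rewrite class_norm mulr_sumr; apply: ler_sum => l /eqP lk.
  rewrite gE lk ler_pdivrMr ?(s0 _ _ lk) //.
  by move: bi; rewrite /big -leNgt => ->; rewrite mulr1.
have big_part k : \sum_(i | big k i) r i * \sum_(j | bad k j) nsq (G i j) <= expR (- tau).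
  case: (pickP (bad k)) => [j0 bj0|nob]; last first.
    rewrite big1 ?expR_ge0 // => i _; rewrite big_pred0 ?mulr0 //.
  have sk : 0 < s k by move: bj0; rewrite /bad => /andP[/eqP <- _].
  have p0 j : 0 <= p j.
    by rewrite pE sumr_ge0 // => i _; rewrite mulr_ge0 // nsq_ge0.
  have cs0 : 0 <= c * s k by move: bj0 => /andP[_]; exact: le_trans.
  have ub i : r i * \sum_(j | bad k j) nsq (G i j) <= c * s k.
    set n := \sum_(j | _) _.
    have n0 : 0 <= n by apply: sumr_ge0 => j _; exact: nsq_ge0.
    have [n1|n1] := eqVneq n 0; first by rewrite n1 mulr0.
    have n2 : 0 < n by rewrite lt_def n1 n0.
    rewrite -(ler_pM2r n2) -mulrA -expr2.
    apply: (le_trans (quad_diag_ge i r0 _)).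
      move=> j j' /andP[/eqP e _] /andP[/eqP e' _].
      by apply: diagG; rewrite e e'.
    rewrite mulr_sumr; apply: ler_sum => j /andP[_ h].
    by rewrite ler_wpM2r // nsq_ge0.
  apply: (@le_trans _ _ (\sum_(i | big k i) c * s k)); first exact: ler_sum.
  rewrite -[leRHS]mul1r -(ler_pM2r (expR_gt0 tau)) -mulrA -expRD addNr expR0 mulr1.
  rewrite mulr_suml -r1 [leRHS](bigID (big k)) /= -[leLHS]addr0 lerD //; last first.
    by apply: sumr_ge0.
  by apply: ler_sum => i; rewrite /big mulrAC => /ltW.
apply: (@le_trans _ _ (\sum_k ((\sum_i \sum_(l | cl l == k) r i * nsq ((dagger V *m W) l i) *
       (r i / gw beta E l <= c * expR tau)%R%:R) + expR (- tau)))).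
  apply: ler_sum => k _; rewrite (bigID (big k)) /= addrC lerD //.
have eT : \sum_(k : T) expR (- tau) = #|T|%:R * expR (- tau).
  by rewrite sumr_const -[LHS]mulr_natl.
rewrite [leLHS]big_split /= eT lerD2r.
rewrite exchange_big /= le_eqVlt; apply/orP; left; apply/eqP.
by apply: eq_bigr => i _; rewrite [RHS](partition_big cl predT).
Qed.

End Pinching.

(** * Tensor powers and likelihood ratios *)

Section TensorPowers.
Variable R : realType.
Local Notation C := (complex R).

Fixpoint prodf d (a : 'I_d -> R) n : 'I_(npow d n) -> R :=
  match n return 'I_(npow d n) -> R with
  | 0 => fun=> 1
  | n'.+1 => tfun *%R a (@prodf d a n')
  end.

Fixpoint sumf d (a : 'I_d -> R) n : 'I_(npow d n) -> R :=
  match n return 'I_(npow d n) -> R with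
  | 0 => fun=> 0
  | n'.+1 => tfun +%R a (@sumf d a n')
  end.

(* Tests looking at the first m0 factors only give a converse uniform in the number n >= m0 of copies. *)
Fixpoint headf d (a : 'I_d -> R) m0 n : 'I_(npow d n) -> R :=
  match n return 'I_(npow d n) -> R with
  | 0 => fun=> 1
  | n'.+1 => if m0 is m0'.+1 then tfun *%R a (@headf d a m0' n') else fun=> 1
  end.

Lemma sum_npow (S : nmodType) d n (F : 'I_(npow d n.+1) -> S) :
  \sum_k F k = \sum_(i < d) \sum_(j < npow d n) F (mxtens_index (i, j)).
Proof. exact: (@sum_mxtens S d (npow d n) F). Qed.

Lemma prodfS d (a : 'I_d -> R) n i (j : 'I_(npow d n)) :
  prodf a (n := n.+1) (mxtens_index (i, j)) = a i * prodf a j.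
Proof. exact: tfunE. Qed.

Lemma headfS d (a : 'I_d -> R) m0 n i (j : 'I_(npow d n)) :
  headf a m0.+1 (n := n.+1) (mxtens_index (i, j)) = a i * headf a m0 j.
Proof. exact: tfunE. Qed.

Lemma prodf_ge0 d (a : 'I_d -> R) n (k : 'I_(npow d n)) :
  (forall i, 0 <= a i) -> 0 <= prodf a k.
Proof.
move=> a0; elim: n k => [|n IH] k; first exact: ler01.
by rewrite /= /tfun mulr_ge0.
Qed.

Lemma prodf_gt0 d (a : 'I_d -> R) n (k : 'I_(npow d n)) :
  (forall i, 0 < a i) -> 0 < prodf a k.
Proof.
move=> a0; elim: n k => [|n IH] k; first exact: ltr01.
by rewrite /= /tfun mulr_gt0.
Qed.

Lemma prodf_sum d (a : 'I_d -> R) n : \sum_(k < npow d n) prodf a k = (\sum_i a i) ^+ n.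
Proof.
elim: n => [|n IH]; first by rewrite [LHS]big_ord1 expr0.
rewrite sum_npow exprS -IH mulr_suml; apply: eq_bigr => i _.
by rewrite mulr_sumr; apply: eq_bigr => j _; rewrite prodfS.
Qed.

Lemma prodf_div d (a b : 'I_d -> R) n (k : 'I_(npow d n)) :
  prodf a k / prodf b k = prodf (fun i => a i / b i) k.
Proof.
elim: n k => [|n IH] k; first by rewrite divr1.
by rewrite /= /tfun -IH invfM; ring.
Qed.

Lemma unitary_tpow d (V : 'M[C]_d) n : unitary_mx V -> unitary_mx (tpow V n).
Proof.
move=> uV; elim: n => [|n IH]; first exact: unitary1.
exact: unitary_tens.
Qed.

Lemma tpow_spf d (V : 'M[C]_d) a n : unitary_mx V ->
  tpow (spf V a) n = spf (tpow V n) (@prodf d a n).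
Proof.
move=> uV; elim: n => [|n IH] /=; first by rewrite spf1 //; exact: unitary1.
by rewrite IH spf_tens.
Qed.

Lemma hpow_spf d (V : 'M[C]_d) a n : unitary_mx V ->
  hpow (spf V a) n = spf (tpow V n) (@sumf d a n).
Proof.
move=> uV; elim: n => [|n IH] /=; last by rewrite IH hsum_spf //; exact: unitary_tpow.
rewrite /spf (_ : dg _ = 0) ?mulmx0 ?mul0mx //.
by apply/matrixP => i j; rewrite dgE mxE rC0 mul0rn.
Qed.

Lemma gw_sumf beta d (E : 'I_d -> R) n (k : 'I_(npow d n)) :
  gw beta (@sumf d E n) k = prodf (gw beta E) k.
Proof.
elim: n k => [|n IH] k.
  rewrite /= /gw big_ord1 /= divff //; exact/lt0r_neq0/expR_gt0.
transitivity (tfun *%R (gw beta E) (gw beta (@sumf d E n)) k); first exact: gw_tfun.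
by rewrite /= /tfun IH.
Qed.

(** Where a i = 0 the logarithm carries no meaning, but such indices have no weight; the factors
    beyond m0 sum to 1. *)
Lemma sum_prodf_headf d (a u : 'I_d -> R) m0 n (h : R -> R) :
  (m0 <= n)%N -> (forall i, 0 < a i -> 0 < u i) -> (forall i, 0 <= a i) -> \sum_i a i = 1 ->
  \sum_(k < npow d n) prodf a k * h (headf u m0 k) =
  Ex a (fun i => ln (u i)) m0 (fun x => h (expR x)).
Proof.
move=> + au a0 a1; elim: m0 n h => [|m0 IH] [|n] h //= mn.
- by rewrite [LHS]big_ord1 mul1r expR0.
- transitivity (\sum_(k < npow d n.+1) prodf a k * h 1); first by [].
  by rewrite -mulr_suml prodf_sum a1 expr1n mul1r expR0.
rewrite (@sum_npow R d n (fun k => prodf a (n := n.+1) k * h (headf u m0.+1 (n := n.+1) k))).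
apply: eq_bigr => i _.
under eq_bigr => j _ do rewrite prodfS headfS -mulrA.
rewrite -mulr_sumr; have [->|ai] := eqVneq (a i) 0; first by rewrite !mul0r.
have ai0 : 0 < a i by rewrite lt_def ai a0.
rewrite (IH n (fun y => h (u i * y))) //; congr (_ * _); apply: eq_Ex => x.
by rewrite expRD lnK // posrE au.
Qed.

Lemma prodf_headf d (a : 'I_d -> R) n (k : 'I_(npow d n)) : headf a n k = prodf a k.
Proof. by elim: n k => [|n IH] k //=; rewrite /tfun IH. Qed.

(** A likelihood ratio has mean 1 under its denominator; this feeds Markov's inequality in the
    converse. *)
Lemma markov_headf d (s t : 'I_d -> R) m0 n : (forall i, 0 < s i) -> \sum_i s i = 1 ->
  \sum_i t i = 1 ->
  \sum_(k < npow d n) prodf s k * headf (fun i => t i / s i) m0 k = 1.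
Proof.
move=> s0 s1 t1; elim: n m0 => [|n IH] m0; first by rewrite [LHS]big_ord1; case: m0 => *; exact: mulr1.
case: m0 => [|m0] /=.
  transitivity (\sum_(k < npow d n.+1) prodf s k); last by rewrite prodf_sum s1 expr1n.
  by apply: eq_bigr => k _; rewrite mulr1.
rewrite (@sum_npow R d n (fun k => prodf s (n := n.+1) k * headf (fun i => t i / s i) m0.+1 (n := n.+1) k)).
rewrite -[RHS]t1; apply: eq_bigr => i _.
under eq_bigr => j _ do rewrite prodfS headfS mulrACA.
by rewrite -mulr_sumr IH mulr1 mulrCA divff ?mulr1 // lt0r_neq0.
Qed.

Lemma headf_ge0 d (a : 'I_d -> R) m0 n (k : 'I_(npow d n)) :
  (forall i, 0 <= a i) -> 0 <= headf a m0 k.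
Proof.
move=> a0; elim: n m0 k => [|n IH] [|m0] k //=.
by rewrite /tfun mulr_ge0.
Qed.

(* Nussbaum-Szkola law of the pair (sum_i r_i |w_i><w_i|, sum_j s_j |v_j><v_j|). *)
Definition nsP d (V W : 'M[C]_d) (r : 'I_d -> R) (x : 'I_d * 'I_d) : R :=
  r x.1 * nsq ((dagger V *m W) x.2 x.1).
Definition nsX d (r s : 'I_d -> R) (x : 'I_d * 'I_d) : R := ln (r x.1 / s x.2).

Section NS.
Variables (d : nat) (V W : 'M[C]_d) (r s : 'I_d -> R).
Hypotheses (uV : unitary_mx V) (uW : unitary_mx W).
Hypotheses (r0 : forall i, 0 <= r i) (r1 : \sum_i r i = 1) (s0 : forall i, 0 < s i).

Let uVW : unitary_mx (dagger V *m W).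
Proof. by apply: unitary_mul => //; exact: unitary_dagger. Qed.

Lemma nsP_ge0 x : 0 <= nsP V W r x.
Proof. by rewrite mulr_ge0 // nsq_ge0. Qed.

Lemma nsP_sum : \sum_x nsP V W r x = 1.
Proof.
rewrite -(pair_bigA _ (fun i j => r i * nsq ((dagger V *m W) j i))) /= -r1.
by apply: eq_bigr => i _; rewrite -mulr_sumr unitary_col // mulr1.
Qed.

(** Overlaps and eigenvalues of product states factorise, so ln of the n-copy ratio is a sum of n
    independent terms. Vanishing r i are split off because ln and expR cancel only on positive
    ratios. *)
Lemma ns_tpow n (h : R -> R) :
  \sum_i \sum_j prodf r i * nsq ((dagger (tpow V n) *m tpow W n) j i) * h (prodf r i / prodf s j)
  = Ex (nsP V W r) (nsX r s) n (fun x => h (expR x)).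
Proof.
elim: n h => [|n IH] h.
  rewrite [LHS]big_ord1 big_ord1 /= dagger1 mulmx1 mxE eqxx.
  have -> : nsq (true%:R : C) = 1 by rewrite /nsq /= expr1n expr0n addr0.
  by rewrite !mul1r invr1 expR0.
rewrite sum_npow.
under eq_bigr => i _ do under eq_bigr => k _ do rewrite sum_npow.
rewrite /= -(pair_bigA _ (fun i j => nsP V W r (i, j) *
   Ex (nsP V W r) (nsX r s) n (fun x => h (expR (nsX r s (i, j) + x))))) /=.
apply: eq_bigr => i _; rewrite exchange_big /=; apply: eq_bigr => j _.
rewrite dagger_tens tensmx_mul.
have [ri|ri] := eqVneq (r i) 0.
  rewrite /nsP /= ri !mul0r big1 // => k _; rewrite big1 // => l _.
  by rewrite tfunE ri !mul0r.
have ri0 : 0 < r i by rewrite lt_def ri r0.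
have -> : Ex (nsP V W r) (nsX r s) n (fun x => h (expR (nsX r s (i, j) + x))) =
    Ex (nsP V W r) (nsX r s) n (fun x => h (r i / s j * expR x)).
  by apply: eq_Ex => x; rewrite expRD lnK // posrE divr_gt0.
rewrite -(IH (fun y => h (r i / s j * y))) mulr_sumr; apply: eq_bigr => k _.
rewrite mulr_sumr; apply: eq_bigr => l _.
rewrite !tfunE tensmxE nsqM /nsP /= [RHS]mulrA mulrACA; congr (_ * h _).
by rewrite invfM mulrACA.
Qed.

Lemma relent_ns : relent (spf W r) (spf V s) = \sum_x nsP V W r x * nsX r s x.
Proof.
rewrite /relent /mln !mfun_spf // mulmxBr linearB /= raddfB /=.
rewrite tr_spf2 // rC_Re tr_spfM Re_sum.
rewrite -(pair_bigA _ (fun i j => nsP V W r (i, j) * nsX r s (i, j))) /= -sumrB.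
apply: eq_bigr => i _.
have -> : (dagger W *m spf V (@ln R \o s) *m W) i i =
    rC (\sum_j ln (s j) * nsq ((dagger V *m W) j i)).
  rewrite spf_conj /spf mxE rC_sum; apply: eq_bigr => j _.
  rewrite mul_dgE daggerE mulrAC [_ * conjc _]mulrC nsqE -rCM mulrC.
  by rewrite -nsq_conj -daggerE daggerM daggerK.
rewrite Re_rCM rC_Re /nsP /nsX /=.
have -> : r i * ln (r i) = \sum_j r i * ln (r i) * nsq ((dagger V *m W) j i).
  by rewrite -mulr_sumr unitary_col // mulr1.
rewrite mulr_sumr -sumrB; apply: eq_bigr => j _.
have [->|ri] := eqVneq (r i) 0; first by rewrite !mul0r subr0.
have ri0 : 0 < r i by rewrite lt_def ri r0.
by rewrite ln_div ?posrE //; ring.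
Qed.

(** Between v_j and w_i the operator ln rho - ln sigma multiplies the overlap by ln r_i - ln s_j.
    Squaring and summing over j gives the second moment, although the logarithms need not
    commute. *)
Lemma relvar_ns : relvar (spf W r) (spf V s) =
  \sum_x nsP V W r x * nsX r s x ^+ 2 - (\sum_x nsP V W r x * nsX r s x) ^+ 2.
Proof.
rewrite /relvar relent_ns; congr (_ - _); rewrite /mln !mfun_spf //.
set Y := _ - _.
have hY : dagger Y = Y by rewrite /Y daggerB (herm_spf W) (herm_spf V).
rewrite tr_spfM Re_sum.
rewrite -(pair_bigA _ (fun i j => nsP V W r (i, j) * nsX r s (i, j) ^+ 2)) /=.
apply: eq_bigr => i _.
have -> : dagger W *m (Y *m Y) *m W = dagger (dagger V *m Y *m W) *m (dagger V *m Y *m W).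
  rewrite !daggerM daggerK hY !mulmxA -[_ *m V *m dagger V]mulmxA uV.1 mulmx1.
  by [].
rewrite dagger_mul_diag Re_rCM rC_Re mulr_sumr; apply: eq_bigr => j _.
have -> : (dagger V *m Y *m W) j i = (dagger V *m W) j i * rC (ln (r i) - ln (s j)).
  have -> : dagger V *m Y *m W = (dagger V *m W) *m dg (@ln R \o r) - dg (@ln R \o s) *m (dagger V *m W).
    rewrite /Y mulmxBr mulmxBl /spf !mulmxA uV.2 mul1mx.
    by rewrite -[_ *m dagger W *m W]mulmxA uW.2 mulmx1.
  by rewrite mxE [X in _ + X]mxE mul_dgE dg_mulE rCD rCN /=; ring.
rewrite nsqM {2}/nsq /= expr0n addr0 /nsP /nsX /= mulrA.
have [->|ri] := eqVneq (r i) 0; first by rewrite !mul0r.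
have ri0 : 0 < r i by rewrite lt_def ri r0.
by rewrite ln_div ?posrE.
Qed.

End NS.

Fixpoint tally d n : 'I_(npow d n) -> 'I_d -> nat :=
  match n return 'I_(npow d n) -> 'I_d -> nat with
  | 0 => fun _ _ => 0%N
  | n'.+1 => fun k i => ((i == (@mxtens_unindex d (npow d n') k).1) +
                tally (@mxtens_unindex d (npow d n') k).2 i)%N
  end.

Lemma tally_le d n (k : 'I_(npow d n)) i : (tally k i <= n)%N.
Proof. by elim: n k => //= n IH k; rewrite -add1n leq_add // leq_b1. Qed.

Lemma sumf_tally d (E : 'I_d -> R) n (k : 'I_(npow d n)) :
  sumf E k = \sum_i (tally k i)%:R * E i.
Proof.
elim: n k => [|n IH] k; first by rewrite /= big1 // => i _; rewrite mul0r.
rewrite /= /tfun IH; under [RHS]eq_bigr => i _ do rewrite natrD mulrDl.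
rewrite big_split /=; congr (_ + _).
rewrite (bigD1 (mxtens_unindex k).1) //= eqxx mul1r big1 ?addr0 // => i /negbTE ->.
by rewrite mul0r.
Qed.

(** The classes fed to [coherent_basis]: the energy of a product level depends on its tally only,
    and the target type has (n + 1)^d elements. *)
Definition tally_class d n (k : 'I_(npow d n)) : {ffun 'I_d -> 'I_n.+1} :=
  [ffun i => inord (tally k i)].

Lemma sumf_class d (E : 'I_d -> R) n (k : 'I_(npow d n)) :
  sumf E k = \sum_i (tally_class k i)%:R * E i.
Proof.
rewrite sumf_tally; apply: eq_bigr => i _.
by rewrite ffunE inordK // ltnS tally_le.
Qed.

Definition batE (w : R) (i : 'I_2) : R := if i == 1 then w else 0.

Lemma HW_spf w : HW w = spf 1%:M (batE w).
Proof. by rewrite spf_id. Qed.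

Lemma delta_spf (b : 'I_2) : delta_mx b b = spf 1%:M (fun i => (i == b)%:R : R) :> 'M[C]_2.
Proof.
rewrite spf_id; apply/matrixP => i j; rewrite dgE mxE.
case: (eqVneq i j) => [<-|ij]; first by rewrite andbb; case: eqP.
rewrite [RHS]mulr0n; have [ib|_] //= := eqVneq i b.
by have [jb|//] := eqVneq j b; rewrite ib jb eqxx in ij.
Qed.

Lemma gw_bat beta w : gw beta (batE w) 1 = expR (- (beta * w)) * gw beta (batE w) 0.
Proof. by rewrite /gw /batE /= mulr0 expR0 mul1r mulNr. Qed.

End TensorPowers.

(** * Monotonicity and range of the discrete distribution functions *)

Section CdfBounds.
Variables (R : realType) (T : finType) (p f : T -> R).
Hypotheses (p0 : forall t, 0 <= p t) (p1 : \sum_t p t = 1).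

Lemma cdfn_mono n x y : x <= y -> cdfn p f n x <= cdfn p f n y.
Proof.
move=> xy; apply: le_Ex => // s; rewrite ler_nat.
by have [sx|//] := leP s x; rewrite (le_trans sx xy).
Qed.

Lemma cdfn_ge0 n x : 0 <= cdfn p f n x.
Proof. by rewrite -(Ex_cst p1 f n 0); apply: le_Ex => // s; rewrite ler0n. Qed.

Lemma cdfn_le1 n x : cdfn p f n x <= 1.
Proof. by rewrite -[leRHS](Ex_cst p1 f n 1); apply: le_Ex => // s; rewrite lern1; case: leP. Qed.

End CdfBounds.

(** * One-shot bounds with a battery *)

Section OneShot.
Variable R : realType.
Local Notation C := (complex R).
Variables (beta : R) (d1 d2 : nat).
Variables (V1 W1 : 'M[C]_d1) (E1 r : 'I_d1 -> R) (V2 : 'M[C]_d2) (E2 t : 'I_d2 -> R).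
Hypotheses (uV1 : unitary_mx V1) (uW1 : unitary_mx W1) (uV2 : unitary_mx V2).
Hypotheses (r0 : forall i, 0 <= r i) (r1 : \sum_i r i = 1).
Hypotheses (t0 : forall k, 0 <= t k) (t1 : \sum_k t k = 1).
Variables (w eps : R) (n : nat).

Local Notation s1 := (gw beta E1).
Local Notation s2 := (gw beta E2).
Local Notation P1 := (nsP V1 W1 r).
Local Notation X1 := (nsX r s1).
Definition llr (k : 'I_d2) : R := ln (t k / s2 k).

Lemma sum_ord2 (S : nmodType) (F : 'I_2 -> S) : \sum_b F b = F 0 + F 1.
Proof. by rewrite big_ord_recl big_ord1; congr (_ + F _); apply: val_inj. Qed.

(** The excited battery has Gibbs weight e^(- beta w) times that of its ground state, so the work
    only shifts the output threshold by beta w. The terms with tau are the cost of coherence in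
    [coherent_basis]. *)
Lemma achievable_of_cdf m e tau : 0 <= e -> e < eps -> eps < 1 ->
  (forall y, cdfn P1 X1 n (y + tau) + (n.+1 ^ d1)%:R * expR (- tau) <=
     e + cdfn t llr m (y - beta * w)) ->
  achievable beta (spf V1 E1) (spf V2 E2) (spf W1 r) (spf V2 t) w eps n m.
Proof.
move=> e0 ee eps1 H; rewrite /achievable.
have uVn := unitary_tpow n uV1; have uWn := unitary_tpow n uW1.
have uV2m := unitary_tpow m uV2.
have rn0 k : 0 <= @prodf R d1 r n k by exact: prodf_ge0.
have rn1 : \sum_k @prodf R d1 r n k = 1 by rewrite prodf_sum r1 expr1n.
have tm0 k : 0 <= @prodf R d2 t m k by exact: prodf_ge0.
have tm1 : \sum_k @prodf R d2 t m k = 1 by rewrite prodf_sum t1 expr1n.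
have [V [E [p [uV HE rhoE [p0 p1] Hp]]]] :=
  coherent_basis beta (E := @sumf R d1 E1 n) (cl := @tally_class d1 n)
   (ce := fun c => \sum_i (c i)%:R * E1 i) uVn uWn rn0 rn1 (@sumf_class R d1 E1 n).
rewrite !hpow_spf // !tpow_spf // HE HW_spf /ket0 /ket1 !delta_spf.
have u2 := unitary1 R 2.
rewrite !hsum_spf // !spf_tens.
have uVO : unitary_mx (tpow V2 m *t (1%:M : 'M[C]_2)) by exact: unitary_tens.
apply: (TO_achieve (p := tfun *%R p (fun b => (b == 0)%:R)) (e := e)) => //.
- exact: unitary_tens.
- move=> k; case: (mxtens_indexP k) => s b.
  rewrite -spf_tens dagger_tens !tensmx_mul tensmxE rhoE tfunE rCM.
  by rewrite dagger1 mul1mx mulmx1 spf_id dgE eqxx mulr1n.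
- by move=> k; rewrite /tfun mulr_ge0.
- rewrite sum_mxtens -[RHS]p1; apply: eq_bigr => s _.
  under eq_bigr => b _ do rewrite tfunE.
  by rewrite sum_ord2 /= mulr0 mulr1 addr0.
- by move=> k; rewrite /tfun mulr_ge0.
- rewrite sum_mxtens -[RHS]tm1; apply: eq_bigr => s _.
  under eq_bigr => b _ do rewrite tfunE.
  by rewrite sum_ord2 /= mulr0 mulr1 add0r.
move=> c.
set g0 := gw beta (batE w) 0.
have g00 : 0 < g0 by exact: gw_gt0.
have -> : \sum_i tfun *%R p (fun b => (b == 0)%:R) i *
   (tfun *%R p (fun b => (b == 0)%:R) i / gw beta (tfun +%R E (batE w)) i <= c)%R%:R =
   \sum_s p s * (p s / gw beta E s <= c * g0)%R%:R.
  rewrite sum_mxtens; apply: eq_bigr => s _; rewrite sum_ord2 gw_tfun !tfunE /=.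
  rewrite mulr0 mul0r addr0 mulr1; congr (_ * (nat_of_bool _)%:R).
  by rewrite invfM mulrA -/g0 ler_pdivrMr.
have -> : \sum_k tfun *%R (@prodf R d2 t m) (fun b => (b == 1)%:R) k *
   (tfun *%R (@prodf R d2 t m) (fun b => (b == 1)%:R) k /
     gw beta (tfun +%R (@sumf R d2 E2 m) (batE w)) k <= c)%R%:R =
   \sum_k @prodf R d2 t m k * (@headf R d2 (fun i => t i / s2 i) m m k <= c * g0 * expR (- (beta * w)))%R%:R.
  rewrite sum_mxtens; apply: eq_bigr => k _; rewrite sum_ord2 !gw_tfun !tfunE /=.
  rewrite gw_bat -/g0 gw_sumf prodf_headf -prodf_div.
  rewrite mulr0 mul0r add0r mulr1; congr (_ * (nat_of_bool _)%:R).
  have ek := expR_gt0 (- (beta * w)).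
  rewrite [X in _ / X](_ : _ = expR (- (beta * w)) * g0 * prodf s2 k); last by ring.
  rewrite invfM [X in _ * X]mulrC mulrA ler_pdivrMr ?(mulr_gt0 ek g00) //.
  by rewrite [expR _ * g0]mulrC mulrA.
(* For c <= 0 the left side vanishes, as ratios on the support are positive; otherwise y is ln (c
   g0). *)
have [c0|c0] := lerP c 0.
  have T0 : 0 <= \sum_k @prodf R d2 t m k * (@headf R d2 (fun i => t i / s2 i) m m k <= c * g0 * expR (- (beta * w)))%R%:R.
    by apply: sumr_ge0 => k _; rewrite mulr_ge0.
  rewrite [leLHS]big1 ?addr_ge0 // => s _.
  have [ps|ps] := eqVneq (p s) 0; first by rewrite ps mul0r.
  have ps0 : 0 < p s by rewrite lt_def ps p0.
  rewrite leNgt (le_lt_trans _ (divr_gt0 ps0 (gw_gt0 _ _ _))) ?mulr0 //.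
  by rewrite pmulr_lle0.
have cg0 : 0 < c * g0 by rewrite mulr_gt0.
apply: (le_trans (Hp _ tau)); have := H (ln (c * g0)).
rewrite card_ffun !card_ord.
have -> : \sum_i \sum_j @prodf R d1 r n i * nsq ((dagger (tpow V1 n) *m tpow W1 n) j i) *
    (@prodf R d1 r n i / gw beta (@sumf R d1 E1 n) j <= c * g0 * expR tau)%R%:R =
    cdfn P1 X1 n (ln (c * g0) + tau).
  under eq_bigr => i _ do under eq_bigr => j _ do rewrite gw_sumf.
  rewrite (ns_tpow V1 W1 r0 (fun i => gw_gt0 beta E1 i) n (fun y => (y <= c * g0 * expR tau)%R%:R)).
  apply: eq_Ex => x; congr (nat_of_bool _)%:R.
  by rewrite -[c * g0 in LHS](lnK (x := c * g0)) // -expRD ler_expR.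
have -> // : \sum_k @prodf R d2 t m k * (@headf R d2 (fun i => t i / s2 i) m m k <= c * g0 * expR (- (beta * w)))%R%:R =
    cdfn t llr m (ln (c * g0) - beta * w).
rewrite (@sum_prodf_headf R d2 t (fun i => t i / s2 i) m m
  (fun y => (y <= c * g0 * expR (- (beta * w)))%R%:R)) //; last first.
  by move=> i ti; rewrite divr_gt0 // gw_gt0.
apply: eq_Ex => x; congr (nat_of_bool _)%:R.
by rewrite -[c * g0 in LHS](lnK (x := c * g0)) // -expRD ler_expR.
Qed.

(** One tau makes the Gibbs acceptance term at most e^(- tau); the other turns the smooth
    Neyman-Pearson weight into an indicator at the cost of another e^(- tau). *)
Lemma converse_cdf m0 m c tau :
  achievable beta (spf V1 E1) (spf V2 E2) (spf W1 r) (spf V2 t) w eps n m ->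
  (m0 <= m)%N ->
  cdfn P1 X1 n (c + beta * w - tau *+ 2) <= cdfn t llr m0 c + eps + expR (- tau) *+ 2.
Proof.
rewrite /achievable => ach mm.
have uVn := unitary_tpow n uV1; have uWn := unitary_tpow n uW1.
have uV2m := unitary_tpow m uV2.
have rn0 k : 0 <= @prodf R d1 r n k by exact: prodf_ge0.
have rn1 : \sum_k @prodf R d1 r n k = 1 by rewrite prodf_sum r1 expr1n.
have tm1 : \sum_k @prodf R d2 t m k = 1 by rewrite prodf_sum t1 expr1n.
have u2 := unitary1 R 2.
move: ach; rewrite !hpow_spf // !tpow_spf // HW_spf /ket0 /ket1 !delta_spf.
rewrite !hsum_spf // !spf_tens.
set g0 := gw beta (batE w) 0.
have g00 : 0 < g0 by exact: gw_gt0.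
(* With l = e^a / g0, the Gibbs mass of the test, at most g0 e^(- beta w - c), is weighted down to
   e^(- tau). *)
pose a := c + beta * w - tau.
pose u (i : 'I_d2) := t i / s2 i.
pose Q (k : 'I_(npow d2 m)) := expR c < @headf R d2 u m0 m k.
pose Pq (k : 'I_(npow d2 m * 2)) := Q (mxtens_unindex k).1 && ((mxtens_unindex k).2 == 1).
have l0 : 0 < expR a / g0 by rewrite divr_gt0 ?expR_gt0.
move=> ach.
have := @TO_converse R beta _ _ _ _ _ _ _ _ _ _ _ Pq (expR a / g0) eps _ _ _ _ _ _ l0 ach.
have -> : \sum_k tfun *%R (@prodf R d2 t m) (fun b => (b == 1)%:R) k * (Pq k)%:R =
    1 - cdfn t llr m0 c.
  transitivity (\sum_k @prodf R d2 t m k * (Q k)%:R).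
    rewrite sum_mxtens; apply: eq_bigr => k _; rewrite sum_ord2 !tfunE /Pq !mxtens_indexK /=.
    by rewrite mulr0 mul0r add0r mulr1 andbT.
  transitivity (\sum_k (@prodf R d2 t m k - @prodf R d2 t m k * (@headf R d2 u m0 m k <= expR c)%R%:R)).
    apply: eq_bigr => k _; rewrite /Q ltNge; case: (_ <= _)%R; rewrite /= ?mulr1 ?mulr0 ?subrr ?subr0 //.
  rewrite sumrB tm1; congr (_ - _).
  rewrite (@sum_prodf_headf R d2 t u m0 m (fun y => (y <= expR c)%R%:R)) //; last first.
    by move=> i ti; rewrite divr_gt0 // gw_gt0.
  by apply: eq_Ex => x; rewrite ler_expR.
have -> : \sum_k gw beta (tfun +%R (@sumf R d2 E2 m) (batE w)) k * (Pq k)%:R =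
   expR (- (beta * w)) * g0 * \sum_k @prodf R d2 s2 m k * (Q k)%:R.
  rewrite sum_mxtens mulr_sumr; apply: eq_bigr => k _.
  rewrite sum_ord2 !gw_tfun !tfunE /Pq !mxtens_indexK /= andbF andbT mulr0 add0r.
  by rewrite gw_sumf gw_bat -/g0; ring.
have -> : \sum_i \sum_j nsq ((dagger (tpow V1 n *t (1%:M : 'M[C]_2)) *m (tpow W1 n *t 1%:M)) j i) *
     (tfun *%R (@prodf R d1 r n) (fun b => (b == 0)%:R) i *
       (expR a / g0 * gw beta (tfun +%R (@sumf R d1 E1 n) (batE w)) j) /
      (tfun *%R (@prodf R d1 r n) (fun b => (b == 0)%:R) i +
        expR a / g0 * gw beta (tfun +%R (@sumf R d1 E1 n) (batE w)) j)) =
   Ex P1 X1 n (fun x => expR a / (expR x + expR a)).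
  rewrite -(ns_tpow V1 W1 r0 (fun i => gw_gt0 beta E1 i) n (fun y => expR a / (y + expR a))).
  rewrite sum_mxtens; apply: eq_bigr => i _; rewrite sum_ord2.
  rewrite [X in _ + X]big1 ?addr0 => [|j _]; last by rewrite tfunE /= mulr0 !mul0r mulr0.
  rewrite sum_mxtens; apply: eq_bigr => j _; rewrite sum_ord2.
  rewrite dagger_tens tensmx_mul dagger1 mulmx1 !tensmxE !mxE /= mulr0 nsq0 mul0r addr0.
  rewrite mulr1 gw_tfun !tfunE /= mulr1 gw_sumf -/g0.
  have := rn0 i; have := @prodf_gt0 R d1 s1 n j (fun i => gw_gt0 beta E1 i).
  have := expR_gt0 a; move: (nsq _) (expR a) (prodf s1 j) (prodf r i) => N ea sj ri ea0 sj0 ri0.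
  have k1 : ri + ea * sj != 0 by rewrite gt_eqF // ltr_wpDl // mulr_gt0.
  have k2 : sj != 0 by rewrite gt_eqF.
  have k3 : g0 != 0 by rewrite gt_eqF.
  have -> : ea / g0 * (sj * g0) = ea * sj by field.
  by field; rewrite k1 k2.
set A := Ex _ _ _ _.
(* For x <= a - tau the weight e^a / (e^x + e^a) is at least 1 - e^(- tau). *)
have hA : cdfn P1 X1 n (a - tau) * (1 - expR (- tau)) <= A.
  rewrite mulrC -ExZ; apply: le_Ex => [x|x]; first exact: nsP_ge0.
  have [xa|_] := leP x (a - tau); last first.
    by rewrite mulr0 divr_ge0 ?expR_ge0 // addr_ge0 ?expR_ge0.
  rewrite mulr1 ler_pdivlMr ?addr_gt0 ?expR_gt0 //.
  have : expR x <= expR a * expR (- tau) by rewrite -expRD ler_expR.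
  have := expR_gt0 x; have := expR_gt0 a; have := expR_gt0 (- tau).
  by move: (expR x) (expR a) (expR (- tau)) => X Y Z *; nra.
(* Markov's inequality for the likelihood ratio of the first m0 copies. *)
have hQ : \sum_k @prodf R d2 s2 m k * (Q k)%:R <= expR (- c).
  have mk : \sum_k @prodf R d2 s2 m k * @headf R d2 u m0 m k = 1.
    apply: markov_headf => //; first by move=> i; exact: gw_gt0.
    by apply: gw_sum1; move: t1; case: (d2) t => // t' /eqP; rewrite big_ord0 eq_sym oner_eq0.
  rewrite -[leRHS]mulr1 -[X in _ <= _ * X]mk.
  rewrite mulr_sumr; apply: ler_sum => k _.
  rewrite mulrCA ler_wpM2l ?prodf_ge0 // => [i|]; first exact/ltW/gw_gt0.
  rewrite expRN; have [q|_] := boolP (Q k); last first.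
    rewrite mulr_ge0 ?invr_ge0 ?expR_ge0 // headf_ge0 // => i.
    by rewrite divr_ge0 // ltW // gw_gt0.
  by rewrite mulrC ler_pdivlMr ?expR_gt0 // mul1r ltW.
have hl : expR a / g0 * (expR (- (beta * w)) * g0 * \sum_k @prodf R d2 s2 m k * (Q k)%:R) <= expR (- tau).
  have -> : expR a = expR c * expR (beta * w) * expR (- tau) by rewrite -!expRD.
  have -> : expR c * expR (beta * w) * expR (- tau) / g0 *
    (expR (- (beta * w)) * g0 * \sum_k @prodf R d2 s2 m k * (Q k)%:R) =
    expR (- tau) * (expR c * \sum_k @prodf R d2 s2 m k * (Q k)%:R).
    rewrite [expR (- (beta * w))]expRN; have := lt0r_neq0 (expR_gt0 (beta * w)); have := lt0r_neq0 g00.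
    by move: (expR c) (expR (beta * w)) (expR _) (\sum_k _) => x1 x2 x3 x4 h1 h2; field; rewrite h1 h2.
  rewrite ler_piMr ?expR_ge0 //; move: hQ; rewrite expRN -ler_pdivlMl ?expR_gt0 //.
  by rewrite mulr1.
have F1 : cdfn P1 X1 n (a - tau) <= 1.
  by apply: cdfn_le1; [exact: nsP_ge0|exact: nsP_sum].
have := expR_gt0 (- tau); have -> : c + beta * w - tau *+ 2 = a - tau by rewrite /a; ring.
move: hA hl F1; rewrite -/(cdfn _ _ _ _).
move: (cdfn P1 X1 n (a - tau)) (cdfn t llr m0 c) (expR (- tau)) A (_ * (_ * _)) => F G z A' l h1 h2 h3 z0 h.
have : 1 - G + A' <= 1 + eps + l.
  apply: h; try exact: unitary_tens.
  - by move=> k; rewrite /tfun mulr_ge0.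
  - rewrite sum_mxtens -[RHS]rn1; apply: eq_bigr => k _.
    by rewrite sum_ord2 !tfunE /= mulr0 mulr1 addr0.
  - rewrite sum_mxtens -[RHS]tm1; apply: eq_bigr => k _.
    by rewrite sum_ord2 !tfunE /= mulr0 mulr1 add0r.
by nra.
Qed.

End OneShot.

(** * Limits of discrete distribution functions *)

Section Asymptotics.
Variable R : realType.
Implicit Types (a b : nat -> R).

Local Notation rt n := (Num.sqrt (n%:R : R)).

Lemma cvgn_le (u : nat -> R) (l e : R) : u @ \oo --> l -> 0 < e ->
  exists N, forall n, (N <= n)%N -> `|u n - l| <= e.
Proof.
move=> /cvgrPdist_le ul e0; have [N _ hN] := ul e e0.
by exists N => n nN; rewrite distrC; exact: hN.
Qed.

Lemma cvgn_intro (u : nat -> R) (l : R) :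
  (forall e, 0 < e -> exists N, forall n, (N <= n)%N -> `|u n - l| <= e) ->
  u @ \oo --> l.
Proof.
move=> h; apply/cvgrPdist_le => e e0; have [N hN] := h e e0.
by exists N => // n nN; rewrite /= distrC; exact: hN.
Qed.

Lemma sqrt_natP n : (0 < n)%N -> 0 < rt n.
Proof. by move=> n0; rewrite sqrtr_gt0 ltr0n. Qed.

Lemma sqrt_cvg (u : nat -> R) (l : R) : u @ \oo --> l ->
  (fun n => Num.sqrt (u n)) @ \oo --> Num.sqrt l.
Proof. by move=> ul; apply: (@cvg_comp _ _ _ u (@Num.sqrt R) _ (nbhs l)) => //; exact: sqrt_continuous. Qed.

Lemma inv_nat_cvg : (fun n => (n%:R : R)^-1) @ \oo --> (0 : R).
Proof. by rewrite -cvg_shiftS; exact: cvg_harmonic. Qed.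

Lemma inv_sqrt_cvg : (fun n => (rt n)^-1) @ \oo --> (0 : R).
Proof.
have := sqrt_cvg inv_nat_cvg; rewrite sqrtr0.
by under eq_fun do rewrite sqrtrV ?ler0n //.
Qed.

Lemma ln_sqrt_cvg : (fun n => ln (n.+1%:R : R) / rt n) @ \oo --> (0 : R).
Proof.
have h0 : (fun n => 8 * Num.sqrt (rt n)^-1) @ \oo --> (0 : R).
  rewrite -[X in _ --> X](mulr0 8); apply: cvgMr; rewrite -[X in _ --> X]sqrtr0.
  exact: sqrt_cvg inv_sqrt_cvg.
apply: (squeeze_cvgr _ (cvg_cst 0) h0).
exists 1%N => // n /= n0.
have rn := sqrt_natP n0.
rewrite divr_ge0 ?ln_ge0 ?ler1n ?sqrtr_ge0 //=.
have q0 : 0 < Num.sqrt (rt n) by rewrite sqrtr_gt0.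
have qq : Num.sqrt (rt n) * Num.sqrt (rt n) = rt n by rewrite -expr2 sqr_sqrtr ?sqrtr_ge0.
have rr : rt n * rt n = n%:R by rewrite -expr2 sqr_sqrtr ?ler0n.
(* Here q = n^(1/4), and n + 1 <= (2 q)^4 gives ln (n + 1) <= 4 (2 q - 1) <= 8 q, against q^2 in the
   denominator. *)
set q := Num.sqrt (rt n) in q0 qq *.
rewrite sqrtrV ?sqrtr_ge0 // -/q -qq invfM mulrA ler_wpM2r ?invr_ge0 ?(ltW q0) //.
rewrite ler_pdivrMr //.
have n2q : n.+1%:R <= (2 * q) ^+ 4.
  have -> : (2 * q) ^+ 4 = 16 * ((q * q) * (q * q)) by ring.
  have h1 : (1 : R) <= n%:R by rewrite ler1n.
  by rewrite qq rr -natr1; move: (n%:R : R) h1 => *; lra.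
have q2 : 0 < 2 * q by rewrite mulr_gt0.
apply: (@le_trans _ _ (ln ((2 * q) ^+ 4))).
  by rewrite ler_ln ?posrE ?exprn_gt0 ?ltr0n.
rewrite lnXn //; have := @le_ln1Dx R (2 * q - 1).
have -> : 1 + (2 * q - 1) = 2 * q by ring.
have -> : -1 < 2 * q - 1 by lra.
by move=> /(_ isT); rewrite -[_ *+ 4]mulr_natr; move: (ln _) => *; lra.
Qed.

Section Cdf.
Variables (T : finType) (p f : T -> R).
Hypotheses (p0 : forall t, 0 <= p t) (p1 : \sum_t p t = 1).
Let D := \sum_t p t * f t.
Let V := \sum_t p t * (f t - D) ^+ 2.

Lemma var_shift : V = \sum_t p t * f t ^+ 2 - D ^+ 2.
Proof.
have E t : p t * (f t - D) ^+ 2 = p t * f t ^+ 2 - 2 * D * (p t * f t) + D ^+ 2 * p t by ring.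
rewrite /V; under eq_bigr => t _ do rewrite E.
by rewrite big_split sumrB /= -!mulr_sumr p1 -/D; ring.
Qed.

(** [clt] is applied at the fixed points z - d/2 and z + d/2, which enclose the moving normalised
    argument; monotonicity does the rest. *)
Lemma cdfn_cvg (k : nat -> nat) (y : nat -> R) z : 0 < V ->
  (forall N, \forall n \near \oo, (N <= k n)%N) ->
  (fun n => (y n - (k n)%:R * D) / (rt (k n) * Num.sqrt V)) @ \oo --> z ->
  (fun n => cdfn p f (k n) (y n)) @ \oo --> ncdf 0 1 z.
Proof.
move=> V0 kinf yz; apply: cvgn_intro => e e0.
have n1 : (0 : R) < 1 by [].
have e2 : 0 < e / 2 by rewrite divr_gt0.
have cont : (ncdf 0 1 : R -> R) @ z --> ncdf 0 1 z by exact: ncdf_continuous.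
move/cvgrPdist_le: cont => /(_ _ e2) /nbhs_ballP[d /= d0 hd].
have dz : 0 < d / 2 by rewrite divr_gt0.
have du : `|ncdf 0 1 z - ncdf 0 1 (z + d / 2)| <= e / 2.
  by apply: hd; rewrite /ball /= opprD addrA subrr sub0r normrN gtr0_norm //; lra.
have dl : `|ncdf 0 1 z - ncdf 0 1 (z - d / 2)| <= e / 2.
  by apply: hd; rewrite /ball /= opprB addrC subrK gtr0_norm //; lra.
have [Nu hu] := clt p0 p1 V0 (z + d / 2) e2.
have [Nl hl] := clt p0 p1 V0 (z - d / 2) e2.
have [Ny hy] := cvgn_le yz dz.
have [Nk _ hk] := kinf (maxn 1 (maxn Nu Nl)).
exists (maxn Ny Nk) => n; rewrite geq_max => /andP[nNy nNk].
have := hk n nNk; rewrite /= !geq_max => /and3P[k0 ku kl].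
have sk : 0 < rt (k n) * Num.sqrt V by rewrite mulr_gt0 ?sqrt_natP // sqrtr_gt0.
move: (hy n nNy); rewrite ler_norml => /andP[y1 y2].
have {}y2 : y n <= (k n)%:R * D + rt (k n) * Num.sqrt V * (z + d / 2).
  move: y2; rewrite lerBlDr ler_pdivrMr // [d / 2 + z]addrC [_ * (rt _ * _)]mulrC; lra.
have {}y1 : (k n)%:R * D + rt (k n) * Num.sqrt V * (z - d / 2) <= y n.
  move: y1; rewrite lerBrDr ler_pdivlMr // [- _ + z]addrC [_ * (rt _ * _)]mulrC; lra.
have := cdfn_mono f p0 (k n) y1; have := cdfn_mono f p0 (k n) y2.
have := hu _ ku; have := hl _ kl; move: du dl; rewrite !ler_norml -Phi_ncdf.
move: (cdfn _ _ _ _) (cdfn _ _ _ _) (cdfn _ _ _ _) (Phi _) (Phi _) (Phi _) => x1 x2 x3 x4 x5 x6.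
by move=> /andP[? ?] /andP[? ?] /andP[? ?] /andP[? ?] ? ?; apply/andP; split; lra.
Qed.

Lemma Ex_degenerate n (g : R -> R) : V = 0 -> Ex p f n g = g (n%:R * D).
Proof.
move=> V0; have fD t : p t != 0 -> f t = D.
  move=> pt; have : p t * (f t - D) ^+ 2 = 0.
    have := V0; rewrite /V => /eqP; rewrite psumr_eq0; last by move=> *; rewrite mulr_ge0 // sqr_ge0.
    by move=> /allP /(_ t); rewrite mem_index_enum => /(_ isT) /eqP.
  by move=> /eqP; rewrite mulf_eq0 (negbTE pt) /= sqrf_eq0 subr_eq0 => /eqP.
elim: n g => [|n IH] g /=; first by rewrite mul0r.
transitivity (\sum_t p t * g (n.+1%:R * D)); last by rewrite -mulr_suml p1 mul1r.
apply: eq_bigr => t _; have [->|pt] := eqVneq (p t) 0; first by rewrite !mul0r.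
by rewrite IH fD // -natr1; congr (_ * g _); ring.
Qed.

Lemma cdfn_vanish n : exists y, forall x, x <= y -> cdfn p f n x = 0.
Proof.
pose B := 1 + \sum_t `|f t|.
have fB t : - B <= f t.
  have : `|f t| <= \sum_t `|f t| by rewrite (bigD1 t) //= lerDl sumr_ge0.
  by have := ler_norm (- f t); rewrite normrN /B; lra.
suff H k c x : x < c - k%:R * B -> Ex p f k (fun s => (c + s <= x)%R%:R) = 0.
  exists (- (n%:R * B) - 1) => x xn; rewrite /cdfn -[RHS](H n 0 x); last by lra.
  by apply: eq_Ex => s; rewrite add0r.
elim: k c => [|k IH] c /=; first by rewrite mul0r subr0 addr0 => h; rewrite leNgt h.
move=> h; rewrite big1 // => t _; rewrite -[RHS](mulr0 (p t)) -[X in _ = _ * X](IH (c + f t)).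
  by congr (_ * _); apply: eq_Ex => s; rewrite addrA.
by have := fB t; move: h; rewrite -natr1; lra.
Qed.

End Cdf.

(* Polya's argument: for monotone functions pointwise one-sided limits give a uniform one-sided bound, on a finite grid of quantiles. *)
Lemma unif_gap (a b : nat -> R -> R) (Psi : R -> R) (g eta : R) :
  (forall n x y, x <= y -> a n x <= a n y) -> (forall n x y, x <= y -> b n x <= b n y) ->
  (forall n x, a n x <= 1) -> (forall n x, 0 <= b n x) ->
  (forall x, (fun n => a n x) @ \oo --> ncdf 0 1 x) ->
  (forall x, (fun n => b n x) @ \oo --> Psi x) ->
  (forall x, ncdf 0 1 x - Psi x <= g) -> 0 <= g -> 0 < eta ->
  exists N, forall n, (N <= n)%N -> forall x, a n x - b n x <= g + eta.
Proof.
move=> am bm a1 b0 ac bc gap g0 eta0.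
have n1 : (0 : R) < 1 by [].
have e4 : 0 < eta / 4 by rewrite divr_gt0.
(* Grid points are the quantiles (i + 1) / (K + 1), with spacing at most eta / 4. *)
pose K := (Num.truncn (4 / eta)).+1.
have hK : (K.+1%:R : R)^-1 <= eta / 4.
  rewrite -[eta / 4]invrK lef_pV2 ?posrE ?invr_gt0 ?ltr0n // invf_div.
  have := ltW (Num.Theory.truncnS_gt (4 / eta)); rewrite -/K => h.
  by apply: le_trans h _; rewrite ler_nat.
have K0 : 0 < (K.+1%:R : R) by rewrite ltr0n.
have xq (i : 'I_K) : exists x, ncdf 0 1 x = i.+1%:R / K.+1%:R :> R.
  by apply: ncdf_inv => //; rewrite divr_gt0 ?ltr0n //= ltr_pdivrMr // mul1r ltr_nat ltnS ltn_ord.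
pose x_ i := projT1 (cid (xq i)).
have xE i : ncdf 0 1 (x_ i) = i.+1%:R / K.+1%:R := projT2 (cid (xq i)).
have ev (i : 'I_K) : exists N, forall n, (N <= n)%N ->
    a n (x_ i) <= ncdf 0 1 (x_ i) + eta / 4 /\ Psi (x_ i) - eta / 4 <= b n (x_ i).
  have [N1 h1] := cvgn_le (ac (x_ i)) e4; have [N2 h2] := cvgn_le (bc (x_ i)) e4.
  exists (maxn N1 N2) => n; rewrite geq_max => /andP[/h1 + /h2].
  by rewrite !ler_norml => /andP[_ ?] /andP[? _]; split; lra.
pose N_ i := projT1 (cid (ev i)).
have hN i n : (N_ i <= n)%N -> _ := projT2 (cid (ev i)) n.
exists (\max_i N_ i)%N => n nN x.
have {}hN i : a n (x_ i) <= i.+1%:R / K.+1%:R + eta / 4 /\ Psi (x_ i) - eta / 4 <= b n (x_ i).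
  by rewrite -xE; apply: hN; apply: leq_trans nN; exact: leq_bigmax.
have stepE (j : nat) : j.+1%:R / K.+1%:R = j%:R / K.+1%:R + K.+1%:R^-1 :> R.
  by rewrite -natr1 mulrDl mul1r.
(* Right of the last grid point, a is at most 1, a single spacing above the last quantile. *)
have [i /= xi|nox] := pickP (fun i : 'I_K => x <= x_ i); last first.
  have i0 : (K.-1 < K)%N by [].
  have xl : x_ (Ordinal i0) <= x by apply/ltW; rewrite ltNge nox.
  have [_ h] := hN (Ordinal i0); have := bm n _ _ xl; have := a1 n x.
  have := gap (x_ (Ordinal i0)); rewrite xE /=.
  have : K%:R / K.+1%:R = 1 - K.+1%:R^-1 :> R.
    by rewrite -(addrK (K.+1%:R^-1) (K%:R / K.+1%:R)) -stepE divff // gt_eqF.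
  rewrite -/K.
  move: (_^-1) hK (a n x) (b n x) (b n _) (Psi _) h.
  by move=> *; lra.
(* The first grid point not left of x bounds a; its predecessor bounds b, or b >= 0 does when there
   is none. *)
have [i0 xi0 imin] := @arg_minnP _ i (fun i => x <= x_ i) (@nat_of_ord K) xi.
have [ha _] := hN i0; have := am n _ _ xi0.
have [z|z] := posnP i0.
  move: ha; rewrite z stepE mul0r add0r; have := b0 n x.
  move: (_^-1) hK (a n x) (a n _) (b n x) => *; lra.
have ip : (i0.-1 < K)%N by apply: leq_ltn_trans (leq_pred _) (ltn_ord i0).
have xl : x_ (Ordinal ip) <= x.
  rewrite leNgt; apply/negP => /ltW /imin /=.
  by rewrite leqNgt prednK // leqnn.
have [_ hb] := hN (Ordinal ip); have := bm n _ _ xl; have := gap (x_ (Ordinal ip)).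
rewrite xE /= prednK //; move: ha; rewrite stepE.
move: (_^-1) hK (_ / _) (a n x) (a n _) (b n x) (b n _) (Psi _) hb => *; lra.
Qed.

End Asymptotics.

(** * Second-order expansion of the optimal rate *)

Section SecondOrder.
Variable R : realType.
Local Notation rt n := (Num.sqrt (n%:R : R)).

Lemma cvg_scale (c l : R) (u : nat -> R) : u @ \oo --> l -> (fun n => c * u n) @ \oo --> c * l.
Proof. by move=> ul; apply: cvgM => //; exact: cvg_cst. Qed.

Lemma cvg_scale0 (c : R) (u : nat -> R) : u @ \oo --> (0 : R) -> (fun n => c * u n) @ \oo --> (0 : R).
Proof. by move=> h; rewrite -[X in _ --> X](mulr0 c); exact: cvg_scale. Qed.

Lemma norm_bounds (x y e : R) : `|x - y| <= e -> y - e <= x /\ x <= y + e.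
Proof. by rewrite ler_norml => /andP[? ?]; split; lra. Qed.

Lemma inf_nat_near (N : nat) : \forall n \near \oo, (N <= n)%N.
Proof. by exists N. Qed.

(* Large enough to absorb the at most (n+1)^d energy types, and o(sqrt n). *)
Definition slack d n : R := d.+1%:R * ln n.+1%:R.

Lemma slack_expR d n : (n.+1 ^ d)%:R * expR (- slack d n) = n.+1%:R^-1.
Proof.
rewrite expRN /slack expRM_natl lnK ?posrE ?ltr0n // natrX exprSr invfM mulrA.
by rewrite divff ?mul1r // expf_neq0 // pnatr_eq0.
Qed.

Lemma slack_cvg d : (fun n => slack d n / rt n) @ \oo --> (0 : R).
Proof.
rewrite /slack; under eq_fun do rewrite -mulrA.
exact: cvg_scale0 (@ln_sqrt_cvg R).
Qed.

Lemma slack_expN d n : expR (- slack d n) <= n.+1%:R^-1.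
Proof.
rewrite -(slack_expR d) -[leLHS]mul1r ler_wpM2r ?expR_ge0 // ler1n.
by rewrite expn_gt0.
Qed.

Lemma inv_natS_cvg : (fun n => (n.+1%:R : R)^-1) @ \oo --> (0 : R).
Proof. exact: cvg_harmonic. Qed.

Lemma rt_sq n : rt n * rt n = n%:R.
Proof. by rewrite -expr2 sqr_sqrtr ?ler0n. Qed.

Lemma cvg_eq_near (u v : nat -> R) (l : R) N : (forall n, (N <= n)%N -> u n = v n) ->
  u @ \oo --> l -> v @ \oo --> l.
Proof.
move=> uv ul; apply: cvg_trans ul; apply: near_eq_cvg.
by exists N => // n nN /=; rewrite uv.
Qed.

Lemma cdfn_cvg_moments (T : finType) (p f : T -> R) D V (k : nat -> nat) (y : nat -> R) z :
  (forall t, 0 <= p t) -> \sum_t p t = 1 -> \sum_t p t * f t = D ->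
  \sum_t p t * (f t - D) ^+ 2 = V -> 0 < V ->
  (forall N, \forall n \near \oo, (N <= k n)%N) ->
  (fun n => (y n - (k n)%:R * D) / (rt (k n) * Num.sqrt V)) @ \oo --> z ->
  (fun n => cdfn p f (k n) (y n)) @ \oo --> ncdf 0 1 z.
Proof. by move=> p0 p1 <- <-; exact: cdfn_cvg. Qed.

Section One.
Variables (T1 : finType) (p1 f1 : T1 -> R).
Hypotheses (p10 : forall t, 0 <= p1 t) (p11 : \sum_t p1 t = 1).
Variables D1 V1 : R.
Hypotheses (D1E : \sum_t p1 t * f1 t = D1) (V1E : \sum_t p1 t * (f1 t - D1) ^+ 2 = V1).
Hypothesis V10 : 0 < V1.

Lemma first_cvg (tau : nat -> R) z : (fun n => tau n / rt n) @ \oo --> (0 : R) ->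
  (fun n => cdfn p1 f1 n (n%:R * D1 + rt n * Num.sqrt V1 * z + tau n)) @ \oo --> ncdf 0 1 z.
Proof.
move=> ht; apply: (@cdfn_cvg_moments T1 p1 f1 D1 V1 id) => //; first exact: inf_nat_near.
have s0 : 0 < Num.sqrt V1 by rewrite sqrtr_gt0.
apply: (@cvg_eq_near (fun n => z + tau n / rt n * (Num.sqrt V1)^-1) _ _ 1).
  move=> n n1; have := lt0r_neq0 (sqrt_natP R n1); have := lt0r_neq0 s0.
  move: (rt n) (n%:R : R) (tau n) (Num.sqrt V1) => a N t b ha hb.
  by field; rewrite ha hb.
rewrite -[X in _ --> X]addr0; apply: cvgD; first exact: cvg_cst.
by under eq_fun do rewrite mulrC; exact: cvg_scale0.
Qed.

Section Two.
Variables (T2 : finType) (p2 f2 : T2 -> R).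
Hypotheses (p20 : forall t, 0 <= p2 t) (p21 : \sum_t p2 t = 1).
Variables D2 V2 : R.
Hypotheses (D2E : \sum_t p2 t * f2 t = D2) (V2E : \sum_t p2 t * (f2 t - D2) ^+ 2 = V2).
Hypotheses (V20 : 0 < V2) (D20 : 0 < D2).
Variables (b1 b2 eps : R) (d : nat).
Hypotheses (A0 : 0 < D1 - b1) (eps01 : 0 < eps < 1).
Local Notation xi := ((V1 / (D1 - b1)) / (V2 / D2)).
Local Notation s := (Num.sqrt xi^-1).
Local Notation q := (qinv (@Sfun R xi^-1) eps).

Definition work n : R := b1 * n%:R + b2 * rt n.
(** n times the expansion of the theorem, with x in place of the quantile and b1, b2 for beta w1,
    beta w2. *)
Definition rate n x : R := (n%:R * (D1 - b1) + rt n * (Num.sqrt V1 * x - b2)) / D2.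
Definition copies n x : nat := Num.truncn (rate n x).

Lemma xi_gt0 : 0 < xi^-1.
Proof. by rewrite invr_gt0 !divr_gt0. Qed.

(** About n (D1 - b1) / D2 output copies are made, so s is the standard deviation of the output
    log-likelihood in units of that of the input. *)
Lemma sE : s = Num.sqrt ((D1 - b1) / D2) * Num.sqrt V2 / Num.sqrt V1.
Proof.
have a0 : 0 <= (D1 - b1) / D2 by rewrite divr_ge0 // ltW.
rewrite -sqrtrM // -sqrtrV ?(ltW V10) // -sqrtrM ?(mulr_ge0 a0 (ltW V20)) //.
congr Num.sqrt; have := lt0r_neq0 V10; have := lt0r_neq0 V20; have := lt0r_neq0 D20; have := lt0r_neq0 A0.
by move=> h1 h2 h3 h4; field; rewrite h1 h2 h3 h4.
Qed.

Lemma rate_cvg x : (fun n => rate n x / n%:R) @ \oo --> (D1 - b1) / D2.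
Proof.
apply: (@cvg_eq_near (fun n => (D1 - b1) / D2 + (Num.sqrt V1 * x - b2) / D2 * (rt n)^-1) _ _ 1).
  move=> n /(sqrt_natP R) /lt0r_neq0 n0; rewrite /rate; have := rt_sq n.
  by move: (rt n) n0 => a a0 <-; field; rewrite a0 lt0r_neq0.
rewrite -[X in _ --> X]addr0; apply: cvgD; first exact: cvg_cst.
exact: cvg_scale0 (@inv_sqrt_cvg R).
Qed.

Lemma rate_large x (K : R) : exists N, forall n, (N <= n)%N -> K <= rate n x.
Proof.
have h0 : 0 < (D1 - b1) / D2 / 2 by rewrite !divr_gt0.
have [N hN] := cvgn_le (rate_cvg x) h0.
pose N' := (Num.truncn (`|K| / ((D1 - b1) / D2 / 2))).+1.
exists (maxn N N') => n; rewrite geq_max => /andP[/hN + nN'].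
have n0 : 0 < (n%:R : R) by rewrite ltr0n; apply: leq_trans nN'.
rewrite ler_norml => /andP[h _].
have {}h : (D1 - b1) / D2 / 2 <= rate n x / n%:R.
  by move: h; move: (rate n x / _) (_ / D2) => *; lra.
move: h; rewrite ler_pdivlMr // => h; apply: le_trans h.
rewrite mulrC -ler_pdivrMr //; apply: le_trans (_ : N'%:R <= _); last by rewrite ler_nat.
apply: le_trans (ltW (Num.Theory.truncnS_gt _)).
by rewrite ler_pM2r ?invr_gt0 // ler_norm.
Qed.

Lemma copies_near x : exists N, forall n, (N <= n)%N ->
  (copies n x)%:R <= rate n x /\ rate n x - 1 <= (copies n x)%:R.
Proof.
by have [N hN] := rate_large x 0; exists N => n /hN; exact: truncn_bounds.
Qed.

Lemma copies_large x K : \forall n \near \oo, (K <= copies n x)%N.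
Proof.
have [N hN] := rate_large x K%:R; exists N => // n /= /hN h.
by rewrite /copies truncn_ge_nat // (le_trans _ h).
Qed.

Lemma copies_err_cvg x (c : R) : (fun n => c * ((copies n x)%:R - rate n x) / rt n) @ \oo --> (0 : R).
Proof.
have [N hN] := copies_near x.
have cc : (fun n => `|c| * (rt n)^-1) @ \oo --> (0 : R).
  exact: cvg_scale0 (@inv_sqrt_cvg R).
have cn : (fun n => - (`|c| * (rt n)^-1)) @ \oo --> (0 : R).
  by rewrite -[X in _ --> X]oppr0; exact: cvgN.
apply: (squeeze_cvgr _ cn cc).
exists (maxn 1 N) => // n /=; rewrite geq_max => /andP[/(sqrt_natP R) n0 /hN [h1 h2]].
rewrite -ler_norml normrM [X in _ * X]gtr0_norm ?invr_gt0 // ler_wpM2r ?invr_ge0 ?(ltW n0) //.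
rewrite normrM ler_piMr // ler_norml; apply/andP; split; lra.
Qed.

Lemma copies_cvg x : (fun n => (copies n x)%:R / n%:R) @ \oo --> (D1 - b1) / D2.
Proof.
apply: (@cvg_eq_near (fun n => rate n x / n%:R + 1 * ((copies n x)%:R - rate n x) / rt n * (rt n)^-1) _ _ 1).
  move=> n /(sqrt_natP R) /lt0r_neq0 n0; have := rt_sq n.
  by move: (rt n) n0 => a a0 <-; field.
rewrite -[X in _ --> X]addr0; apply: cvgD; first exact: rate_cvg.
rewrite -[X in _ --> X](mulr0 0); apply: cvgM; [exact: copies_err_cvg|exact: inv_sqrt_cvg].
Qed.

(** [rate n x] times D2 plus the work is n D1 + sqrt (n V1) x: in input units the shifted output
    log-likelihood is centred at x with standard deviation s. *)
Lemma second_cvg x z :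
  (fun n => cdfn p2 f2 (copies n x) (n%:R * D1 + rt n * Num.sqrt V1 * z - work n))
  @ \oo --> ncdf x s z.
Proof.
have s0 : 0 < s by rewrite sqrtr_gt0 xi_gt0.
rewrite ncdf_scale //; apply: (cdfn_cvg_moments (D := D2) (V := V2)) => //; first exact: copies_large.
have [N hN] := copies_near x.
have [K _ hK] := copies_large x 1.
have v1 : 0 < Num.sqrt V1 by rewrite sqrtr_gt0.
have v2 : 0 < Num.sqrt V2 by rewrite sqrtr_gt0.
have ad : 0 < (D1 - b1) / D2 by rewrite divr_gt0.
apply: (@cvg_eq_near (fun n => (Num.sqrt V1 * (z - x) - D2 * ((copies n x)%:R - rate n x) / rt n)
   * (Num.sqrt ((copies n x)%:R / n%:R))^-1 / Num.sqrt V2) _ _ (maxn 1 K)).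
  move=> n; rewrite geq_max => /andP[n1 /hK k1].
  have n0 := sqrt_natP R n1; have k0 := sqrt_natP R k1.
  rewrite sqrtrM ?ler0n // sqrtrV ?ler0n // /rate /work.
  have := lt0r_neq0 D20; have := lt0r_neq0 v2; have := lt0r_neq0 n0; have := lt0r_neq0 k0.
  rewrite -[n%:R]rt_sq; move: (copies n x)%:R => k.
  move: (Num.sqrt k) (rt n) (Num.sqrt V1) (Num.sqrt V2) => a b c e.
  by move=> ha hb he hg; field; rewrite ha hb he hg.
have -> : (z - x) / s = (Num.sqrt V1 * (z - x) - 0) * (Num.sqrt ((D1 - b1) / D2))^-1 / Num.sqrt V2.
  rewrite sE; have := lt0r_neq0 v1; have := lt0r_neq0 v2.
  have : Num.sqrt ((D1 - b1) / D2) != 0 by rewrite gt_eqF // sqrtr_gt0.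
  by move: (Num.sqrt _) (Num.sqrt V1) (Num.sqrt V2) => a b c ha hc hb; field; rewrite ha hb hc.
apply: cvgM; last exact: cvg_cst.
apply: cvgM.
  apply: cvgB; first exact: cvg_cst.
  exact: copies_err_cvg.
apply: cvgV; first by rewrite gt_eqF // sqrtr_gt0.
exact: sqrt_cvg (copies_cvg x).
Qed.

(** [achievable_of_cdf] needs one e < eps for all y, so the pointwise limits are first made uniform
    by [unif_gap]. *)
Lemma below_rate x : x < q -> exists2 e, 0 <= e < eps & exists N, forall n, (N <= n)%N ->
  forall y, cdfn p1 f1 n (y + slack d n) + (n.+1 ^ d)%:R * expR (- slack d n) <=
    e + cdfn p2 f2 (copies n x) (y - work n).
Proof.
move=> hx; have [g ge hg] := qinv_Sfun_below xi_gt0 eps01 hx.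
case/andP: (eps01) => e0 e1.
pose g' := Num.max g 0.
have g'e : g' < eps by rewrite gt_max ge e0.
have g'0 : 0 <= g' by rewrite le_max lexx orbT.
have eta0 : 0 < (eps - g') / 4 by rewrite divr_gt0 // subr_gt0.
have rtV n : 0 <= rt n * Num.sqrt V1 by rewrite mulr_ge0 ?sqrtr_ge0.
have [||n z|n z|z|z|z|N hN] := @unif_gap R
  (fun n z => cdfn p1 f1 n (n%:R * D1 + rt n * Num.sqrt V1 * z + slack d n))
  (fun n z => cdfn p2 f2 (copies n x) (n%:R * D1 + rt n * Num.sqrt V1 * z - work n))
  (ncdf x s) g' ((eps - g') / 4) _ _ _ _ _ _ _ g'0 eta0.
- by move=> n z1 z2 z12; apply: cdfn_mono => //; rewrite lerD2r lerD2l ler_wpM2l.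
- by move=> n z1 z2 z12; apply: cdfn_mono => //; rewrite lerD2r lerD2l ler_wpM2l.
- exact: cdfn_le1.
- exact: cdfn_ge0.
- exact: first_cvg (slack_cvg d).
- exact: second_cvg.
- by apply: le_trans (hg z) _; rewrite le_max lexx.
have [N2 hN2] := cvgn_le inv_natS_cvg eta0.
(* A quarter of the margin pays for uniform convergence and a quarter for the energy types; half
   keeps e below eps. *)
exists (g' + (eps - g') / 2).
  by apply/andP; split; lra.
exists (maxn 1 (maxn N N2)) => n; rewrite !geq_max => /and3P[n1 /hN h /hN2 h2] y.
rewrite slack_expR.
have c0 : 0 < rt n * Num.sqrt V1 by rewrite mulr_gt0 ?sqrt_natP // sqrtr_gt0.
have {}h := h ((y - n%:R * D1) / (rt n * Num.sqrt V1)).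
move: h; have -> : n%:R * D1 + rt n * Num.sqrt V1 * ((y - n%:R * D1) / (rt n * Num.sqrt V1)) = y.
  by rewrite mulrCA divff ?mulr1 ?gt_eqF // addrC subrK.
move: h2; rewrite subr0 ler_norml => /andP[_].
by move: (cdfn _ _ _ _) (cdfn _ _ _ _) (_^-1) => *; lra.
Qed.

(** Here a single point z with gap above eps is enough, and c is its unnormalised threshold. *)
Lemma above_rate x : q < x -> exists N, forall n, (N <= n)%N -> exists c,
  cdfn p2 f2 (copies n x) c + eps + expR (- slack d n) *+ 2 <
  cdfn p1 f1 n (c + work n - slack d n *+ 2).
Proof.
move=> hx; have [z hz] := qinv_Sfun_above xi_gt0 eps01 hx.
(* Four parts g cover the two limits and the doubled exponential; the fifth keeps the inequality
   strict. *)
have [g [g0 hg]] : exists g, 0 < g /\ eps + 5 * g <= ncdf 0 1 z - ncdf x s z.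
  exists ((ncdf 0 1 z - ncdf x s z - eps) / 5); split; first by rewrite divr_gt0 // subr_gt0.
  by move: (ncdf _ _ _) (ncdf _ _ _) => *; lra.
have t2 : (fun n => - (slack d n *+ 2) / rt n) @ \oo --> (0 : R).
  have e n : -2 * (slack d n / rt n) = - (slack d n *+ 2) / rt n by ring.
  by under eq_fun do rewrite -e; exact: cvg_scale0 (slack_cvg d).
have [N1 h1] := cvgn_le (first_cvg (z := z) t2) g0.
have [N2 h2] := cvgn_le (@second_cvg x z) g0.
have [N3 h3] := cvgn_le inv_natS_cvg g0.
exists (maxn N1 (maxn N2 N3)) => n; rewrite !geq_max => /and3P[/h1 {}h1 /h2 {}h2 /h3 {}h3].
exists (n%:R * D1 + rt n * Num.sqrt V1 * z - work n); rewrite subrK.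
have [l1 _] := norm_bounds h1; have [_ l2] := norm_bounds h2; have [_ l3] := norm_bounds h3.
rewrite add0r in l3; have l4 := slack_expN d n; move: hg l1 l2 l3 l4.
move: (ncdf 0 1 z) (ncdf x s z) (cdfn p1 _ _ _) (cdfn p2 _ _ _) (expR _) (n.+1%:R^-1).
clear h1 h2 h3 t2 hz; move=> *; lra.
Qed.

(** The supremum is squeezed between the rates at v - h and v + h. The lower one also shows that the
    set is nonempty, the upper one that it is bounded, as [sup] requires. *)
Lemma rate_limit (ach : nat -> nat -> Prop) (v : R) :
  (forall x, x < v -> exists N, forall n, (N <= n)%N -> ach n (copies n x)) ->
  (forall x, v < x -> exists N, forall n, (N <= n)%N -> forall k, ach n k -> (k < copies n x)%N) ->
  (fun n => rt n * (sup [set (m%:R / n%:R) | m in [set m | ach n m]]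
     - ((D1 - b1) / D2 + (Num.sqrt V1 * v - b2) / (rt n * D2)))) @ \oo --> (0 : R).
Proof.
move=> lo up; apply: cvgn_intro => e e0.
have v1 : 0 < Num.sqrt V1 by rewrite sqrtr_gt0.
(* Chosen so that moving x by h changes the scaled rate by e / 2; the other half covers rounding
   down to whole copies. *)
pose h := e * D2 / (2 * Num.sqrt V1).
have h0 : 0 < h by rewrite divr_gt0 // mulr_gt0.
have hE : Num.sqrt V1 * h / D2 = e / 2.
  by rewrite /h; move: (Num.sqrt V1) v1 D2 D20 => a a0 b b0; field; rewrite !gt_eqF.
have [N1 h1] := lo (v - h) ltac:(by rewrite ltrBlDr ltrDl).
have [N2 h2] := up (v + h) ltac:(by rewrite ltrDl).
have [N3 h3] := copies_near (v - h).
have [N4 h4] := copies_near (v + h).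
have e2 : 0 < e / 2 by rewrite divr_gt0.
have [N5 h5] := cvgn_le (@inv_sqrt_cvg R) e2.
exists (maxn 1 (maxn N1 (maxn N2 (maxn N3 (maxn N4 N5))))) => n.
rewrite !geq_max => /and5P[n1 /h1 {}h1 /h2 {}h2 /h3 {}h3 /andP[/h4 {}h4 /h5 {}h5]].
rewrite subr0; have n0 := sqrt_natP R n1; have nn : 0 < (n%:R : R) by rewrite ltr0n.
set S := [set _ | _ in _]; set t := (_ / D2 + _).
have tE x : rt n * (rate n x / n%:R - t) = Num.sqrt V1 * (x - v) / D2.
  rewrite /t /rate; have := rt_sq n; have := lt0r_neq0 n0; have := lt0r_neq0 D20.
  by move: (rt n) => a ha hc <-; field; rewrite ha hc.
have ubS : ubound S (rate n (v + h) / n%:R).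
  move=> _ [k kS <-]; rewrite ler_pM2r ?invr_gt0 //.
  by apply: le_trans h4.1; rewrite ler_nat; apply/ltnW/h2.
have inS : S ((copies n (v - h))%:R / n%:R) by exists (copies n (v - h)).
have supu : sup S <= rate n (v + h) / n%:R by apply: ge_sup => //; exists ((copies n (v - h))%:R / n%:R).
have supl : (copies n (v - h))%:R / n%:R <= sup S.
  by apply: ub_le_sup => //; exists (rate n (v + h) / n%:R).
have {}supl : (rate n (v - h) - 1) / n%:R <= sup S.
  by apply: le_trans supl; rewrite ler_pM2r ?invr_gt0 //; exact: h3.2.
have := tE (v + h); have := tE (v - h).
have -> : v + h - v = h by ring.
have -> : v - h - v = - h by ring.
rewrite mulrN mulNr hE => k1 k2.
have u1 : rt n * (sup S - t) <= rt n * (rate n (v + h) / n%:R - t).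
  by rewrite ler_wpM2l ?(ltW n0) // lerD2r.
have u2 : rt n * ((rate n (v - h) - 1) / n%:R - t) <= rt n * (sup S - t).
  by rewrite ler_wpM2l ?(ltW n0) // lerD2r.
have u3 : rt n * ((rate n (v - h) - 1) / n%:R - t) = rt n * (rate n (v - h) / n%:R - t) - (rt n)^-1.
  have gen (c b a N : R) : a != 0 -> a * a = N -> a * ((b - 1) / N - c) = a * (b / N - c) - a^-1.
    by move=> a0 <-; field.
  exact: gen (lt0r_neq0 n0) (rt_sq n).
move: h5; rewrite subr0 ler_norml => /andP[_ h5].
rewrite ler_norml; move: u1 u2; rewrite u3 k1 k2.
by move: (rt n * (sup S - t)) (_^-1) h5 => a b h5 u1 u2; apply/andP; split; lra.
Qed.

End Two.
End One.
End SecondOrder.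

(** * Work extraction with a thermal target *)

Section WorkExtraction.
Variable R : realType.
Local Notation rt n := (Num.sqrt (n%:R : R)).

(** Takes the infimum of the admissible nonnegative levels at each n; 1 / (n + 1) is added because
    the infimum need not be attained. *)
Lemma diagonal_rate (ok : nat -> R -> Prop) :
  (forall n x y, x <= y -> ok n x -> ok n y) -> (forall n, exists x, ok n x) ->
  (forall x, 0 < x -> exists N, forall n, (N <= n)%N -> ok n x) ->
  exists u : nat -> R, u @ \oo --> (0 : R) /\ forall n, ok n (u n).
Proof.
move=> mono ex ev.
pose S n := [set x | 0 <= x /\ ok n x].
have S0 n : S n !=set0.
  have [x hx] := ex n; exists (Num.max x 0); split; first by rewrite le_max lexx orbT.
  by apply: mono hx; rewrite le_max lexx.
have lbS n : lbound (S n) 0 by move=> x [].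
have hlb n : has_lbound (S n) by exists 0.
exists (fun n => inf (S n) + n.+1%:R^-1); split; last first.
  move=> n; have n0 : 0 < (n.+1%:R : R)^-1 by rewrite invr_gt0 ltr0n.
  have [x [_ okx] xlt] := inf_adherent n0 (conj (S0 n) (hlb n)).
  by apply: mono okx; exact: ltW.
apply: cvgn_intro => e e0; have e2 : 0 < e / 2 by rewrite divr_gt0.
have [N1 h1] := ev _ e2; have [N2 h2] := cvgn_le (@inv_natS_cvg R) e2.
exists (maxn N1 N2) => n; rewrite geq_max => /andP[/h1 k1 /h2 k2].
have l1 : inf (S n) <= e / 2 by apply: ge_inf => //; split => //; exact: ltW.
have l2 : 0 <= inf (S n) by apply: lb_le_inf.
have [_ l3] := norm_bounds k2.
have l4 : 0 <= (n.+1%:R : R)^-1 by rewrite invr_ge0 ler0n.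
rewrite add0r in l3; rewrite subr0 ger0_norm ?addr_ge0 //.
by move: (inf _) (n.+1%:R^-1) l1 l3 => a b h3 h4; lra.
Qed.

Section Bound.
Variables (T : finType) (p f : T -> R) (d : nat) (D V eps : R).
Hypotheses (p0 : forall t, 0 <= p t) (p1 : \sum_t p t = 1).
Hypotheses (DE : \sum_t p t * f t = D) (VE : \sum_t p t * (f t - D) ^+ 2 = V).
Hypothesis eps01 : 0 < eps < 1.
Local Notation q := (qinv (ncdf (0 : R) 1) eps).

(** The hypothesis of [achievable_of_cdf] when the output log-likelihood is constantly 0: its
    distribution function is a step, so m disappears. W stands for beta w. *)
Definition extractable n W := exists e tau, 0 <= e < eps /\
  forall y, cdfn p f n (y + tau) + (n.+1 ^ d)%:R * expR (- tau) <= e + (W <= y)%R%:R.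

Let e0 : 0 < eps. Proof. by case/andP: eps01. Qed.

Lemma extractable_intro n W tau F : 0 <= F < eps ->
  (forall y, y < W -> cdfn p f n (y + tau) <= F) ->
  (n.+1 ^ d)%:R * expR (- tau) <= (eps - F) / 2 -> extractable n W.
Proof.
move=> /andP[F0 Fe] hF hK; exists (F + (eps - F) / 2), tau; split.
  by apply/andP; split; lra.
move=> y; have [Wy|yW] := leP W y.
  rewrite /=; have := cdfn_le1 f p0 p1 n (y + tau); move: (cdfn _ _ _ _) ((n.+1 ^ d)%:R * _) hK => a b *; lra.
by rewrite /=; have := hF y yW; move: (cdfn _ _ _ _) ((n.+1 ^ d)%:R * _) hK => a b *; lra.
Qed.

Definition budget n x : R := n%:R * D + rt n * (Num.sqrt V * q) - x * rt n.

(** [diagonal_rate] needs some level at every n; W is put below the smallest possible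
    log-likelihood, shifted by tau. *)
Lemma extractable_some n : exists x, (0 < n)%N -> forall W, W <= budget n x -> extractable n W.
Proof.
have [y0 hy] := cdfn_vanish p f n.
pose tau := ln (2 * (n.+1 ^ d)%:R / eps).
have K0 : 0 < (n.+1 ^ d)%:R :> R by rewrite ltr0n expn_gt0.
exists ((n%:R * D + rt n * (Num.sqrt V * q) + tau - y0) / rt n) => n0 W hW.
apply: (@extractable_intro n W tau 0); first by rewrite lexx e0.
  move=> y yW; rewrite hy //; move: hW; rewrite /budget divfK ?gt_eqF ?sqrt_natP //; lra.
rewrite subr0 expRN /tau lnK ?posrE ?divr_gt0 ?mulr_gt0 //.
by rewrite invf_div mulrC; move: (_%:R) K0 => K K0; rewrite [leLHS](_ : _ = eps / 2) //; field; rewrite gt_eqF.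
Qed.

Lemma extractable_eventually x : 0 < x ->
  exists N, forall n, (N <= n)%N -> forall W, W <= budget n x -> extractable n W.
Proof.
move=> x0.
have V0 : 0 <= V by rewrite -VE sumr_ge0 // => t _; rewrite mulr_ge0 // sqr_ge0.
have [V1|V1] := eqVneq V 0.
  have e2 : 0 < eps / 2 by rewrite divr_gt0.
  have [N1 h1] := cvgn_le (@inv_natS_cvg R) e2.
  have [N2 h2] := cvgn_le (@slack_cvg R d) x0.
  exists (maxn 1 (maxn N1 N2)) => n; rewrite !geq_max => /and3P[n1 /h1 k1 /h2 k2] W hW.
  have n0 := sqrt_natP R n1.
  apply: (@extractable_intro n W (slack R d n) 0); first by rewrite lexx e0.
    move=> y yW; rewrite /cdfn (Ex_degenerate p0 p1) ?DE ?VE //.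
    suff /negbTE -> : ~~ (n%:R * D <= y + slack R d n)%R by rewrite lexx.
    rewrite -ltNge.
    have [_ l] := norm_bounds k2; move: l; rewrite add0r ler_pdivrMr //.
    move: hW; rewrite /budget V1 sqrtr0 mul0r mulr0 addr0.
    move: (x * rt n) (slack R d n) (n%:R * D) yW => a b c *; lra.
  rewrite slack_expR subr0; have [_] := norm_bounds k1; by rewrite add0r.
have V2 : 0 < V by rewrite lt_def V1 V0.
have sV : 0 < Num.sqrt V by rewrite sqrtr_gt0.
(* The margin x sqrt n moves the threshold strictly below the eps-quantile. *)
pose z := q - x / Num.sqrt V.
have hz : ncdf (0 : R) 1 z < eps.
  by apply: qinv_Phi_below => //; rewrite /z ltrBlDr ltrDl divr_gt0.
set F := ncdf (0 : R) 1 z in hz.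
have F0 : 0 <= F by apply/ltW/ncdf_gt0.
have k0 : 0 < (eps - F) / 4 by rewrite divr_gt0 // subr_gt0.
have [N1 h1] := cvgn_le (@inv_natS_cvg R) k0.
have [N2 h2] := cvgn_le (first_cvg p0 p1 DE VE V2 (z := z) (@slack_cvg R d)) k0.
exists (maxn 1 (maxn N1 N2)) => n; rewrite !geq_max => /and3P[n1 /h1 k1 /h2 k2] W hW.
apply: (@extractable_intro n W (slack R d n) (F + (eps - F) / 4)).
- clear k0 k1 k2 h1 h2; clearbody F; apply/andP; split; lra.
- move=> y yW; have [_ l] := norm_bounds k2; apply: le_trans l; rewrite -/F.
  apply: cdfn_mono => //; rewrite lerD2r; apply: (le_trans (ltW yW)); apply: (le_trans hW).
  rewrite /budget /z le_eqVlt; apply/orP; left; apply/eqP.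
  by have := lt0r_neq0 sV; move: (rt n) => b ha; field.
- rewrite slack_expR; have [_] := norm_bounds k1; rewrite add0r.
  clear k0 k1 k2 h1 h2; clearbody F; move: (n.+1%:R^-1) => *; lra.
Qed.

End Bound.
End WorkExtraction.

(** * Spectral data of states and Hamiltonians *)

Section Spectral.
Variable R : realType.
Local Notation C := (complex R).

Lemma psd_spf n (V : 'M[C]_n) (a : 'I_n -> R) : unitary_mx V -> psd_mx (spf V a) ->
  forall i, 0 <= a i.
Proof.
move=> uV [_ h] i; have := h (col i V).
rewrite colE daggerM.
have -> : dagger (delta_mx i 0 : 'cV[C]_n) *m dagger V *m spf V a *m (V *m delta_mx i 0) =
   (delta_mx 0 i : 'rV[C]_n) *m dg a *m (delta_mx i 0 : 'cV[C]_n).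
  have -> : dagger (delta_mx i 0 : 'cV[C]_n) = delta_mx 0 i.
    apply/matrixP => j k; rewrite daggerE !mxE andbC.
    by case: (_ && _); rewrite ?rmorph1 ?rmorph0.
  rewrite /spf !mulmxA -[_ *m dagger V *m V]mulmxA uV.2 mulmx1.
  by rewrite -[_ *m dagger V *m V]mulmxA uV.2 mulmx1.
by rewrite -rowE -colE !mxE eqxx mulr1n lecR.
Qed.

Lemma qstate_spf n (V : 'M[C]_n) (a : 'I_n -> R) : unitary_mx V -> qstate (spf V a) ->
  (forall i, 0 <= a i) /\ \sum_i a i = 1.
Proof.
move=> uV [h t]; split; first exact: psd_spf h.
by apply: rC_inj; rewrite -(tr_spf a uV) t.
Qed.

(** H is a function of its Gibbs state, namely - ln (Z gamma) / beta, so every eigenbasis of the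
    Gibbs state diagonalises H. *)
Lemma gibbs_diag beta n (H : 'M[C]_n) (V : 'M[C]_n) (s : 'I_n -> R) : 0 < beta ->
  herm_mx H -> unitary_mx V -> gibbs beta H = spf V s ->
  exists E, H = spf V E.
Proof.
move=> b0 hH uV gE; have [U [E [uU HE]]] := herm_diag hH.
pose Z := \sum_j expR (- beta * E j).
pose phi (y : R) := - ln (y * Z) / beta.
exists (phi \o s); rewrite -mfun_spf // -gE HE gibbs_spf // mfun_spf //.
apply: eq_spf => i; rewrite /= /phi /gw -/Z divfK ?gt_eqF ?(gw_sum_gt0 _ _ i) //.
by rewrite expRK; field; exact: lt0r_neq0.
Qed.

Section Incoherent.
Variables (beta : R) (n : nat) (V : 'M[C]_n) (t E : 'I_n -> R).
Hypotheses (uV : unitary_mx V) (t0 : forall i, 0 <= t i).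

Lemma sum_nsP_diag (g : 'I_n * 'I_n -> R) : \sum_x nsP V V t x * g x = \sum_i t i * g (i, i).
Proof.
transitivity (\sum_i \sum_j nsP V V t (i, j) * g (i, j)).
  by rewrite pair_bigA; apply: eq_bigr; case.
apply: eq_bigr => i _; rewrite /nsP /= uV.2 (bigD1 i) //= big1 ?addr0 => [|j /negbTE ji].
  by rewrite mxE eqxx /nsq /= expr1n expr0n addr0 mulr1.
by rewrite mxE ji nsq0 mulr0 mul0r.
Qed.

Lemma relent_incoherent : relent (spf V t) (gibbs beta (spf V E)) = \sum_i t i * llr beta E t i.
Proof.
by rewrite gibbs_spf // relent_ns // => [|i]; [exact: sum_nsP_diag|exact: gw_gt0].
Qed.

Lemma relvar_incoherent : relvar (spf V t) (gibbs beta (spf V E)) =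
  \sum_i t i * llr beta E t i ^+ 2 - (\sum_i t i * llr beta E t i) ^+ 2.
Proof.
rewrite gibbs_spf // relvar_ns // => [|i]; last exact: gw_gt0.
by rewrite !sum_nsP_diag.
Qed.

End Incoherent.
End Spectral.

(** * Assembly of the two statements *)

Lemma main_rate (R : realType) (d1 d2 : nat) (beta : R)
    (U1 W1 : 'M[complex R]_d1) (U2 : 'M[complex R]_d2)
    (E1 r : 'I_d1 -> R) (E2 t : 'I_d2 -> R) (eps w1 w2 : R) :
  unitary_mx U1 -> unitary_mx W1 -> unitary_mx U2 ->
  (forall i, 0 <= r i) -> \sum_i r i = 1 -> (forall i, 0 <= t i) -> \sum_i t i = 1 ->
  0 < eps < 1 ->
  let H1 := spf U1 E1 in let H2 := spf U2 E2 in
  let rho1 := spf W1 r in let rho2 := spf U2 t in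
  let D1 := relent rho1 (gibbs beta H1) in
  let V1 := relvar rho1 (gibbs beta H1) in
  let D2 := relent rho2 (gibbs beta H2) in
  let V2 := relvar rho2 (gibbs beta H2) in
  0 < D2 -> 0 < V2 -> 0 < V1 -> 0 < D1 - beta * w1 ->
  let xi := (V1 / (D1 - beta * w1)) / (V2 / D2) in
  (fun n : nat =>
      Num.sqrt n%:R *
        (Rstar beta H1 H2 rho1 rho2 (w1 * n%:R + w2 * Num.sqrt n%:R) eps n
         - ((D1 - beta * w1) / D2
            + (Num.sqrt V1 * qinv (Sfun (xi^-1)) eps - beta * w2)
              / (Num.sqrt n%:R * D2))))
     @ \oo --> (0 : R).
Proof.
move=> uU1 uW1 uU2 r0 r1 t0 t1 e01 H1 H2 rho1 rho2 D1 V1 D2 V2 D20 V20 V10 A0 xi.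
have gE1 : gibbs beta H1 = spf U1 (gw beta E1) by exact: gibbs_spf.
have P0 := nsP_ge0 U1 W1 r0.
have P1 : \sum_x nsP U1 W1 r x = 1 by exact: nsP_sum.
have D1E : \sum_x nsP U1 W1 r x * nsX r (gw beta E1) x = D1.
  by rewrite /D1 gE1 relent_ns // => i; exact: gw_gt0.
have V1E : \sum_x nsP U1 W1 r x * (nsX r (gw beta E1) x - D1) ^+ 2 = V1.
  rewrite -D1E var_shift // /V1 gE1 relvar_ns // => i; exact: gw_gt0.
have D2E : \sum_i t i * llr beta E2 t i = D2 by rewrite /D2 relent_incoherent.
have V2E : \sum_i t i * (llr beta E2 t i - D2) ^+ 2 = V2.
  by rewrite -D2E var_shift // /V2 relvar_incoherent.
have workE n : beta * (w1 * n%:R + w2 * Num.sqrt n%:R) = work (beta * w1) (beta * w2) n.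
  by rewrite /work; ring.
apply: (rate_limit V10 D20 A0) => x hx.
  have [e /andP[e0 ee] [N hN]] := below_rate P0 P1 D1E V1E V10 t0 t1 D2E V2E V20 D20 (beta * w2) d1 A0 e01 hx.
  exists N => n nN; apply: (achievable_of_cdf uU1 uW1 uU2 r0 r1 t0 t1 e0 ee (tau := slack R d1 n)).
    by case/andP: e01.
  by move=> y; rewrite workE; exact: hN.
have [N hN] := above_rate P0 P1 D1E V1E V10 t0 t1 D2E V2E V20 D20 (beta * w2) d1 A0 e01 hx.
(* The converse is used with m0 = [copies n x] and the actual number k >= m0 of output copies. *)
exists N => n /hN [c hc] k hk; rewrite ltnNge; apply/negP => km.
have := converse_cdf uU1 uW1 uU2 r0 r1 t0 t1 c (slack R d1 n) hk km.
by rewrite workE leNgt hc.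
Qed.

Lemma work_extraction (R : realType) (d1 d2 : nat) (beta : R)
    (U1 W1 : 'M[complex R]_d1) (U2 : 'M[complex R]_d2)
    (E1 r : 'I_d1 -> R) (E2 : 'I_d2 -> R) (eps : R) :
  unitary_mx U1 -> unitary_mx W1 -> unitary_mx U2 -> (0 < d2)%N ->
  (forall i, 0 <= r i) -> \sum_i r i = 1 -> 0 < eps < 1 ->
  let H1 := spf U1 E1 in let H2 := spf U2 E2 in let rho1 := spf W1 r in
  let D1 := relent rho1 (gibbs beta H1) in
  let V1 := relvar rho1 (gibbs beta H1) in
  exists g : nat -> R,
     (fun n : nat => Num.sqrt n%:R * g n) @ \oo --> (0 : R) /\
     forall (n m : nat) (w : R), (0 < n)%N ->
       beta * w / n%:R <= D1 + Num.sqrt (V1 / n%:R) * qinv (@Phi R) eps + g n ->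
       achievable beta H1 H2 rho1 (gibbs beta H2) w eps n m.
Proof.
move=> uU1 uW1 uU2 d20 r0 r1 e01 H1 H2 rho1 D1 V1.
have gE1 : gibbs beta H1 = spf U1 (gw beta E1) by exact: gibbs_spf.
have P0 := nsP_ge0 U1 W1 r0.
have P1 : \sum_x nsP U1 W1 r x = 1 by exact: nsP_sum.
have D1E : \sum_x nsP U1 W1 r x * nsX r (gw beta E1) x = D1.
  by rewrite /D1 gE1 relent_ns // => i; exact: gw_gt0.
have V1E : \sum_x nsP U1 W1 r x * (nsX r (gw beta E1) x - D1) ^+ 2 = V1.
  rewrite -D1E var_shift // /V1 gE1 relvar_ns // => i; exact: gw_gt0.
pose ok n x := (0 < n)%N -> forall W, W <= budget D1 V1 eps n x ->
  extractable (nsP U1 W1 r) (nsX r (gw beta E1)) d1 eps n W.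
have [||x x0|u [u0 hu]] := @diagonal_rate R ok.
- move=> n x y xy h n0 W hW; apply: h => //; apply: le_trans hW _.
  by rewrite /budget lerD2l lerN2 ler_wpM2r ?sqrtr_ge0.
- by move=> n; exact: extractable_some.
- have [N hN] := extractable_eventually d1 P0 P1 D1E V1E e01 x0.
  by exists N => n /hN h _ W; exact: h.
(* [budget] subtracts u n sqrt n from the work; division by n gives this correction. *)
exists (fun n => - u n / Num.sqrt n%:R); split.
  apply: (@cvg_eq_near R (fun n => -1 * u n) _ 0 1); last exact: cvg_scale0.
  by move=> n /(sqrt_natP R) n0; rewrite mulrCA divff ?gt_eqF // mulr1 mulN1r.
move=> n m w n0 hw.
have rn := sqrt_natP R n0.
have hW : beta * w <= budget D1 V1 eps n (u n).
  move: hw; rewrite ler_pdivrMr ?ltr0n // => /le_trans; apply.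
  rewrite sqrtrM; last by rewrite -V1E sumr_ge0 // => x _; rewrite mulr_ge0 // sqr_ge0.
  rewrite sqrtrV ?ler0n // /budget Phi_ncdf le_eqVlt; apply/orP; left; apply/eqP.
  have := rt_sq R n; have := lt0r_neq0 rn.
  by move: (Num.sqrt n%:R) (Num.sqrt V1) (qinv _ _) => a b c ha <-; field.
have [e [tau [/andP[e0 ee] h]]] := hu n n0 _ hW.
rewrite [gibbs beta H2]gibbs_spf //.
apply: (achievable_of_cdf uU1 uW1 uU2 r0 r1 _ _ e0 ee (tau := tau)).
- by move=> i; exact/ltW/gw_gt0.
- exact: gw_sum1.
- by case/andP: e01.
(* A Gibbs target has all likelihood ratios equal to 1, for every number m of copies. *)
move=> y; have -> : cdfn (gw beta E2) (llr beta E2 (gw beta E2)) m (y - beta * w) =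
    (beta * w <= y)%R%:R; last exact: h.
have -> : llr beta E2 (gw beta E2) = fun=> 0.
  by apply: funext => i; rewrite /llr divff ?ln1 // gt_eqF // gw_gt0.
rewrite /cdfn (Ex_degenerate (fun i => ltW (gw_gt0 beta E2 i)) (gw_sum1 beta E2 d20)).
  by rewrite big1 ?mulr0 ?subr_ge0 // => i _; rewrite mulr0.
by rewrite big1 // => i _; rewrite big1 ?subrr ?expr0n ?mulr0 // => j _; rewrite mulr0.
Qed.

Theorem theorem9 (R : realType) (d1 d2 : nat) (beta : R)
    (H1 : 'M[complex R]_d1) (H2 : 'M[complex R]_d2)
    (rho1 : 'M[complex R]_d1) (rho2 : 'M[complex R]_d2) (eps w1 w2 : R) :
  0 < beta -> herm_mx H1 -> herm_mx H2 ->
  qstate rho1 -> qstate rho2 -> 0 < eps < 1 ->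
  let gamma1 := gibbs beta H1 in
  let gamma2 := gibbs beta H2 in
  let D1 := relent rho1 gamma1 in
  let V1 := relvar rho1 gamma1 in
  let D2 := relent rho2 gamma2 in
  let V2 := relvar rho2 gamma2 in
  (* main statement: second-order asymptotics of the optimal rate *)
  (rho2 *m gamma2 = gamma2 *m rho2 ->
   0 < D2 -> 0 < V2 -> 0 < V1 -> 0 < D1 - beta * w1 ->
   let xi := (V1 / (D1 - beta * w1)) / (V2 / D2) in
   let w := fun n : nat => w1 * n%:R + w2 * Num.sqrt n%:R in
   (fun n : nat =>
      Num.sqrt n%:R *
        (Rstar beta H1 H2 rho1 rho2 (w n) eps n
         - ((D1 - beta * w1) / D2
            + (Num.sqrt V1 * qinv (Sfun (xi^-1)) eps - beta * w2)
              / (Num.sqrt n%:R * D2))))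
     @ \oo --> 0)
  /\
  (* moreover: if rho2 = gamma2, any rate is possible below the work bound *)
  (rho2 = gamma2 ->
   exists g : nat -> R,
     (fun n : nat => Num.sqrt n%:R * g n) @ \oo --> 0 /\
     forall (n m : nat) (w : R), (0 < n)%N ->
       beta * w / n%:R <= D1 + Num.sqrt (V1 / n%:R) * qinv (@Phi R) eps + g n ->
       achievable beta H1 H2 rho1 rho2 w eps n m).
Proof.
move=> b0 hH1 hH2 q1 q2 e01 gamma1 gamma2 D1 V1 D2 V2.
have [U1 [E1 [uU1 HE1]]] := herm_diag hH1.
have [W1 [r [uW1 rE]]] := herm_diag q1.1.1.
have [r0 r1] : (forall i, 0 <= r i) /\ \sum_i r i = 1.
  by apply: (qstate_spf uW1); rewrite -rE.
split=> [comm D20 V20 V10 A0 xi w|r2].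
  have hg : herm_mx gamma2.
    have [U [E [uU HE]]] := herm_diag hH2.
    by rewrite /gamma2 HE gibbs_spf //; exact: herm_spf.
  (* rho2 is first diagonalised together with the Gibbs state; [gibbs_diag] then yields the
     Hamiltonian in the same basis. *)
  have [U2 [t [s [uU2 tE sE]]]] := herm_codiag q2.1.1 hg comm.
  have [E2 HE2] := gibbs_diag b0 hH2 uU2 sE.
  have [t0 t1] : (forall i, 0 <= t i) /\ \sum_i t i = 1.
    by apply: (qstate_spf uU2); rewrite -tE.
  have := @main_rate R d1 d2 beta U1 W1 U2 E1 r E2 t eps w1 w2 uU1 uW1 uU2 r0 r1 t0 t1 e01.
  by rewrite -HE1 -HE2 -rE -tE; apply.
have [U2 [E2 [uU2 HE2]]] := herm_diag hH2.
(* A state of trace 1 cannot live in dimension 0. *)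
have d20 : (0 < d2)%N.
  case: d2 H2 rho2 q2 {hH2 gamma2 D2 V2 r2 U2 E2 uU2 HE2} => // H2 rho2 [_].
  by rewrite /mxtrace big_ord0 => /esym/eqP; rewrite oner_eq0.
have := @work_extraction R d1 d2 beta U1 W1 U2 E1 r E2 eps uU1 uW1 uU2 d20 r0 r1 e01.
by rewrite -HE1 -HE2 -rE r2; apply.
Qed.
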